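(* Let $k$ be a field of characteristic $p$, $G$ a profinite group and $B$ a block of $G$ over $k$ with block idempotent $e$. The following are equivalent for a closed subgroup $D$ of $G$: (1) $e\in \mathrm{oTr}_D^G(k[[G]]^D)$ and $D$ is minimal (among closed subgroups of $G$) with this property; (2) $|G:D|_p<\infty$, $e\in \widetilde{\mathrm{Tr}}_D^G(k[[G]]^D)$, and $D$ is minimal among the closed subgroups of $G$ having these two properties; (3) $\delta(D)$ is a vertex of $B$ as a $k[[G\times G]]$-module; (4) $D$ is a pro-$p$ group, $e\in \mathrm{oTr}_D^G(k[[G]]^D)$ and $\mathrm{Br}_D(e)\neq 0$; (5) $D$ is a pro-$p$ group, $\mathrm{Br}_D(e)\neq 0$, and $D$ is maximal among the (closed) pro-$p$ subgroups of $G$ with this property.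
   Context: $k$ is a discrete field of prime characteristic $p$. For a profinite group $G$, $k[[G]]=\varprojlim_N k[G/N]$ ($N$ running over open normal subgroups) is the completed group algebra, and $\varphi_N:k[[G]]\to k[G/N]$ is the canonical projection. There is a unique set $E$ of pairwise orthogonal primitive idempotents of $Z(k[[G]])$ with $k[[G]]=\prod_{e\in E}k[[G]]e$; the $k[[G]]e$ are the blocks of $G$ and the $e\in E$ the block idempotents. Traces. $G$ acts on $k[[G]]$ by conjugation, ${}^g x=gxg^{-1}$; $k[[G]]^H$ denotes the fixed points of a closed subgroup $H$. For closed subgroups $H\le L$ of $G$ with $H$ open in $L$, $\mathrm{Tr}_H^L:k[[G]]^H\to k[[G]]^L$ is $a\mapsto\sum_{g\in L/H}{}^g a$. For $H\le G$ closed, $\mathrm{oTr}_H^G(k[[G]]^H)=\bigcap_{N}\mathrm{Tr}_{HN}^G(k[[G]]^{HN})$, over all open normal subgroups $N$ of $G$. Modified trace. For a natural number write $n=n_p n_{p'}$ with $n_p$ a power of $p$ and $p\nmid n_{p'}$; similarly for the (supernatural) index $|L:H|$ of closed subgroups $H\le L$. If $|L:H|_p$ is finite, let $\mathcal N$ be the (cofinal) set of open normal subgroups $N$ of $G$ with $|LN:HN|_p=|L:H|_p$. The map $\widetilde{\mathrm{Tr}}_H^L:k[[G]]^H\to k[[G]]^L$ sends $x$ to the unique element whose image under $\varphi_N$ is $\frac{1}{|LN:HN|_{p'}}\mathrm{Tr}_{HN/N}^{LN/N}(\varphi_N(x))$ for every $N\in\mathcal N$ (these are compatible, so this is well defined).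 Vertex. A pseudocompact module over a pseudocompact algebra is a topological module $U$ with a basis of neighbourhoods of $0$ of open submodules $V$ of finite codimension, intersecting in $0$, with $U=\varprojlim U/V$. For a profinite group $\Gamma$ and a closed subgroup $H$, a pseudocompact $k[[\Gamma]]$-module $U$ is relatively $H$-projective if, whenever $\beta:V\to W$ is a continuous surjection and $\varphi:U\to W$ a continuous homomorphism of pseudocompact $k[[\Gamma]]$-modules such that $\varphi=\beta\alpha$ for some continuous $k[[H]]$-homomorphism $\alpha:U\to V$, then $\varphi=\beta\alpha'$ for some continuous $k[[\Gamma]]$-homomorphism $\alpha'$. A vertex of a finitely generated indecomposable pseudocompact $k[[\Gamma]]$-module $U$ is a closed subgroup $Q$ of $\Gamma$ such that $U$ is relatively $Q$-projective but not relatively $R$-projective for any proper closed subgroup $R$ of $Q$. The block $B$ is a $k[[G\times G]]$-module via $(g_1,g_2)x=g_1xg_2^{-1}$, and $\delta:G\to G\times G$ is $g\mapsto(g,g)$. Brauer homomorphism. For a closed pro-$p$ subgroup $D$ of $G$, $\mathrm{Br}_D$ is the natural projection $k[[G]]^D\to k[[G]]^D/\overline{\sum_{Q}\mathrm{Tr}_Q^D(k[[G]]^Q)}$, where $Q$ runs over the proper open subgroups of $D$ and the bar denotes closure. *)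

(* Defs.v *)
From HB Require Import structures.
From mathcomp Require Import all_boot all_order all_algebra fingroup.
From mathcomp Require Import all_classical reals topology.
From mathcomp Require Import generic_quotient finmap.

Set Implicit Arguments.
Unset Strict Implicit.
Unset Printing Implicit Defensive.

Import GRing.Theory.
Local Open Scope classical_set_scope.
Local Open Scope ring_scope.
Local Open Scope quotient_scope.

Section AbstractGroups.
Variable T : groupType.
Implicit Types A B H L N : set T.

Definition subgroup H : Prop :=
  [/\ H 1%g, forall x y, H x -> H y -> H (x * y)%g
    & forall x, H x -> H x^-1%g].

Definition normal_in L N : Prop :=
  forall g n, L g -> N n -> N (g * n * g^-1)%g.

Definition setmul A B : set T := [set (a * b)%g | a in A & b in B].

Definition left_cosets L H : set (set T) :=
  [set [set (g * h)%g | h in H] | g in L].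

(** Meaningful only when [L / H] is finite; equal to [0] otherwise. *)
Definition coset_index L H : nat := #|` fset_set (left_cosets L H)|%fset.

(** The relative trace [a |-> \sum_(g in L / H) g a g^-1] in a ring [R]
    receiving a multiplicative map [u] from the group; [xget 1 C] is a chosen
    element of the coset [C].  The sum is over a finite set when [L / H] is
    finite, and independent of the choices when [a] is fixed by [H]. *)
Definition rel_trace (R : pzRingType) (u : T -> R) (H L : set T) (a : R) : R :=
  \sum_(C \in left_cosets L H) u (xget 1%g C) * a * u (xget 1%g C)^-1%g.

End AbstractGroups.

HB.mixin Record isProfinite G of monoid.Group G & Topological G := {
  profinite_mul_continuous : continuous (fun z : G * G => (z.1 * z.2)%g);
  profinite_inv_continuous : continuous (fun x : G => x^-1%g);
  profinite_hausdorff : hausdorff_space G;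
  profinite_compact : compact [set: G];
  profinite_disconnected : totally_disconnected [set: G]
}.

#[short(type="profiniteGroupType")]
HB.structure Definition ProfiniteGroup :=
  {G of monoid.Group G & Topological G & isProfinite G}.

Section ProductProfinite.
Variables G1 G2 : profiniteGroupType.
Local Notation G := (G1 * G2)%type.

Let mulC : continuous (fun z : G * G => (z.1 * z.2)%g).
Proof.
have mul1C : continuous (fun z : G * G => (z.1.1 * z.2.1)%g).
  move=> z; apply: (@continuous_comp _ _ _ (fun z : G * G => (z.1.1, z.2.1))
    (fun w : G1 * G1 => (w.1 * w.2)%g)); last exact: profinite_mul_continuous.
  apply: cvg_pair; apply: (@continuous_comp _ _ _ _ fst);
    by [exact: cvg_fst|exact: cvg_snd].
have mul2C : continuous (fun z : G * G => (z.1.2 * z.2.2)%g).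
  move=> z; apply: (@continuous_comp _ _ _ (fun z : G * G => (z.1.2, z.2.2))
    (fun w : G2 * G2 => (w.1 * w.2)%g)); last exact: profinite_mul_continuous.
  apply: cvg_pair; apply: (@continuous_comp _ _ _ _ snd);
    by [exact: cvg_fst|exact: cvg_snd].
by move=> z; exact: (cvg_pair (mul1C z) (mul2C z)).
Qed.

Let invC : continuous (fun x : G => x^-1%g).
Proof.
have inv1C : continuous (fun x : G => x.1^-1%g).
  move=> x; apply: (@continuous_comp _ _ _ fst (fun w : G1 => w^-1%g)).
    exact: cvg_fst.
  exact: profinite_inv_continuous.
have inv2C : continuous (fun x : G => x.2^-1%g).
  move=> x; apply: (@continuous_comp _ _ _ snd (fun w : G2 => w^-1%g)).
    exact: cvg_snd.
  exact: profinite_inv_continuous.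
by move=> x; exact: (cvg_pair (inv1C x) (inv2C x)).
Qed.

Let hausG : hausdorff_space G.
Proof.
move=> [x1 x2] [y1 y2] cl; congr (_, _).
- apply: (@profinite_hausdorff G1) => A B xA yB.
  have [] := cl (fst @^-1` A) (fst @^-1` B).
  + exact: (@cvg_fst _ _ (nbhs x1) (nbhs x2)).
  + exact: (@cvg_fst _ _ (nbhs y1) (nbhs y2)).
  by move=> [a b] [/= Aa Ba]; exists a.
- apply: (@profinite_hausdorff G2) => A B xA yB.
  have [] := cl (snd @^-1` A) (snd @^-1` B).
  + exact: (@cvg_snd _ _ (nbhs x1) (nbhs x2)).
  + exact: (@cvg_snd _ _ (nbhs y1) (nbhs y2)).
  by move=> [a b] [/= Aa Ba]; exists b.
Qed.

Let compG : compact [set: G].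
Proof.
rewrite -setXTT; apply: compact_setX; exact: profinite_compact.
Qed.

Let discG : totally_disconnected [set: G].
Proof.
move=> [x1 x2] _; rewrite eqEsubset; split; last first.
  by move=> _ ->; exact: connected_component_refl.
move=> [y1 y2] [C [Cx _ cC Cy]]; congr (_, _).
- have : connected_component [set: G1] x1 y1.
    exists (fst @` C); last by exists (y1, y2).
    split=> //; first by exists (x1, x2).
    apply: connected_continuous_connected => //.
    by apply: continuous_subspaceT => z; exact: cvg_fst.
  by rewrite profinite_disconnected.
- have : connected_component [set: G2] x2 y2.
    exists (snd @` C); last by exists (y1, y2).
    split=> //; first by exists (x1, x2).
    apply: connected_continuous_connected => //.
    by apply: continuous_subspaceT => z; exact: cvg_snd.
  by rewrite profinite_disconnected.
Qed.

HB.instance Definition _ := isProfinite.Build G mulC invC hausG compG discG.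

End ProductProfinite.

Record openNormal (G : profiniteGroupType) := OpenNormal {
  on_set :> set G;
  on_subgroup : subgroup on_set;
  on_normal : normal_in [set: G] on_set;
  on_open : open on_set
}.

Section Quotient.
Variables (G : profiniteGroupType) (N : openNormal G).

Let on1 : on_set N 1%g. Proof. by case: (on_subgroup N). Qed.
Let onM x y : on_set N x -> on_set N y -> on_set N (x * y)%g.
Proof. by case: (on_subgroup N) => _ + _; exact. Qed.
Let onV x : on_set N x -> on_set N x^-1%g.
Proof. by case: (on_subgroup N) => _ _; exact. Qed.
Let onJ g x : on_set N x -> on_set N (g * x * g^-1)%g.
Proof. exact: on_normal. Qed.

Definition coset_rel : rel G := fun x y => `[< on_set N (x^-1 * y)%g >].

Let coset_rel_refl : reflexive coset_rel.
Proof. by move=> x; apply/asboolP; rewrite mulVg. Qed.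

Let coset_rel_sym : symmetric coset_rel.
Proof.
suff h x y : coset_rel x y -> coset_rel y x by move=> x y; apply/idP/idP => /h.
by move=> /asboolP/onV; rewrite invMg invgK => ?; exact/asboolP.
Qed.

Let coset_rel_trans : transitive coset_rel.
Proof.
move=> y x z /asboolP xy /asboolP yz; apply/asboolP.
by have := onM xy yz; rewrite mulgA -[(_ * y * _)%g]mulgA mulgV mulg1.
Qed.

Canonical coset_equiv :=
  EquivRel coset_rel coset_rel_refl coset_rel_sym coset_rel_trans.

Definition G_mod := {eq_quot coset_equiv}.

HB.instance Definition _ := Choice.on G_mod.
HB.instance Definition _ := EqQuotient.on G_mod.

Definition to_mod (g : G) : G_mod := \pi g.

Lemma to_modP x y : to_mod x = to_mod y <-> on_set N (x^-1 * y)%g.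
Proof.
split=> [/eqP|h]; first by rewrite (eqmodE coset_equiv) => /asboolP.
by apply/eqP; rewrite (eqmodE coset_equiv); exact/asboolP.
Qed.

Lemma reprK_mod (q : G_mod) : to_mod (repr q) = q.
Proof. exact: reprK. Qed.

Definition mod_one : G_mod := to_mod 1%g.
Definition mod_mul (p q : G_mod) : G_mod := to_mod (repr p * repr q)%g.
Definition mod_inv (q : G_mod) : G_mod := to_mod (repr q)^-1%g.

Let modM x y : mod_mul (to_mod x) (to_mod y) = to_mod (x * y)%g.
Proof.
apply/to_modP; have /to_modP hx := reprK_mod (to_mod x).
have /to_modP hy := reprK_mod (to_mod y).
move: hx hy; set a := repr _; set b := repr _ => hx hy.
have := onM (onJ (b^-1)%g hx) hy; rewrite invgK invMg.
by rewrite !mulgA -[(_ * b * _)%g]mulgA mulgV mulg1.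
Qed.

Let modV x : mod_inv (to_mod x) = to_mod x^-1%g.
Proof.
apply/to_modP; have /to_modP hx := reprK_mod (to_mod x).
move: hx; set a := repr _ => hx.
by have := onJ a (onV hx); rewrite invMg !invgK -!mulgA mulgV mulg1.
Qed.

Let mod_mulA : associative mod_mul.
Proof.
move=> p q r; rewrite -[p]reprK_mod -[q]reprK_mod -[r]reprK_mod.
by rewrite !modM mulgA.
Qed.
Let mod_mul1g : left_id mod_one mod_mul.
Proof. by move=> p; rewrite -[p]reprK_mod modM mul1g. Qed.
Let mod_mulg1 : right_id mod_one mod_mul.
Proof. by move=> p; rewrite -[p]reprK_mod modM mulg1. Qed.
Let mod_mulVg : left_inverse mod_one mod_inv mod_mul.
Proof. by move=> p; rewrite -[p]reprK_mod modV modM mulVg. Qed.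
Let mod_mulgV : right_inverse mod_one mod_inv mod_mul.
Proof. by move=> p; rewrite -[p]reprK_mod modV modM mulgV. Qed.

HB.instance Definition _ :=
  monoid.isGroup.Build G_mod mod_mulA mod_mul1g mod_mulg1 mod_mulVg mod_mulgV.

Lemma to_modM x y : to_mod (x * y)%g = (to_mod x * to_mod y)%g.
Proof. by rewrite -modM. Qed.

Lemma to_modV x : to_mod x^-1%g = (to_mod x)^-1%g.
Proof. by rewrite -modV. Qed.

Lemma to_mod1 : to_mod 1%g = 1%g. Proof. by []. Qed.

Lemma mod_finite : finite_set [set: G_mod].
Proof.
have openq (q : G_mod) : open (to_mod @^-1` [set q]).
  rewrite openE => x xq.
  have cx : continuous (fun y : G => (x^-1 * y)%g).
    move=> y; apply: (@continuous_comp _ _ _ (fun y : G => (x^-1%g, y))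
      (fun z : G * G => (z.1 * z.2)%g)); last exact: profinite_mul_continuous.
    by apply: cvg_pair; [exact: cvg_cst|exact: cvg_id].
  have /continuousP/(_ _ (on_open N)) oN := cx.
  rewrite /interior; suff -> : to_mod @^-1` [set q] =
    (fun y => (x^-1 * y)%g) @^-1` N.
    by apply: open_nbhs_nbhs; split => //=; rewrite mulVg.
  rewrite -xq; apply/seteqP; split => y /=; last by move/to_modP.
  by move=> /esym /to_modP.
pose pG : ptopologicalType := HB.pack (ProfiniteGroup.sort G)
  (ProfiniteGroup.class G) (isPointed.Build G 1%g).
have := @profinite_compact G; rewrite (@compact_cover pG) => cG.
have [] := cG G_mod setT (fun q => to_mod @^-1` [set q]).
- by move=> q _; exact: openq.
- by move=> x _; exists (to_mod x).
move=> D _ DG; apply: (@sub_finite_set _ _ [set` D]); last exact: finite_fset.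
move=> q _; have [r Dr /= rq] := DG (repr q) I.
by rewrite -(reprK_mod q) rq.
Qed.

Definition mod_enum : seq G_mod := fset_set [set: G_mod].

Let mem_mod_enum q : q \in mod_enum.
Proof. by have := in_fset_set mod_finite q; rewrite (mem_set (I : setT q)). Qed.

Let mod_enumP : Finite.axiom mod_enum.
Proof.
by move=> q; rewrite count_uniq_mem ?fset_uniq// mem_mod_enum.
Qed.

Let mod_pickleK : pcancel (fun q => index q mod_enum)
  (fun n => Some (nth mod_one mod_enum n)).
Proof. by move=> q; rewrite nth_index. Qed.

HB.instance Definition _ := Choice_isCountable.Build G_mod mod_pickleK.
HB.instance Definition _ := isFinite.Build G_mod mod_enumP.

End Quotient.

Section ChangeOfQuotient.
Variables (G : profiniteGroupType) (N M : openNormal G).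

(** The projection [G / N -> G / M]; meaningful when [N] is contained in [M]. *)
Definition mod_proj (q : G_mod N) : G_mod M := to_mod M (repr q).

Hypothesis NM : N `<=` M.

Lemma mod_projE g : mod_proj (to_mod N g) = to_mod M g.
Proof.
apply/to_modP; apply: NM; apply/to_modP; exact: reprK_mod.
Qed.

Lemma mod_projM : {morph mod_proj : p q / (p * q)%g}.
Proof.
move=> p q; rewrite -[p]reprK_mod -[q]reprK_mod.
by rewrite -to_modM !mod_projE to_modM.
Qed.

Lemma mod_projV : {morph mod_proj : q / q^-1%g}.
Proof. by move=> q; rewrite -[q]reprK_mod -to_modV !mod_projE to_modV. Qed.

Lemma mod_proj1 : mod_proj 1%g = 1%g.
Proof. exact: mod_projE. Qed.

End ChangeOfQuotient.

Section OpenNormalOps.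
Variables (G : profiniteGroupType).

Program Definition onT : openNormal G := @OpenNormal G setT _ _ _.
Next Obligation. by []. Qed.
Next Obligation. by []. Qed.
Next Obligation. exact: openT. Qed.

Program Definition onI (N M : openNormal G) : openNormal G :=
  @OpenNormal G (N `&` M) _ _ _.
Next Obligation.
move=> N M; have [N1 NMu NV] := on_subgroup N.
have [M1 MMu MV] := on_subgroup M; split => //.
- by move=> x y [Nx Mx] [Ny My]; split; [exact: NMu|exact: MMu].
- by move=> x [Nx Mx]; split; [exact: NV|exact: MV].
Qed.
Next Obligation.
by move=> N M g n Gg [Nn Mn]; split; exact: on_normal.
Qed.
Next Obligation. by move=> N M; apply: openI; exact: on_open. Qed.

Program Definition onX (N : openNormal G) : openNormal (G * G)%type :=
  @OpenNormal (G * G)%type (N `*` N) _ _ _.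
Next Obligation.
move=> N; have [N1 NMu NV] := on_subgroup N; split => //.
- by move=> [x1 x2] [y1 y2] [/= ? ?] [/= ? ?]; split; exact: NMu.
- by move=> [x1 x2] [/= ? ?]; split; exact: NV.
Qed.
Next Obligation.
by move=> N [g1 g2] [n1 n2] _ [/= ? ?]; split; exact: on_normal.
Qed.
Next Obligation.
move=> N.
have -> : N `*` N = fst @^-1` N `&` snd @^-1` N by [].
have c1 : continuous (@fst G G) by move=> z; exact: cvg_fst.
have c2 : continuous (@snd G G) by move=> z; exact: cvg_snd.
by apply: openI; [move/continuousP: c1|move/continuousP: c2]; apply;
  exact: on_open. Qed.

End OpenNormalOps.

Section GroupAlgebra.
Variables (k : fieldType) (gT : finGroupType).

Definition galg := {ffun gT -> k^o}.

HB.instance Definition _ := GRing.Lmodule.on galg.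

Implicit Types x y z : galg.

Definition gdelta (g : gT) : galg := [ffun h => (h == g)%:R].

Definition galg_mul x y : galg :=
  [ffun g => \sum_h x h * y (h^-1 * g)%g].

Let g_mulrA : associative galg_mul.
Proof.
move=> x y z; apply/ffunP => g; rewrite !ffunE.
under eq_bigr => h _ do rewrite ffunE big_distrr /=.
under [RHS]eq_bigr => h _ do rewrite ffunE big_distrl /=.
rewrite [RHS]exchange_big /=; apply: eq_bigr => h _.
rewrite [RHS](reindex_inj (mulgI h)) /=; apply: eq_bigr => l _.
by rewrite mulrA invMg mulKg !mulgA.
Qed.

Let g_mul1r : left_id (gdelta 1%g) galg_mul.
Proof.
move=> x; apply/ffunP => g; rewrite ffunE (bigD1 1%g) //= ffunE eqxx mul1r.
rewrite invg1 mul1g big1 ?addr0 // => h /negPf h1.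
by rewrite ffunE h1 mul0r.
Qed.

Let g_mulr1 : right_id (gdelta 1%g) galg_mul.
Proof.
move=> x; apply/ffunP => g; rewrite ffunE (bigD1 g) //= ffunE mulVg eqxx mulr1.
rewrite big1 ?addr0 // => h /negPf hg.
by rewrite ffunE -eq_mulVg1 hg mulr0.
Qed.

Let g_mulrDl : left_distributive galg_mul +%R.
Proof.
move=> x y z; apply/ffunP => g; rewrite !ffunE -big_split /=.
by apply: eq_bigr => h _; rewrite !ffunE mulrDl.
Qed.

Let g_mulrDr : right_distributive galg_mul +%R.
Proof.
move=> x y z; apply/ffunP => g; rewrite !ffunE -big_split /=.
by apply: eq_bigr => h _; rewrite !ffunE mulrDr.
Qed.

Let g_oner_neq0 : gdelta 1%g != 0.
Proof.
by apply/eqP => /ffunP/(_ 1%g); rewrite !ffunE eqxx; move/eqP; rewrite oner_eq0.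
Qed.

HB.instance Definition _ := GRing.Zmodule_isNzRing.Build galg
  g_mulrA g_mul1r g_mulr1 g_mulrDl g_mulrDr g_oner_neq0.

Fact galg_scalerAl (a : k) (x y : galg) : a *: (x * y) = (a *: x) * y.
Proof.
apply/ffunP => g; rewrite !ffunE scaler_sumr.
by apply: eq_bigr => h _; rewrite ffunE -scalerAl.
Qed.

HB.instance Definition _ := GRing.Lmodule_isLalgebra.Build k galg galg_scalerAl.

Fact galg_scalerAr (a : k) (x y : galg) : a *: (x * y) = x * (a *: y).
Proof.
apply/ffunP => g; rewrite !ffunE scaler_sumr.
by apply: eq_bigr => h _; rewrite ffunE -scalerAr.
Qed.

HB.instance Definition _ := GRing.Lalgebra_isAlgebra.Build k galg galg_scalerAr.

Lemma galg_mulE x y g : (x * y) g = \sum_h x h * y (h^-1 * g)%g.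
Proof. by rewrite ffunE. Qed.

Lemma galg_sumM (M : lmodType k) (F : gT -> M) x y :
  \sum_g (x * y) g *: F g = \sum_s \sum_t (x s * y t) *: F (s * t)%g.
Proof.
under eq_bigr => g _ do rewrite galg_mulE scaler_suml.
rewrite exchange_big /=; apply: eq_bigr => s _.
by rewrite (reindex_inj (mulgI s)) /=; apply: eq_bigr => t _; rewrite mulKg.
Qed.

Lemma gdelta_sum x : x = \sum_g x g *: gdelta g.
Proof.
apply/ffunP => h; rewrite sum_ffunE (bigD1 h) //= !ffunE eqxx big1.
  by rewrite addr0 /GRing.scale /= mulr1.
by move=> g /negPf gh; rewrite !ffunE eq_sym gh scaler0.
Qed.

Lemma sum_gdelta (M : lmodType k) (F : gT -> M) g :
  \sum_h gdelta g h *: F h = F g.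
Proof.
rewrite (bigD1 g) //= ffunE eqxx scale1r big1 ?addr0 // => h /negPf hg.
by rewrite ffunE hg scale0r.
Qed.

Lemma gdelta1 : gdelta 1%g = 1. Proof. by []. Qed.

Lemma gdeltaM g h : gdelta (g * h)%g = gdelta g * gdelta h.
Proof.
rewrite [RHS]gdelta_sum galg_sumM.
under eq_bigr => s _ do under eq_bigr => t _ do rewrite -scalerA.
under eq_bigr => s _ do rewrite -scaler_sumr sum_gdelta.
by rewrite sum_gdelta.
Qed.

End GroupAlgebra.

Section GroupAlgebraMap.
Variables (k : fieldType) (gT hT : finGroupType) (f : gT -> hT).

Definition galg_map (x : galg k gT) : galg k hT :=
  [ffun d => \sum_(c | f c == d) x c].

Lemma galg_map_sum (M : lmodType k) (F : hT -> M) x :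
  \sum_d galg_map x d *: F d = \sum_c x c *: F (f c).
Proof.
rewrite [RHS](partition_big f xpredT) //=; apply: eq_bigr => d _.
rewrite ffunE scaler_suml; apply: eq_bigr => c /eqP ->.
by [].
Qed.

Lemma galg_map_is_linear : linear galg_map.
Proof.
move=> a x y; apply/ffunP => d; rewrite !ffunE scaler_sumr -big_split /=.
by apply: eq_bigr => c _; rewrite !ffunE.
Qed.
HB.instance Definition _ :=
  GRing.isLinear.Build k (galg k gT) (galg k hT) _ galg_map galg_map_is_linear.

Lemma galg_map_delta g : galg_map (gdelta k g) = gdelta k (f g).
Proof.
by rewrite [LHS]gdelta_sum galg_map_sum sum_gdelta.
Qed.

Hypothesis fM : {morph f : a b / (a * b)%g}.

Lemma galg_mapM : {morph galg_map : x y / x * y}.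
Proof.
move=> x y; rewrite [LHS]gdelta_sum [RHS]gdelta_sum galg_map_sum !galg_sumM.
under [RHS]eq_bigr => s _ do under eq_bigr => t _ do rewrite -scalerA.
under [RHS]eq_bigr => s _ do rewrite -scaler_sumr galg_map_sum.
rewrite galg_map_sum; apply: eq_bigr => s _; rewrite scaler_sumr.
by apply: eq_bigr => t _; rewrite scalerA fM.
Qed.

End GroupAlgebraMap.

Record cgalg (k : fieldType) (G : profiniteGroupType) := CGalg {
  cg_proj : forall N : openNormal G, galg k (G_mod N);
  cg_compat : forall N M : openNormal G, N `<=` M ->
    galg_map (@mod_proj G N M) (cg_proj N) = cg_proj M
}.

Section CompletedGroupAlgebra.
Variables (k : fieldType) (G : profiniteGroupType).
Local Notation kG := (cgalg k G).
Implicit Types (x y z : kG) (N M : openNormal G).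

Lemma cgalgP x y : (forall N, cg_proj x N = cg_proj y N) -> x = y.
Proof.
case: x y => [x xP] [y yP] /= xy.
have {}xy : x = y by exact/functional_extensionality_dep.
by subst y; congr CGalg; exact: Prop_irrelevance.
Qed.

HB.instance Definition _ := gen_eqMixin kG.
HB.instance Definition _ := gen_choiceMixin kG.

Program Definition cg_zero : kG := @CGalg k G (fun N => 0) _.
Next Obligation. by move=> N M NM; rewrite linear0. Qed.

Program Definition cg_opp x : kG := @CGalg k G (fun N => - cg_proj x N) _.
Next Obligation. by move=> x N M NM; rewrite linearN /= cg_compat. Qed.

Program Definition cg_add x y : kG :=
  @CGalg k G (fun N => cg_proj x N + cg_proj y N) _.
Next Obligation. by move=> x y N M NM; rewrite linearD /= !cg_compat. Qed.

Program Definition cg_scale (a : k) x : kG :=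
  @CGalg k G (fun N => a *: cg_proj x N) _.
Next Obligation. by move=> a x N M NM; rewrite linearZ /= cg_compat. Qed.

Program Definition cg_mul x y : kG :=
  @CGalg k G (fun N => cg_proj x N * cg_proj y N) _.
Next Obligation.
by move=> x y N M NM; rewrite galg_mapM ?cg_compat//; exact: mod_projM.
Qed.

Program Definition cdelta (g : G) : kG :=
  @CGalg k G (fun N => gdelta k (to_mod N g)) _.
Next Obligation.
by move=> g N M NM; rewrite galg_map_delta mod_projE.
Qed.

Let cg_addA : associative cg_add.
Proof. by move=> x y z; apply: cgalgP => N /=; rewrite addrA. Qed.
Let cg_addC : commutative cg_add.
Proof. by move=> x y; apply: cgalgP => N /=; rewrite addrC. Qed.
Let cg_add0r : left_id cg_zero cg_add.
Proof. by move=> x; apply: cgalgP => N /=; rewrite add0r. Qed.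
Let cg_addNr : left_inverse cg_zero cg_opp cg_add.
Proof. by move=> x; apply: cgalgP => N /=; rewrite addNr. Qed.

HB.instance Definition _ :=
  GRing.isZmodule.Build kG cg_addA cg_addC cg_add0r cg_addNr.

Let cg_mulA : associative cg_mul.
Proof. by move=> x y z; apply: cgalgP => N /=; rewrite mulrA. Qed.
Let cg_mul1r : left_id (cdelta 1%g) cg_mul.
Proof. by move=> x; apply: cgalgP => N /=; rewrite mul1r. Qed.
Let cg_mulr1 : right_id (cdelta 1%g) cg_mul.
Proof. by move=> x; apply: cgalgP => N /=; rewrite mulr1. Qed.
Let cg_mulDl : left_distributive cg_mul +%R.
Proof. by move=> x y z; apply: cgalgP => N /=; rewrite mulrDl. Qed.
Let cg_mulDr : right_distributive cg_mul +%R.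
Proof. by move=> x y z; apply: cgalgP => N /=; rewrite mulrDr. Qed.
Let cg_1neq0 : cdelta 1%g != 0.
Proof.
apply/eqP => /(congr1 (fun x => cg_proj x (onT G))) /= /eqP.
by rewrite [_ == _]oner_eq0.
Qed.

HB.instance Definition _ := GRing.Zmodule_isNzRing.Build kG
  cg_mulA cg_mul1r cg_mulr1 cg_mulDl cg_mulDr cg_1neq0.

Let cg_scaleA a b x : cg_scale a (cg_scale b x) = cg_scale (a * b) x.
Proof. by apply: cgalgP => N /=; rewrite scalerA. Qed.
Let cg_scale1r : left_id 1 cg_scale.
Proof. by move=> x; apply: cgalgP => N /=; rewrite scale1r. Qed.
Let cg_scaleDr : right_distributive cg_scale +%R.
Proof. by move=> a x y; apply: cgalgP => N /=; rewrite scalerDr. Qed.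
Let cg_scaleDl x : {morph cg_scale^~ x : a b / a + b}.
Proof. by move=> a b; apply: cgalgP => N /=; rewrite scalerDl. Qed.

HB.instance Definition _ := GRing.Zmodule_isLmodule.Build k kG
  cg_scaleA cg_scale1r cg_scaleDr cg_scaleDl.

Let cg_scaleAl (a : k) x y : a *: (x * y) = (a *: x) * y.
Proof. by apply: cgalgP => N /=; rewrite scalerAl. Qed.
HB.instance Definition _ := GRing.Lmodule_isLalgebra.Build k kG cg_scaleAl.

Let cg_scaleAr (a : k) x y : a *: (x * y) = x * (a *: y).
Proof. by apply: cgalgP => N /=; rewrite scalerAr. Qed.
HB.instance Definition _ := GRing.Lalgebra_isAlgebra.Build k kG cg_scaleAr.

(** The inverse limit topology, each [k[G / N]] being discrete. *)
Definition cg_nbhs x : set_system kG :=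
  [set A | exists N, [set y | cg_proj y N = cg_proj x N] `<=` A].

HB.instance Definition _ := hasNbhs.Build kG cg_nbhs.

Let cg_nbhs_filter x : ProperFilter (cg_nbhs x).
Proof.
split; first by move=> [N /(_ x erefl)].
split.
- by exists (onT G).
- move=> A B [N NA] [M MB]; exists (onI N M) => y yx; split.
  + by apply: NA => /=; rewrite -!(@cg_compat k G _ (onI N M) N) ?yx// => g [].
  + by apply: MB => /=; rewrite -!(@cg_compat k G _ (onI N M) M) ?yx// => g [].
- by move=> A B AB [N NA]; exists N; exact: subset_trans AB.
Qed.

Let cg_nbhs_singleton x A : cg_nbhs x A -> A x.
Proof. by move=> [N]; exact. Qed.

Let cg_nbhs_nbhs x A : cg_nbhs x A -> cg_nbhs x (cg_nbhs^~ A).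
Proof.
move=> [N NA]; exists N => y /= yx; exists N => z /= zy.
by apply: NA; rewrite /= zy.
Qed.

HB.instance Definition _ := Nbhs_isNbhsTopological.Build kG
  cg_nbhs_filter cg_nbhs_singleton cg_nbhs_nbhs.

Lemma cg_projM x y N : cg_proj (x * y) N = cg_proj x N * cg_proj y N.
Proof. by []. Qed.
Lemma cg_projD x y N : cg_proj (x + y) N = cg_proj x N + cg_proj y N.
Proof. by []. Qed.

End CompletedGroupAlgebra.

Arguments cdelta k {G} g.
Arguments gdelta k {gT} g.

Section Blocks.
Variables (k : fieldType) (G : profiniteGroupType).
Local Notation kG := (cgalg k G).

Definition centre : set kG := [set z | forall x, z * x = x * z].

Definition central_idempotent (e : kG) : Prop := centre e /\ e * e = e.

Definition primitive_central_idempotent (e : kG) : Prop :=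
  [/\ central_idempotent e, e <> 0 &
    forall f f', central_idempotent f -> central_idempotent f' ->
      f * f' = 0 -> e = f + f' -> f = 0 \/ f' = 0].

Definition ideal_of (e : kG) : set kG := [set x * e | x in [set: kG]].

(** The third clause says that the continuous map [x |-> (x e)_e] is a
    bijection from [k[[G]]] onto the product of the [k[[G]]e], [e \in E]; it is
    then a homeomorphism since [k[[G]]] is linearly compact. *)
Definition block_decomposition (E : set kG) : Prop :=
  [/\ forall e, E e -> primitive_central_idempotent e,
      forall e f, E e -> E f -> e <> f -> e * f = 0 &
      forall y : kG -> kG, (forall e, E e -> ideal_of e (y e)) ->
        exists! x, forall e, E e -> x * e = y e].

Record block := Block {
  block_idem : kG;
  block_idemP : exists2 E, block_decomposition E & E block_idem
}.

Lemma block_idem_central (B : block) x : block_idem B * x = x * block_idem B.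
Proof. by case: (block_idemP B) => E [h _ _] /h [[c _] _ _]. Qed.

Lemma block_idemK (B : block) : block_idem B * block_idem B = block_idem B.
Proof. by case: (block_idemP B) => E [h _ _] /h [[_ c] _ _]. Qed.

End Blocks.

Section Bimodule.
Variables (k : fieldType) (G : profiniteGroupType).
Local Notation kG := (cgalg k G).
Local Notation kGG := (cgalg k (G * G)%type).
Implicit Types (a b : kGG) (x y : kG) (N : openNormal G).

Definition mod_fst N (q : G_mod (onX N)) : G_mod N := to_mod N (repr q).1.
Definition mod_snd N (q : G_mod (onX N)) : G_mod N := to_mod N (repr q).2.

Lemma mod_fstE N g : mod_fst (to_mod (onX N) g) = to_mod N g.1.
Proof.
by apply/to_modP; have /to_modP[] := reprK_mod (to_mod (onX N) g).
Qed.
Lemma mod_sndE N g : mod_snd (to_mod (onX N) g) = to_mod N g.2.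
Proof.
by apply/to_modP; have /to_modP[] := reprK_mod (to_mod (onX N) g).
Qed.

Lemma mod_fstM N : {morph @mod_fst N : p q / (p * q)%g}.
Proof.
move=> p q; rewrite -[p]reprK_mod -[q]reprK_mod -to_modM !mod_fstE.
exact: to_modM.
Qed.
Lemma mod_sndM N : {morph @mod_snd N : p q / (p * q)%g}.
Proof.
move=> p q; rewrite -[p]reprK_mod -[q]reprK_mod -to_modM !mod_sndE.
exact: to_modM.
Qed.

(** [(g1, g2)] acts on [k[G / N]] by [u |-> g1 u g2^-1]. *)
Definition two_sided N (q : G_mod (onX N)) (u : galg k (G_mod N)) :=
  gdelta k (mod_fst q) * u * gdelta k (mod_snd q)^-1%g.

Lemma two_sidedM N p q u :
  @two_sided N (p * q)%g u = two_sided p (two_sided q u).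
Proof.
by rewrite /two_sided mod_fstM mod_sndM invMg !gdeltaM !mulrA.
Qed.

Lemma two_sided_is_linear N q : linear (@two_sided N q).
Proof.
move=> c u v; rewrite /two_sided mulrDr mulrDl.
by rewrite -scalerAr -scalerAl.
Qed.
HB.instance Definition _ N q := GRing.isLinear.Build k
  (galg k (G_mod N)) (galg k (G_mod N)) _ (@two_sided N q)
  (@two_sided_is_linear N q).

(** The extension to [k[[G x G]]] of the action [(g1, g2) x = g1 x g2^-1]. *)
Program Definition biact a x : kG :=
  @CGalg k G (fun N => \sum_(q : G_mod (onX N))
                cg_proj a (onX N) q *: two_sided q (cg_proj x N)) _.
Next Obligation.
move=> a x N M NM.
have NM2 : onX N `<=` onX M by move=> [g h] [/= ? ?]; split; exact: NM.
rewrite linear_sum /= -(cg_compat a NM2) galg_map_sum.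
apply: eq_bigr => q _; rewrite linearZ /=; congr (_ *: _).
have mM := mod_projM NM.
rewrite /two_sided !galg_mapM// !galg_map_delta cg_compat//.
rewrite -(reprK_mod q) mod_projE// !mod_fstE !mod_sndE.
by rewrite mod_projV// !mod_projE.
Qed.

Lemma biactA a b x : biact a (biact b x) = biact (a * b) x.
Proof.
apply: cgalgP => N /=; rewrite galg_sumM; apply: eq_bigr => p _.
rewrite linear_sum scaler_sumr; apply: eq_bigr => q _.
by rewrite linearZ /= scalerA two_sidedM.
Qed.

Lemma biact_delta g h x :
  biact (cdelta k (g, h)) x = cdelta k g * x * cdelta k h^-1%g.
Proof.
apply: cgalgP => N /=; rewrite sum_gdelta /two_sided.
by rewrite mod_fstE mod_sndE to_modV.
Qed.

Lemma biact1 x : biact 1 x = x.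
Proof.
have -> : biact 1 x = cdelta k 1%g * x * cdelta k 1%g.
  by have := biact_delta 1%g 1%g x; rewrite invg1.
by rewrite [LHS](mulr1 (1 * x)) mul1r.
Qed.

Lemma biactDr a x y : biact a (x + y) = biact a x + biact a y.
Proof.
apply: cgalgP => N /=; rewrite -big_split; apply: eq_bigr => q _ /=.
by rewrite linearD scalerDr.
Qed.

Lemma biactDl a b x : biact (a + b) x = biact a x + biact b x.
Proof.
apply: cgalgP => N /=; rewrite -big_split; apply: eq_bigr => q _ /=.
by rewrite ffunE scalerDl.
Qed.

Lemma biact_central e a x : centre e -> biact a (x * e) = biact a x * e.
Proof.
move=> ce; apply: cgalgP => N /=; rewrite mulr_suml.
apply: eq_bigr => q _; rewrite -scalerAl; congr (_ *: _).
rewrite /two_sided -!mulrA; congr (_ * (_ * _)).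
rewrite -[mod_snd q]reprK_mod -to_modV.
set g := repr _.
by have /(congr1 (fun z => cg_proj z N)) := ce (cdelta k g^-1%g).
Qed.

Variable B : block k G.
Local Notation e := (block_idem B).

Definition block_mod := set_type (ideal_of e).

HB.instance Definition _ := Choice.on block_mod.
HB.instance Definition _ := Topological.on block_mod.

Let bval (u : block_mod) : kG := set_val u.

Lemma block_modE (u : block_mod) : bval u * e = bval u.
Proof.
have [x _ xe] := set_valP u; rewrite -[bval u]/(val u) -xe -mulrA.
by rewrite block_idemK.
Qed.

Lemma block_mod_subproof x : x * e = x -> x \in ideal_of e.
Proof. by move=> xe; apply/mem_set; exists x. Qed.

Definition bmk x (xe : x * e = x) : block_mod :=
  exist _ x (block_mod_subproof xe).

Lemma block_modP (u v : block_mod) : bval u = bval v -> u = v.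
Proof. exact: val_inj. Qed.

Program Definition b_zero : block_mod := @bmk 0 _.
Next Obligation. by rewrite mul0r. Qed.
Program Definition b_opp (u : block_mod) : block_mod := @bmk (- bval u) _.
Next Obligation. by move=> u; rewrite mulNr block_modE. Qed.
Program Definition b_add (u v : block_mod) : block_mod :=
  @bmk (bval u + bval v) _.
Next Obligation. by move=> u v; rewrite mulrDl !block_modE. Qed.
Program Definition b_scale (a : kGG) (u : block_mod) : block_mod :=
  @bmk (biact a (bval u)) _.
Next Obligation.
move=> a u; rewrite -biact_central ?block_modE//.
exact: block_idem_central.
Qed.

Let b_addA : associative b_add.
Proof. by move=> u v w; apply: block_modP; exact: addrA. Qed.
Let b_addC : commutative b_add.
Proof. by move=> u v; apply: block_modP; exact: addrC. Qed.
Let b_add0r : left_id b_zero b_add.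
Proof. by move=> u; apply: block_modP; exact: add0r. Qed.
Let b_addNr : left_inverse b_zero b_opp b_add.
Proof. by move=> u; apply: block_modP; exact: addNr. Qed.

HB.instance Definition _ :=
  GRing.isZmodule.Build block_mod b_addA b_addC b_add0r b_addNr.

Let b_scaleA a b u : b_scale a (b_scale b u) = b_scale (a * b) u.
Proof. by apply: block_modP; exact: biactA. Qed.
Let b_scale1r : left_id 1 b_scale.
Proof. by move=> u; apply: block_modP; exact: biact1. Qed.
Let b_scaleDr : right_distributive b_scale +%R.
Proof. by move=> a u v; apply: block_modP; exact: biactDr. Qed.
Let b_scaleDl u : {morph b_scale^~ u : a b / a + b}.
Proof. by move=> a b; apply: block_modP; exact: biactDl. Qed.

HB.instance Definition _ := GRing.Zmodule_isLmodule.Build kGG block_mod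
  b_scaleA b_scale1r b_scaleDr b_scaleDl.

End Bimodule.

Definition mod_image (G : profiniteGroupType) (N : openNormal G) (H : set G) :
  set (G_mod N) := to_mod N @` setmul H N.
Arguments mod_image {G} N H _.

Section Traces.
Variables (k : fieldType) (p : nat) (G : profiniteGroupType).
Local Notation kG := (cgalg k G).
Implicit Types (H L D Q : set G) (N : openNormal G) (x y : kG).

Definition closed_subgroup H : Prop := subgroup H /\ closed H.

Definition open_subgroup_in H L : Prop :=
  subgroup H /\ exists2 U : set G, open U & H = L `&` U.

Definition pro_p D : Prop :=
  forall U, open_subgroup_in U D -> normal_in D U ->
    (p.-nat (coset_index D U))%N.

Definition cg_fixed H : set kG :=
  [set x | forall h, H h -> cdelta k h * x * cdelta k h^-1%g = x].

Definition cg_trace H L : kG -> kG := rel_trace (@cdelta k G) H L.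

Definition trace_image H L : set kG := cg_trace H L @` cg_fixed H.

Definition otrace_image H : set kG :=
  \bigcap_(N in [set: openNormal G]) trace_image (setmul H N) [set: G].

Definition index_mod N H L : nat := coset_index (setmul L N) (setmul H N).

(** [n = |L : H|_p], where [|L : H|] is the supernatural number
    [lcm_N |LN : HN|]: when its [p]-part is finite, it is one of the
    [|LN : HN|_p] and is divisible by all of them. *)
Definition is_pindex H L (n : nat) : Prop :=
  (exists N, n = (index_mod N H L)`_p)%N /\
  (forall N, (index_mod N H L)`_p %| n)%N.

Definition finite_pindex H L : Prop := exists n, is_pindex H L n.

Definition pindex_normals H L : set (openNormal G) :=
  [set N | is_pindex H L (index_mod N H L)`_p%N].

(** The modified trace; the element it selects exists and is unique for [x] in
    [k[[G]]^H], [H <= L] closed, when [|L : H|_p] is finite. *)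
Definition modified_trace H L x : kG :=
  xget 0 [set y | forall N, pindex_normals H L N ->
    cg_proj y N = ((index_mod N H L)`_p^')%N%:R^-1 *:
      rel_trace (gdelta k) (mod_image N H) (mod_image N L) (cg_proj x N)].

Definition modified_trace_image H L : set kG :=
  modified_trace H L @` cg_fixed H.

(** The closure of [\sum_Q Tr_Q^D(k[[G]]^Q)], [Q] ranging over the proper open
    subgroups of [D]. *)
Definition brauer_kernel D : set kG :=
  closure [set x | exists (n : nat) (t : 'I_n -> kG),
    (forall i, exists Q, [/\ open_subgroup_in Q D, Q <> D
                           & trace_image Q D (t i)]) /\
    x = \sum_i t i].

(** The Brauer homomorphism; elements of the quotient are cosets in
    [k[[G]]] of the subgroup [brauer_kernel D], so that the zero of the
    quotient is [brauer D 0]. *)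
Definition brauer D x : set kG := [set x + z | z in brauer_kernel D].

Definition minimal_closed (P : set G -> Prop) D : Prop :=
  P D /\ forall D', closed_subgroup D' -> P D' -> D' `<=` D -> D' = D.

Definition maximal_closed (P : set G -> Prop) D : Prop :=
  P D /\ forall D', closed_subgroup D' -> P D' -> D `<=` D' -> D' = D.

End Traces.

(** A module with a topology; no compatibility is required here, see
    [pseudocompact]. *)
#[short(type="preTopModType")]
HB.structure Definition PreTopModule (R : pzRingType) :=
  {M of Topological M & GRing.Lmodule R M}.

HB.instance Definition _ (k : fieldType) (G : profiniteGroupType)
  (B : block k G) := GRing.Lmodule.on (block_mod B).

Section Vertex.
Variables (k : fieldType) (Gamma : profiniteGroupType).
Local Notation kGamma := (cgalg k Gamma).
Implicit Types (U V W : preTopModType kGamma) (H Q : set Gamma).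

Definition submodule U (S : set U) : Prop :=
  [/\ S 0, forall u v, S u -> S v -> S (u + v)
    & forall (a : kGamma) u, S u -> S (a *: u)].

(** Codimension over [k], which acts on [U] through [c |-> c%:A]. *)
Definition finite_codim U (S : set U) : Prop :=
  exists (n : nat) (b : 'I_n -> U), forall u, exists c : 'I_n -> k,
    S (u - \sum_i (c i)%:A *: b i).

(** In the last clause, [s] represents a compatible family in
    [lim_(S in F) U / S]. *)
Definition pseudocompact U : Prop :=
  [/\ continuous (fun z : U * U => z.1 + z.2),
      continuous (fun u : U => - u),
      continuous (fun z : kGamma * U => z.1 *: z.2) &
      exists F : set (set U),
        [/\ forall S, F S -> [/\ submodule S, open S & finite_codim S],
            forall A, nbhs (0 : U) A -> exists2 S, F S & S `<=` A,
            forall u, (forall S, F S -> S u) -> u = 0 &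
            forall s : set U -> U,
              (forall S T, F S -> F T -> S `<=` T -> T (s S - s T)) ->
              exists u, forall S, F S -> S (u - s S)]].

(** [k[[H]]] as a closed subalgebra of [k[[Gamma]]]: the inverse limit of the
    [k[HN / N]], isomorphic to the [k[H / (H `&` N)]]. *)
Definition cg_sub H : set kGamma :=
  [set a | forall (N : openNormal Gamma) (q : G_mod N),
             cg_proj a N q != 0 -> mod_image N H q].

Definition sub_hom H U V (alpha : U -> V) : Prop :=
  (forall u v, alpha (u + v) = alpha u + alpha v) /\
  (forall a u, cg_sub H a -> alpha (a *: u) = a *: alpha u).

Definition rel_projective H U : Prop :=
  forall V W : preTopModType kGamma, pseudocompact V -> pseudocompact W ->
  forall (beta : {linear V -> W}) (phi : {linear U -> W}),
    continuous beta -> set_surj [set: V] [set: W] beta -> continuous phi ->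
    (exists alpha : U -> V, [/\ sub_hom H alpha, continuous alpha
                              & forall u, phi u = beta (alpha u)]) ->
    exists alpha' : {linear U -> V},
      continuous alpha' /\ forall u, phi u = beta (alpha' u).

Definition is_vertex Q U : Prop :=
  [/\ closed_subgroup Q, rel_projective Q U &
      forall R, closed_subgroup R -> R `<` Q -> ~ rel_projective R U].

End Vertex.

Definition delta (G : Type) (g : G) : G * G := (g, g).

(* Main.v *)
(* Let [e] be a block idempotent. The subgroups [D] with [e] in [oTr_D^G] are
   controlled by Rosenberg's lemma: [e Z(k[[G]])] is local by Fitting's lemma in
   the finite quotients, so if [e] is a sum of central elements lying in trace
   ideals, one of the ideals contains [e]. Writing [Tr_D^G(a) e] as a sum over
   [G/D] times the support of [e] shows that [D] may be replaced by
   [D `&` C_G(c)] for some [c] in the support of [e] modulo [N]. Hence a minimal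
   [D] centralises a support point modulo every [N] on which [e] does not
   vanish, and [Br_D(e) <> 0], [D] being pro-[p] since indices prime to [p] are
   invertible in [k]. Conversely, if [Br_P(e) <> 0] then the pro-[p] group [P]
   centralises a support point modulo some [N]; when [e = Tr_D^G(a)], counting
   fixed points modulo [p] gives [P] a fixed point on each [G/DM], and by
   compactness [P] lies in a conjugate of [D]. This gives the equivalence of
   (1), (4) and (5).
   When [e] lies in [oTr_D^G], [|G : D|_p] is finite: counting modulo [p], the
   centraliser of a support point has an orbit of length prime to [p] on each
   [G/DM], which bounds [|G : DM|_p]. Averaging over the layers [DN/DM] of
   index prime to [p] then passes between ordinary and modified traces. The same
   averaging turns a splitting on [delta(D)] into one on [G x G], and
   conversely relative projectivity tested on the permutation modules
   [k[[G]] (x) k[G/DN]] yields the preimages of [e] under the traces. *)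

Require Import Defs.
From HB Require Import structures.
From mathcomp Require Import all_boot all_order all_algebra fingroup pgroup sylow.
From mathcomp Require Import all_classical reals topology.
From mathcomp Require Import finmap.

Set Implicit Arguments.
Unset Strict Implicit.
Unset Printing Implicit Defensive.

Import GRing.Theory.
Local Open Scope classical_set_scope.
Local Open Scope ring_scope.

(** * Profinite spaces and open normal subgroups *)

(** Nothing of finite dimension is available in [k[[G]]] itself, so idempotents and inverses are
    built in each [k[G/N]]. They glue because each is pinned down by a property that makes it unique
    at its level. A trace condition quantifies over all [N], and the support point in [otrace_split]
    must serve every level at once. Only finitely many points exist modulo a given [N], so one level
    below finitely many counterexamples settles it. [H] may have infinite index in [HK], so no
    finite sum averages over [HK/H]. If all the [|HK : HN|] are prime to [p], the averages over
    [HK/HN] agree modulo any submodule modulo which [N] acts trivially, and completeness supplies a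
    limit. One averaging lemma, with congruences modulo [S], thus serves both modified traces and
    relative projectivity. The block is generated by [e] over [k[[G]] (x) 1] and [e] is fixed by
    [delta(G)], so a vector fixed by [delta(G)] is all that is needed to define a homomorphism out
    of the block. Maximality in (5) says nothing directly about traces: a minimal subgroup as in (1)
    is produced by Zorn's lemma and compared with [D] up to conjugacy. *)

Lemma compact_directed (T : topologicalType) (I : Type) (i0 : I)
    (F : I -> set T) (U : set T) :
    compact [set: T] -> (forall i, closed (F i)) ->
    (forall i j, exists l, F l `<=` F i `&` F j) ->
    open U -> (forall x, (forall i, F i x) -> U x) ->
  exists i, F i `<=` U.
Proof.
move=> cT cF dF oU FU; apply: contrapT => /forallNP nFU.
(* If no [F i] lies in [U], the sets [F i] minus [U] generate a proper filter; a cluster point of it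
   lies in every [F i] but not in [U]. *)
pose Fi := filter_from [set: I] (fun i => F i `\` U).
have FiP : ProperFilter Fi.
  apply: filter_from_proper; last first.
    by move=> i _; apply/set0P/eqP; rewrite setD_eq0; exact: nFU.
  apply: filter_from_filter; first by exists i0.
  move=> i j _ _; have [l Fl] := dF i j; exists l => // x [/Fl[? ?] ?].
  by split; split.
have [x [_ clx]] := cT _ FiP filterT.
have Fx i : F i x.
  apply: cF => B /(clx (F i)); apply.
  by exists i => //; exact: subDsetl.
have [] := clx (~` U) U; last by move=> y [].
- by exists i0 => // y [].
- by apply: open_nbhs_nbhs; split => //; exact: FU.
Qed.

(** The intersection [Q] of the clopen sets containing [x] is connected. Normality separates two
    closed pieces of [Q] by disjoint open [U] and [V]; compactness puts some clopen [W] around [x]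
    inside their union, and then [W] meets each of them in a clopen set, so [Q] lies on one side. *)
Lemma totally_disconnected_zero_dimensional (T : topologicalType) :
  compact [set: T] -> hausdorff_space T -> totally_disconnected [set: T] ->
  zero_dimensional T.
Proof.
move=> cT hT dT x y xy; apply: contrapT => nU.
pose I := {U : set T | clopen U /\ U x}.
pose F (i : I) := sval i.
pose i0 : I := exist _ setT (conj clopenT Logic.I).
have cF i : closed (F i) by have [[]] := svalP i.
have dF i j : exists l, F l `<=` F i `&` F j.
  have [ci xi] := svalP i; have [cj xj] := svalP j.
  by exists (exist _ (sval i `&` sval j) (conj (clopenI ci cj) (conj xi xj))).
pose Q := [set z | forall i, F i z].
have Qx : Q x by move=> i; have [] := svalP i.
have Qy : Q y by move=> [U [cU Ux]]; apply: contrapT => Uy; apply: nU; exists U.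
have cQ : closed Q.
  have -> : Q = \bigcap_(i in [set: I]) F i.
    by apply/seteqP; split => z h i; [move=> _|]; exact: h.
  by apply: closed_bigI => i _; exact: cF.
suff conQ : connected Q.
  have : connected_component [set: T] x y by exists Q.
  by rewrite dT// => /= yx; rewrite yx eqxx in xy.
move=> B B0 [C oC BC] [E cE BE].
have cB : closed B by rewrite BE; exact: closedI.
have BQ : B `<=` Q by rewrite BE; exact: subIsetl.
have cQB : closed (Q `\` B).
  suff -> : Q `\` B = Q `&` ~` C by apply: closedI => //; exact: open_closedC.
  by rewrite BC; apply/seteqP; split => z [Qz nz]; split=> // Cz; apply: nz;
    [split|case: Cz].
have /(_ (~` (Q `\` B)))[] := compact_normal hT cT cB.
  apply/set_nbhsP; exists (~` (Q `\` B)); split => //.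
    exact: closed_openC.
  by move=> z Bz [].
move=> O /set_nbhsP[U [oU BU UO]] OB.
pose V := ~` closure O.
have oV : open V by apply: closed_openC; exact: closed_closure.
have UV z : U z -> V z -> False by move=> /UO/subset_closure.
have QUV z : (forall i, F i z) -> (U `|` V) z.
  move=> Qz; have [Bz|nBz] := pselect (B z); first by left; exact: BU.
  by right=> /OB; apply.
have [[W [cW Wx]] /= WUV] := compact_directed i0 cT cF dF (openU oU oV) QUV.
have clWU : clopen (W `&` U).
  case: cW => oW clW; split; first exact: openI.
  suff -> : W `&` U = W `&` ~` V by apply: closedI => //; exact: open_closedC.
  apply/seteqP; split => z [Wz]; first by move=> Uz; split => // /(UV _ Uz).
  by move: (WUV _ Wz) => [].
have clWV : clopen (W `&` V).
  case: cW => oW clW; split; first exact: openI.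
  suff -> : W `&` V = W `&` ~` U by apply: closedI => //; exact: open_closedC.
  apply/seteqP; split => z [Wz]; first by move=> Vz; split => // /UV; apply.
  by move: (WUV _ Wz) => [].
apply/seteqP; split => // z Qz; have [Ux|Vx] := WUV _ Wx.
  have [_ Uz] := Qz (exist _ _ (conj clWU (conj Wx Ux))).
  by apply: contrapT => nBz; move: (UO _ Uz) => /subset_closure/OB; apply.
have [b Bb] := B0.
have [_ Vb] := BQ _ Bb (exist _ _ (conj clWV (conj Wx Vx))).
by have := UV _ (BU _ Bb) Vb.
Qed.

Section OpenNormalBase.
Variable G : profiniteGroupType.
Implicit Types (N M : openNormal G).

Lemma on1 N : on_set N 1%g. Proof. by case: (on_subgroup N). Qed.
Lemma onM N x y : on_set N x -> on_set N y -> on_set N (x * y)%g.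
Proof. by case: (on_subgroup N) => _ + _; exact. Qed.
Lemma onV N x : on_set N x -> on_set N x^-1%g.
Proof. by case: (on_subgroup N) => _ _; exact. Qed.
Lemma onJ N g x : on_set N x -> on_set N (g * x * g^-1)%g.
Proof. exact: on_normal. Qed.
Lemma to_mod_on N n : on_set N n -> to_mod N n = 1%g.
Proof. by move=> Nn; rewrite -to_mod1; apply/to_modP; rewrite mulg1; exact: onV. Qed.

Lemma continuous_mulg (T : topologicalType) (f g : T -> G) :
  continuous f -> continuous g -> continuous (fun x => (f x * g x)%g).
Proof.
move=> cf cg x; apply: (@continuous_comp _ _ _ (fun x => (f x, g x))
  (fun z : G * G => (z.1 * z.2)%g)); last exact: profinite_mul_continuous.
by apply: cvg_pair; [exact: cf|exact: cg].
Qed.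

Lemma continuous_invg (T : topologicalType) (f : T -> G) :
  continuous f -> continuous (fun x => (f x)^-1%g).
Proof.
move=> cf x; apply: (@continuous_comp _ _ _ f (fun z : G => z^-1%g)).
  exact: cf.
exact: profinite_inv_continuous.
Qed.

Lemma closed_image (T : topologicalType) (f : T -> G) (A : set T) :
  compact [set: T] -> continuous f -> closed A -> closed (f @` A).
Proof.
move=> cT cf cA; apply: compact_closed; first exact: profinite_hausdorff.
apply: continuous_compact; first exact: continuous_subspaceT.
exact: subclosed_compact cA cT _.
Qed.

(* Van Dantzig: the open normal subgroup is the set of [x] all of whose
   conjugates map a clopen neighbourhood of [1] into itself on the right. *)
Lemma open_normal_base (U : set G) : nbhs 1%g U ->
  exists N : openNormal G, on_set N `<=` U.
Proof.
have cG := @profinite_compact G; have hG := @profinite_hausdorff G.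
have zG := totally_disconnected_zero_dimensional cG hG
  (@profinite_disconnected G).
move=> /(zero_dimensional_cvg hG zG cG)[W [W1 [oW cW]] WU].
have cG2 : compact [set: G * G] by rewrite -setXTT; exact: compact_setX.
have cG3 : compact [set: G * G * G] by rewrite -setXTT; exact: compact_setX.
pose T : topologicalType := (G * G * G)%type.
have c1 : continuous (fun t : T => t.1.1).
  by move=> t; apply: (@continuous_comp _ _ _ fst fst); exact: cvg_fst.
have c2 : continuous (fun t : T => t.1.2).
  move=> t; apply: (@continuous_comp _ _ _ fst snd);
  by [exact: cvg_fst|exact: cvg_snd].
have c3 : continuous (fun t : T => t.2) by move=> t; exact: cvg_snd.
pose f (t : T) := (t.1.1 * (t.1.2 * t.2 * t.1.2^-1))%g.
pose f' (t : T) := (t.1.1 * (t.1.2 * t.2^-1 * t.1.2^-1))%g.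
have cf : continuous f.
  by do !apply: continuous_mulg => //; exact: continuous_invg.
have cf' : continuous f'.
  by do !apply: continuous_mulg => //; exact: continuous_invg.
pose N : set G := [set x | forall u g, W u ->
  W (u * (g * x * g^-1))%g /\ W (u * (g * x^-1 * g^-1))%g].
have sN : subgroup N.
  split=> [u g Wu|x y Nx Ny u g Wu|x Nx u g Wu].
  - by rewrite invg1 mulg1 mulgV mulg1.
  - have [Wx _] := Nx u g Wu; have [Wxy _] := Ny _ g Wx.
    have [_ Wy] := Ny u g Wu; have [_ Wyx] := Nx _ g Wy.
    split; [move: Wxy|move: Wyx]; rewrite ?invMg -!mulgA.
      by rewrite [(g^-1 * (g * _))%g]mulgA mulVg mul1g.
    by rewrite [(g^-1 * (g * _))%g]mulgA mulVg mul1g.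
  - by have [? ?] := Nx u g Wu; rewrite invgK.
have nN : normal_in [set: G] N.
  move=> h x _ Nx u g Wu; have := Nx u (g * h)%g Wu.
  by rewrite !invMg invgK -!mulgA.
have oN : open N.
  (* The complement of [N] is the projection of a closed subset of the compact space [G * G * G],
     hence closed. *)
  suff -> : N = ~` (snd @` ([set t : T | W t.1.1] `&` (f @^-1` (~` W) `|`
      f' @^-1` (~` W)))).
    apply: closed_openC; apply: (closed_image (f := fun t : T => t.2)) => //.
    apply: closedI; first by apply: preimage_closed cW => ? _; exact: c1.
    apply: closedU; apply: preimage_closed (open_closedC oW) => ? _;
      by [exact: cf|exact: cf'].
  apply/seteqP; split=> x.
    by move=> Nx [[[u g] y] [/= Wu nW] yx]; subst y; have [? ?] := Nx u g Wu;
      case: nW.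
  move=> nx u g Wu; apply: contrapT => /not_andP nW; apply: nx.
  by exists (u, g, x) => //; split.
exists (OpenNormal sN nN oN) => x Nx; apply: WU.
by have [] := Nx 1%g 1%g W1; rewrite mul1g invg1 mulg1 mul1g.
Qed.

End OpenNormalBase.

(** * Cosets and sums over cosets *)

Section Cosets.
Variable T : groupType.
Implicit Types (L H K : set T) (g h : T).

Definition lcos g H : set T := [set (g * h)%g | h in H].

Lemma subgroupT : subgroup [set: T]. Proof. by []. Qed.

Lemma subgroupI L H : subgroup L -> subgroup H -> subgroup (L `&` H).
Proof.
move=> [L1 LM LV] [H1 HM HV]; split; first by split.
  by move=> x y [? ?] [? ?]; split; [exact: LM|exact: HM].
by move=> x [? ?]; split; [exact: LV|exact: HV].
Qed.

Section WithSubgroup.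
Variables (L H : set T).
Hypotheses (sL : subgroup L) (sH : subgroup H) (HL : H `<=` L).

Lemma subgroup1 : H 1%g. Proof. by case: sH. Qed.
Lemma subgroupM g h : H g -> H h -> H (g * h)%g.
Proof. by case: sH => _ HM _; exact: HM. Qed.
Lemma subgroupV g : H g -> H g^-1%g. Proof. by case: sH => _ _; exact. Qed.

Lemma lcosP g h : lcos g H = lcos h H <-> H (g^-1 * h)%g.
Proof.
split=> [gh|Hgh].
  have : lcos h H h by exists 1%g; rewrite ?mulg1//; exact: subgroup1.
  by rewrite -gh => -[x Hx <-]; rewrite mulKg.
apply/seteqP; split=> _ [x Hx <-].
  exists ((g^-1 * h)^-1 * x)%g; last by rewrite invMg invgK !mulgA mulgV mul1g.
  by apply: subgroupM => //; exact: subgroupV.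
exists ((g^-1 * h) * x)%g; first exact: subgroupM.
by rewrite !mulgA mulgV mul1g.
Qed.

Lemma xget_lcos g : exists2 h, H h & xget 1%g (lcos g H) = (g * h)%g.
Proof.
have [] := @xgetI _ 1%g (lcos g H) g.
  by exists 1%g; [exact: subgroup1|rewrite mulg1].
by move=> h Hh <-; exists h.
Qed.

Lemma left_cosets_xget C : left_cosets L H C ->
  L (xget 1%g C) /\ C = lcos (xget 1%g C) H.
Proof.
move=> [g Lg <-]; rewrite -/(lcos g H).
have [h Hh ->] := xget_lcos g; split.
  by have [_ LM _] := sL; apply: LM => //; exact: HL.
by apply/lcosP; rewrite mulKg.
Qed.

(** Coset representatives are opaque choices; a labelling [phi] whose fibres are exactly the cosets
    allows sums to be reindexed without knowing them. *)
Lemma coset_bij (X : choiceType) (phi : T -> X) :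
    (forall g h, L g -> L h -> phi g = phi h <-> H (g^-1 * h)%g) ->
  set_bij (left_cosets L H) (phi @` L) (fun C => phi (xget 1%g C)).
Proof.
move=> phiP; split.
- by move=> C /left_cosets_xget[LC _]; exists (xget 1%g C).
- move=> C C' /set_mem/left_cosets_xget[LC ->] /set_mem/left_cosets_xget[LC' ->].
  have [h Hh ->] := xget_lcos (xget 1%g C).
  have [h' Hh' ->] := xget_lcos (xget 1%g C').
  have [_ LM LV] := sL.
  move=> /phiP -/(_ (LM _ _ LC (HL Hh)) (LM _ _ LC' (HL Hh'))).
  rewrite invMg -!mulgA => H1; apply/lcosP.
  have := subgroupM Hh (subgroupM H1 (subgroupV Hh')).
  by rewrite -!mulgA mulgV mulg1 !mulgA mulgV mul1g.
- move=> _ [g Lg <-]; exists (lcos g H); first by exists g.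
  have [h Hh e] := xget_lcos g; rewrite e.
  have [_ LM LV] := sL; apply/phiP => //; first by apply: LM => //; exact: HL.
  by rewrite invMg -mulgA mulVg mulg1; exact: subgroupV.
Qed.

End WithSubgroup.

(** [rel_trace] is by conversion the case where [F g] is the conjugate of [a] by [g]. *)
Definition csum (M : nmodType) L H (F : T -> M) : M :=
  \sum_(C \in left_cosets L H) F (xget 1%g C).

End Cosets.

(* Coset representatives are chosen by [xget]; sums over them are compared
   modulo an additive subgroup [S], so that [F] need be invariant only up to
   [S]. *)
Section CosetSums.
Variables (T : groupType) (M : zmodType) (S : set M).
Hypotheses (S0 : S 0) (SB : forall x y, S x -> S y -> S (x - y)).

Lemma addset_opp x : S x -> S (- x).
Proof. by move=> Sx; rewrite -sub0r; exact: SB. Qed.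
Lemma addset_add x y : S x -> S y -> S (x + y).
Proof. by move=> Sx /addset_opp Sy; rewrite -[y]opprK; exact: SB. Qed.
Lemma addset_trans y x z : S (x - y) -> S (y - z) -> S (x - z).
Proof. by move=> xy yz; have := addset_add xy yz; rewrite addrA subrK. Qed.
Lemma addset_sym x y : S (x - y) -> S (y - x).
Proof. by move/addset_opp; rewrite opprB. Qed.

Lemma fsum_congr (I : choiceType) (A : set I) (F F' : I -> M) : finite_set A ->
  (forall i, A i -> S (F i - F' i)) -> S (\sum_(i \in A) F i - \sum_(i \in A) F' i).
Proof.
move=> fA FF; rewrite !fsbig_finite// -sumrB big_seq.
apply: (big_ind S) => //; first exact: addset_add.
by move=> i; rewrite in_fset_set// => /set_mem/FF.
Qed.

Variables (L H : set T).
Hypotheses (sL : subgroup L) (sH : subgroup H) (HL : H `<=` L).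
Hypothesis fLH : finite_set (left_cosets L H).

Lemma csum_congr (F F' : T -> M) : (forall g, L g -> S (F g - F' g)) ->
  S (csum L H F - csum L H F').
Proof.
move=> FF; apply: fsum_congr => // C /(left_cosets_xget sL sH HL)[LC _].
exact: FF.
Qed.

Lemma csum_rep (X : choiceType) (phi : T -> X) (F : T -> M) (F' : X -> M) :
    (forall g h, L g -> L h -> phi g = phi h <-> H (g^-1 * h)%g) ->
    (forall g, L g -> S (F g - F' (phi g))) ->
  S (csum L H F - \sum_(x \in phi @` L) F' x).
Proof.
move=> phiP FF; rewrite (reindex_fsbig _ _ _ _ (coset_bij sL sH HL phiP)).
apply: fsum_congr => // C /(left_cosets_xget sL sH HL)[LC _]; exact: FF.
Qed.

(** Each [g] is labelled by the coset of [phi g], which reduces the claim to [csum_rep]; invariance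
    of [F'] modulo [S] absorbs the choice of a representative in that coset. *)
Lemma csum_reindex (T' : groupType) (L' H' : set T') (phi : T -> T')
    (F : T -> M) (F' : T' -> M) :
    subgroup L' -> subgroup H' -> H' `<=` L' ->
    (forall g, L g -> L' (phi g)) ->
    (forall g h, L g -> L h -> H' ((phi g)^-1 * phi h)%g <-> H (g^-1 * h)%g) ->
    (forall x : T', L' x -> exists2 g, L g & H' (x^-1 * phi g)%g) ->
    (forall x y : T', L' x -> H' y -> S (F' (x * y)%g - F' x)) ->
    (forall g, L g -> S (F g - F' (phi g))) ->
  S (csum L H F - csum L' H' F').
Proof.
move=> sL' sH' HL' LL phiP phiS invF' FF.
have := @csum_rep _ (fun g => [set (phi g * h)%g | h in H']) F
  (fun C => F' (xget 1%g C)).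
have -> : [set [set (phi g * h)%g | h in H'] | g in L] = left_cosets L' H'.
  apply/seteqP; split=> _ [g Lg <-]; first by exists (phi g) => //; exact: LL.
  by have [g' Lg' Hg'] := phiS g Lg; exists g' => //; apply/esym/lcosP.
apply=> [g h Lg Lh|g Lg]; first by rewrite -phiP//; exact: lcosP.
have [h Hh ->] := xget_lcos sH' (phi g).
by apply: addset_trans (FF _ Lg) _; apply/addset_sym/invF' => //; exact: LL.
Qed.

End CosetSums.

Section Tower.
Variables (T : groupType) (M : zmodType) (S : set M).
Hypotheses (S0 : S 0) (SB : forall x y, S x -> S y -> S (x - y)).
Variables (L K H : set T).
Hypotheses (sL : subgroup L) (sK : subgroup K) (sH : subgroup H).
Hypotheses (HK : H `<=` K) (KL : K `<=` L).
Hypotheses (fLK : finite_set (left_cosets L K)).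
Hypotheses (fKH : finite_set (left_cosets K H)).

Let h (P : set T * set T) := lcos (xget 1%g P.1 * xget 1%g P.2)%g H.

Let h_bij : set_bij (left_cosets L K `*` left_cosets K H) (left_cosets L H) h.
Proof.
have [_ LM LV] := sL; have [_ KM KV] := sK; have HL := subset_trans HK KL.
split.
- move=> [C C'] [/= /(left_cosets_xget sL sK KL)[LC _]].
  move=> /(left_cosets_xget sK sH HK)[KC' _].
  by exists (xget 1%g C * xget 1%g C')%g => //; apply: LM => //; exact: KL.
- move=> [C C'] [D D'] /set_mem[/= /(left_cosets_xget sL sK KL)[LC CE]].
  move=> /(left_cosets_xget sK sH HK)[KC' CE'].
  move=> /set_mem[/= /(left_cosets_xget sL sK KL)[LD DE]].
  move=> /(left_cosets_xget sK sH HK)[KD' DE'].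
  rewrite /h /= => /(lcosP sH).
  rewrite invMg -!mulgA => Hh.
  have CD : C = D.
    rewrite CE DE; apply/(lcosP sK); have := KM _ _ KC' (HK Hh).
    by rewrite mulVKg => /KM/(_ (KV _ KD')); rewrite mulgA mulgK.
  congr (_, _) => //; rewrite CE' DE'; apply/(lcosP sH).
  by move: Hh; rewrite CD mulKg.
(* The chosen representative of [lcos g K] is [g * k], so the second coordinate has to be the coset
   of [k^-1]. *)
- move=> _ [g Lg <-]; have [k Kk ek] := xget_lcos sK g.
  have kgK : K (k^-1)%g by exact: KV.
  exists (lcos g K, lcos k^-1%g H); first by split=> /=; [exists g|exists k^-1%g].
  rewrite /h /= ek; have [x Hx ->] := xget_lcos sH k^-1%g.
  by apply/(lcosP sH); rewrite !mulgA mulgK invMg -mulgA mulVg mulg1; case: sH => _ _; apply.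
Qed.

Lemma finite_left_cosets_tower : finite_set (left_cosets L H).
Proof.
have -> : left_cosets L H = h @` (left_cosets L K `*` left_cosets K H).
  by have [h1 _ h2] := h_bij; apply/seteqP; split=> // _ [x xP <-]; exact: h1.
by apply: finite_image; exact: finite_setX.
Qed.

Lemma csum_tower (F : T -> M) :
    (forall g x, L g -> H x -> S (F (g * x)%g - F g)) ->
  S (csum L H F - csum L K (fun g => csum K H (fun k => F (g * k)%g))).
Proof.
move=> FH; rewrite /csum (reindex_fsbig _ _ _ _ h_bij) pair_fsbig//.
have [_ LM _] := sL; have HL := subset_trans HK KL.
apply: fsum_congr => //; first exact: finite_setX.
move=> [C C'] [/= /(left_cosets_xget sL sK KL)[LC _]].
move=> /(left_cosets_xget sK sH HK)[/KL LC' _]; rewrite /h /=.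
have [x Hx ->] := xget_lcos sH (xget 1%g C * xget 1%g C')%g.
by apply: FH => //; exact: LM.
Qed.

Lemma coset_index_tower :
  coset_index L H = (coset_index L K * coset_index K H)%N.
Proof.
have card (I : choiceType) (A : set I) : finite_set A ->
    #|` fset_set A|%fset = (\sum_(i \in A) 1)%N.
  by move=> fA; rewrite fsbig_finite//= sum1_size.
rewrite /coset_index !card//; last exact: finite_left_cosets_tower.
rewrite (reindex_fsbig _ _ _ _ h_bij) -(pair_fsbig _ (fun _ _ => 1%N))//.
by rewrite !fsbig_finite//= !sum1_size big_const_seq count_predT iter_addn addn0 mulnC.
Qed.
End Tower.

Lemma fsbig_fintype (R : Type) (idx : R) (op : Monoid.com_law idx)
    (T : finType) (A : set T) (F : T -> R) :
  \big[op/idx]_(x \in A) F x = \big[op/idx]_(x | `[< A x >]) F x.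
Proof.
have fA : finite_set A by exact: finite_finset.
rewrite fsbig_finite// big_uniq ?fset_uniq//; apply: eq_bigl => x.
by rewrite in_fset_set//; apply/idP/asboolP => [/set_mem|/mem_set].
Qed.

Lemma card_fset_set_fintype (T : finType) (A : set T) :
  #|` fset_set A|%fset = #|[set x | `[< A x >]]%SET|.
Proof.
rewrite -sum1_card -[LHS]sum1_size -(fsbig_finite addn (fun _ => 1%N)).
  by rewrite fsbig_fintype; apply: eq_bigl => x; rewrite inE.
exact: finite_finset.
Qed.

Section CosetIndex.
Variables (T : groupType) (L H : set T).
Hypotheses (sL : subgroup L) (sH : subgroup H) (HL : H `<=` L).

Lemma coset_index_rep (X : finType) (phi : T -> X) :
    (forall g h, L g -> L h -> phi g = phi h <-> H (g^-1 * h)%g) ->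
  finite_set (left_cosets L H) /\
  coset_index L H = #|[set x | `[< (phi @` L) x >]]%SET|.
Proof.
move=> phiP; have phi_bij := coset_bij sL sH HL phiP.
have fLH : finite_set (left_cosets L H).
  (* [psi] inverts the labelling, which exhibits the cosets as an image of a finite type. *)
  pose psi x := lcos (xget 1%g [set g | L g /\ phi g = x]) H.
  apply: (@sub_finite_set _ _ (psi @` [set: X])); last first.
    by apply: finite_image; exact: finite_finset.
  move=> _ [g Lg <-]; exists (phi g) => //; rewrite /psi.
  case: xgetP => [x _ [Lx xg]|/(_ g)[]//].
  by apply/(lcosP sH)/phiP.
split=> //; rewrite /coset_index -card_fset_set_fintype.
rewrite -[LHS]sum1_size -[RHS]sum1_size.
rewrite -!(fsbig_finite addn (fun _ => 1%N))//; last exact: finite_finset.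
by rewrite (reindex_fsbig _ _ _ _ phi_bij).
Qed.

Lemma csum_const (M : zmodType) (c : M) : finite_set (left_cosets L H) ->
  csum L H (fun _ => c) = c *+ coset_index L H.
Proof.
move=> fLH; rewrite /csum fsbig_finite// big_const_seq count_predT.
by rewrite -Monoid.iteropE.
Qed.

End CosetIndex.

Section Images.
Variables (G : profiniteGroupType) (N : openNormal G).
Implicit Types (D H L Q : set G).

(** The image of [H] in [G/N] as a boolean set, so that Lagrange and Sylow for finite groups apply;
    for a subgroup it has the same elements as [mod_image N H]. *)
Definition gimg H : {set G_mod N} :=
  [set q | `[< exists2 g, H g & to_mod N g = q >]]%SET.

Lemma gimgP H q : reflect (exists2 g, H g & to_mod N g = q) (q \in gimg H).
Proof. by rewrite inE; exact: asboolP. Qed.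

Lemma mem_gimg H g : H g -> to_mod N g \in gimg H.
Proof. by move=> Hg; apply/gimgP; exists g. Qed.

Lemma gimg_group_set H : subgroup H -> group_set (gimg H).
Proof.
move=> [H1 HM _]; apply/group_setP; split; first by rewrite -to_mod1 mem_gimg.
move=> _ _ /gimgP[g Hg <-] /gimgP[h Hh <-]; rewrite -to_modM.
by apply: mem_gimg; exact: HM.
Qed.

Definition gimg_group H (sH : subgroup H) : {group G_mod N} :=
  Group (gimg_group_set sH).

Lemma setmulP H g : subgroup H -> setmul H N g <-> to_mod N g \in gimg H.
Proof.
move=> sH; split=> [[h Hh [n Nn <-]]|/gimgP[h Hh /to_modP hg]].
  by apply/gimgP; exists h => //; apply/to_modP; rewrite mulKg.
by exists h => //; exists (h^-1 * g)%g => //; rewrite mulVKg.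
Qed.

Lemma setmul_subgroup H : subgroup H -> subgroup (setmul H N).
Proof.
move=> sH; split.
- apply/setmulP => //; rewrite to_mod1; exact: group1 (gimg_group sH).
- move=> x y /(setmulP _ sH) Hx /(setmulP _ sH) Hy; apply/setmulP => //.
  by rewrite to_modM; apply: (@groupM _ (gimg_group sH)).
- move=> x /(setmulP _ sH) Hx; apply/setmulP => //.
  by rewrite to_modV; apply: (@groupVr _ (gimg_group sH)).
Qed.

Lemma sub_setmull H : H `<=` setmul H N.
Proof. by move=> h Hh; exists h => //; exists 1%g; [exact: on1|rewrite mulg1]. Qed.

Lemma sub_setmulr H : subgroup H -> on_set N `<=` setmul H N.
Proof.
by move=> sH n Nn; exists 1%g; [case: sH|exists n; rewrite ?mul1g].
Qed.

Lemma gimg_setmul H : subgroup H -> gimg (setmul H N) = gimg H.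
Proof.
move=> sH; apply/setP => q; apply/idP/idP => /gimgP[g Hg <-]; last first.
  by apply: mem_gimg; exact: sub_setmull.
exact/(setmulP _ sH).
Qed.

Lemma to_mod_surj (q : G_mod N) : exists g, to_mod N g = q.
Proof. by exists (generic_quotient.repr q); exact: reprK_mod. Qed.

Lemma gimgT : gimg [set: G] = [set: G_mod N]%SET.
Proof.
by apply/setP => q; rewrite finset.in_setT; have [g <-] := to_mod_surj q; exact: mem_gimg.
Qed.

Lemma gimgS H L : H `<=` L -> gimg H \subset gimg L.
Proof. by move=> HL; apply/fintype.subsetP => _ /gimgP[g /HL Lg <-]; exact: mem_gimg. Qed.

(** Since [D] meets [N] inside [Q], two elements of [D] lie in one coset of [Q] exactly when their
    images lie in one coset of the image of [Q]. Indices thereby become indices in a finite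
    group. *)
Lemma coset_index_gimg D Q : subgroup D -> subgroup Q -> Q `<=` D ->
    D `&` on_set N `<=` Q ->
  finite_set (left_cosets D Q) /\
  coset_index D Q = #|gimg D : gimg Q|%g.
Proof.
move=> sD sQ QD DNQ.
have phiP g h : D g -> D h ->
    (to_mod N g *: gimg Q)%g = (to_mod N h *: gimg Q)%g <-> Q (g^-1 * h)%g.
  move=> Dg Dh; have lcosE := @lcoset_eqP _ (gimg_group sQ).
  have [_ DM DV] := sD; have [_ QM QV] := sQ; split=> [/esym/lcosE|Qgh].
    rewrite mem_lcoset -to_modV -to_modM => /gimgP[q Qq /to_modP Nq].
    rewrite -(mulVKg q (g^-1 * h)%g); apply: QM => //; apply: DNQ; split=> //.
    by apply: (DM); [apply/QD/QV|apply: DM => //; exact: DV].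
  apply/esym/lcosE; rewrite mem_lcoset -to_modV -to_modM; exact: mem_gimg.
have [fDQ ->] := coset_index_rep sD sQ QD phiP; split=> //.
rewrite -[gimg D]/(gval (gimg_group sD)) -[gimg Q]/(gval (gimg_group sQ)).
rewrite -card_lcosets; apply: eq_card => C.
rewrite inE; apply/asboolP/lcosetsP => [[g Dg <-]|[_ /gimgP[g Dg <-] ->]].
  by exists (to_mod N g) => //; exact: mem_gimg.
by exists g.
Qed.

End Images.

(** * The completed group algebra *)

Section GroupAlgebraCoefficients.
Variables (k : fieldType) (gT : finGroupType).
Implicit Types (x y : galg k gT) (g h : gT).

Lemma galgD x y g : (x + y) g = x g + y g. Proof. exact: ffunE. Qed.
Lemma galgZ (c : k) x g : (c *: x) g = c * x g. Proof. exact: ffunE. Qed.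
Lemma galg_deltaE h g : gdelta k h g = (g == h)%:R. Proof. exact: ffunE. Qed.
Lemma galg_sumE I (r : seq I) (P : pred I) (F : I -> galg k gT) g :
  (\sum_(i <- r | P i) F i) g = \sum_(i <- r | P i) F i g.
Proof. exact: sum_ffunE. Qed.

Lemma gdeltaMl h x g : (gdelta k h * x) g = x (h^-1 * g)%g.
Proof.
rewrite galg_mulE (bigD1 h)//= galg_deltaE eqxx mul1r big1 ?addr0// => l.
by move=> /negPf lh; rewrite galg_deltaE lh mul0r.
Qed.

Lemma gdeltaMr h x g : (x * gdelta k h) g = x (g * h^-1)%g.
Proof.
rewrite galg_mulE (bigD1 (g * h^-1)%g)//= galg_deltaE.
rewrite invMg invgK mulgVK eqxx mulr1 big1 ?addr0// => l lgh.
rewrite galg_deltaE; case: eqP => [lg|]; last by rewrite mulr0.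
by move: lgh; rewrite -lg invMg invgK mulVKg eqxx.
Qed.

End GroupAlgebraCoefficients.

Section CompletedAlgebra.
Variables (k : fieldType) (G : profiniteGroupType).
Local Notation kG := (cgalg k G).
Implicit Types (x y z : kG) (N M K : openNormal G) (g h : G).

(** [cg_proj] with its arguments exchanged, so that it can carry linear and multiplicative
    structures. *)
Definition cgpr N x : galg k (G_mod N) := cg_proj x N.
Arguments cgpr : simpl never.

Lemma cgpr_is_linear N : linear (cgpr N).
Proof. by []. Qed.
HB.instance Definition _ N :=
  GRing.isLinear.Build k kG (galg k (G_mod N)) _ (cgpr N) (@cgpr_is_linear N).

Lemma cgpr_is_monoid_morphism N : monoid_morphism (cgpr N).
Proof. by []. Qed.
HB.instance Definition _ N :=
  GRing.isMonoidMorphism.Build kG (galg k (G_mod N)) (cgpr N)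
    (@cgpr_is_monoid_morphism N).

Lemma cgpr_delta N g : cgpr N (cdelta k g) = gdelta k (to_mod N g).
Proof. by []. Qed.

Lemma cgpr_compat N M x : on_set N `<=` on_set M ->
  galg_map (@mod_proj G N M) (cgpr N x) = cgpr M x.
Proof. exact: cg_compat. Qed.

Lemma cgpr_sub N M x y : on_set N `<=` on_set M ->
  cgpr N x = cgpr N y -> cgpr M x = cgpr M y.
Proof. by move=> NM xy; rewrite -!(cgpr_compat _ NM) xy. Qed.

Lemma cgprP_cofinal K x y :
  (forall M, on_set M `<=` on_set K -> cgpr M x = cgpr M y) -> x = y.
Proof.
move=> xy; apply: cgalgP => M; apply: (@cgpr_sub (onI M K)).
  by move=> g [].
by apply: xy => g [].
Qed.

Lemma cdeltaM g h : cdelta k (g * h)%g = cdelta k g * cdelta k h.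
Proof. by apply: cgalgP => N /=; rewrite to_modM gdeltaM. Qed.

Lemma cdelta1 : cdelta k (1%g : G) = 1. Proof. by []. Qed.

Lemma cdeltaVK g : cdelta k g^-1%g * cdelta k g = 1.
Proof. by rewrite -cdeltaM mulVg. Qed.
Lemma cdeltaKV g : cdelta k g * cdelta k g^-1%g = 1.
Proof. by rewrite -cdeltaM mulgV. Qed.

(** A finite combination of group elements that agrees with [x] modulo [N]: the density of [k[G]] in
    [k[[G]]]. *)
Definition dexp N x : kG :=
  \sum_(q : G_mod N) (cg_proj x N q : k) *: cdelta k (generic_quotient.repr q).

Lemma cgpr_dexp N x : cgpr N (dexp N x) = cgpr N x.
Proof.
rewrite linear_sum [RHS]gdelta_sum; apply: eq_bigr => q _.
by rewrite linearZ /= cgpr_delta reprK_mod.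
Qed.

Lemma galg_map_proj N M K (x : galg k (G_mod N)) :
    on_set N `<=` on_set M -> on_set M `<=` on_set K ->
  galg_map (@mod_proj G M K) (galg_map (@mod_proj G N M) x) =
  galg_map (@mod_proj G N K) x.
Proof.
move=> NM MK; rewrite [x]gdelta_sum !linear_sum; apply: eq_bigr => q _.
rewrite !linearZ /= !galg_map_delta; have [g <-] := to_mod_surj q.
by rewrite !mod_projE //; exact: subset_trans MK.
Qed.

Section Extend.
Variables (K : openNormal G) (f : forall M, galg k (G_mod M)).
Hypothesis fP : forall N M, on_set N `<=` on_set M -> on_set M `<=` on_set K ->
  galg_map (@mod_proj G N M) (f N) = f M.

(** Components are needed only below [K], these levels being cofinal; the component at [M] is pushed
    down from the intersection of [M] and [K]. *)
Program Definition cg_extend : kG :=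
  @CGalg k G (fun M => galg_map (@mod_proj G (onI M K) M) (f (onI M K))) _.
Next Obligation.
move=> N M NM.
have sub1 : on_set (onI N K) `<=` on_set (onI M K).
  by move=> g [/NM ? ?]; split.
have subK L : on_set (onI L K) `<=` on_set K by move=> g [].
have subL L : on_set (onI L K) `<=` on_set L by move=> g [].
rewrite (galg_map_proj _ (@subL N) NM).
by rewrite -(fP sub1 (@subK M)) (galg_map_proj _ sub1 (@subL M)).
Qed.

Lemma cgpr_extend M : on_set M `<=` on_set K -> cgpr M cg_extend = f M.
Proof. by move=> MK; apply: fP => // g []. Qed.

End Extend.

Section Restriction.
Variable K : openNormal G.
Implicit Types q r : G_mod K.

(** The part of [x] supported on the clopen coset [q] of [K]. Its coefficients at [M] make sense
    only when the cosets of [M] refine those of [K], whence the use of [cg_extend]. *)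
Definition cg_res_fun q x M : galg k (G_mod M) :=
  [ffun m => if @mod_proj G M K m == q then cg_proj x M m else 0].

Lemma cg_res_fun_compat q x N M :
    on_set N `<=` on_set M -> on_set M `<=` on_set K ->
  galg_map (@mod_proj G N M) (cg_res_fun q x N) = cg_res_fun q x M.
Proof.
move=> NM MK; apply/ffunP => m; rewrite !ffunE -(cg_compat x NM) ffunE.
have NK : on_set N `<=` on_set K by exact: subset_trans MK.
case: ifPn => mq.
  apply: eq_bigr => n /eqP nm; rewrite ffunE ifT//.
  move: nm mq; have [g <-] := to_mod_surj n; rewrite !mod_projE// => <-.
  by rewrite mod_projE.
rewrite big1// => n /eqP nm; rewrite ffunE ifN//.
move: nm mq; have [g <-] := to_mod_surj n; rewrite !mod_projE// => <-.
by rewrite mod_projE.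
Qed.

Definition cg_res q x : kG := cg_extend (@cg_res_fun_compat q x).

Lemma cgpr_res q x M m : on_set M `<=` on_set K ->
  cgpr M (cg_res q x) m = if @mod_proj G M K m == q then cgpr M x m else 0.
Proof. by move=> MK; rewrite cgpr_extend// ffunE. Qed.

Lemma cg_res_is_linear q : linear (cg_res q).
Proof.
move=> c x y; apply: (@cgprP_cofinal K) => M MK; apply/ffunP => m.
rewrite linearP /= galgD galgZ !cgpr_res// linearP /= galgD galgZ.
by case: ifP => //; rewrite mulr0 addr0.
Qed.
HB.instance Definition _ q :=
  GRing.isLinear.Build k kG kG _ (cg_res q) (@cg_res_is_linear q).

Lemma cg_res_sum x : \sum_q cg_res q x = x.
Proof.
apply: (@cgprP_cofinal K) => M MK; rewrite linear_sum; apply/ffunP => m.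
rewrite galg_sumE (bigD1 (@mod_proj G M K m)) //= cgpr_res// eqxx.
by rewrite big1 ?addr0// => q /negPf nq; rewrite cgpr_res// eq_sym nq.
Qed.

(** The parts over the cosets of [K] grade [k[[G]]] by the finite group [G/K]. This grading is what
    makes the scalar action on permutation modules associative. *)
Lemma cg_resM q x y :
  cg_res q (x * y) = \sum_r cg_res r x * cg_res (r^-1 * q)%g y.
Proof.
apply: (@cgprP_cofinal K) => M MK; rewrite linear_sum; apply/ffunP => m.
rewrite galg_sumE cgpr_res//= rmorphM /= galg_mulE.
under eq_bigr => r _ do rewrite rmorphM /= galg_mulE.
rewrite exchange_big /=.
rewrite (_ : (if _ then _ else _) = \sum_h (if @mod_proj G M K m == q then
              cgpr M x h * cgpr M y (h^-1 * m)%g else 0)); last first.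
  by case: ifP => // _; rewrite big1.
apply: eq_bigr => h _; rewrite (bigD1 (@mod_proj G M K h))//=.
rewrite big1 ?addr0 => [|r /negPf rh]; last first.
  by rewrite cgpr_res// eq_sym rh mul0r.
rewrite !cgpr_res// eqxx mod_projM// mod_projV// (inj_eq (mulgI _)).
by case: ifP => // _; rewrite mulr0.
Qed.

Lemma cg_res_delta q g :
  cg_res q (cdelta k g) = if to_mod K g == q then cdelta k g else 0.
Proof.
apply: (@cgprP_cofinal K) => M MK; apply/ffunP => m.
rewrite cgpr_res// cgpr_delta; have [h <-] := to_mod_surj m; rewrite mod_projE//.
rewrite galg_deltaE; have [/eqP hg|hg] := eqVneq (to_mod M h) (to_mod M g).
  have -> : to_mod K h = to_mod K g by apply/to_modP/MK/to_modP/eqP.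
  by case: ifP; rewrite ?linear0 ?cgpr_delta ?galg_deltaE ?hg// ffunE.
by case: ifP; case: ifP; rewrite ?linear0 ?cgpr_delta ?galg_deltaE ?(negPf hg)// ffunE.
Qed.

End Restriction.

Lemma cgpr_conj N g x (q : G_mod N) :
  cgpr N (cdelta k g * x * cdelta k g^-1%g) q =
  cgpr N x ((to_mod N g)^-1 * q * to_mod N g)%g.
Proof.
by rewrite !rmorphM /= !cgpr_delta gdeltaMr gdeltaMl to_modV invgK mulgA.
Qed.

Lemma cg_res_conj K (q : G_mod K) g x :
  cdelta k g * cg_res q x * cdelta k g^-1%g =
  cg_res (to_mod K g * q * (to_mod K g)^-1)%g (cdelta k g * x * cdelta k g^-1%g).
Proof.
apply: (@cgprP_cofinal K) => M MK; apply/ffunP => m.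
rewrite cgpr_conj !cgpr_res// cgpr_conj !mod_projM// mod_projV// !mod_projE//.
congr (if _ then _ else _); apply/eqP/eqP => [<-|->].
  by rewrite !mulgA mulgV mul1g mulgK.
by rewrite !mulgA mulVg mul1g mulgVK.
Qed.

End CompletedAlgebra.
Arguments cgpr : simpl never.

(** * Fitting idempotents and Rosenberg's lemma *)

HB.instance Definition _ (k : fieldType) (gT : finGroupType) :=
  Vector.copy (galg k gT) {ffun gT -> k^o}.

Section Fitting.
Variables (R : nzRingType) (z : R).
Hypothesis zC : forall x, z * x = x * z.

(* The Fitting idempotent of [z]: [z] is invertible on [f R] and nilpotent on
   [(1 - f) R]. *)
Definition fitting (f : R) : Prop :=
  exists n y, f = z ^+ n.+1 * y /\ z ^+ n.+1 * f = z ^+ n.+1.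

Let zXC n x : z ^+ n * x = x * z ^+ n.
Proof. exact/esym/commrX/esym/zC. Qed.

Lemma fitting_idem f : fitting f -> f * f = f.
Proof. by move=> [n [y [fE fz]]]; rewrite {1}fE zXC -mulrA fz -zXC. Qed.

(** An idempotent equals its own powers, and the power [m.+1] of [z ^+ n.+1 * y] is divisible by
    [z ^+ m.+1]. *)
Lemma fitting_powE f : fitting f -> forall m, exists y, f = z ^+ m.+1 * y.
Proof.
move=> Ff m; have [n [y [fE _]]] := Ff; have ff := fitting_idem Ff.
have fX : f ^+ m.+1 = f by elim: m => // m IHm; rewrite exprS IHm.
exists (z ^+ (n * m.+1) * y ^+ m.+1); rewrite -{1}fX {1}fE exprMn_comm//.
  by rewrite mulrA -exprD -exprM mulSn.
Qed.

(** Each idempotent is divisible by every power of [z], hence absorbed by the other. Uniqueness is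
    what makes the idempotents of the different quotients compatible. *)
Lemma fitting_unique f f' : fitting f -> fitting f' -> f = f'.
Proof.
suff absorb g g' : fitting g -> fitting g' -> g' * g = g /\ g * g' = g.
  by move=> Ff Ff'; have [<- _] := absorb _ _ Ff Ff';
    have [_ ->] := absorb _ _ Ff' Ff.
move=> /fitting_powE gz [n [y [_ g'z]]]; have [w ->] := gz n.
by split; [rewrite mulrA -zXC g'z|rewrite -mulrA zXC -mulrA -zXC g'z zXC].
Qed.

(** The cofactor [y] need not be central. Multiples of [z ^+ n.+1] are fixed by [f] on either side,
    and both [f * x] and [x * f] are such multiples, so both equal [f * x * f]. *)
Lemma fitting_central f : fitting f -> forall x, f * x = x * f.
Proof.
move=> [n [y [fE fz]]] x.
have fzR : f * z ^+ n.+1 = z ^+ n.+1 by rewrite -zXC.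
have fx : f * x = y * x * z ^+ n.+1 by rewrite fE -mulrA zXC.
have xf : x * f = z ^+ n.+1 * (x * y) by rewrite fE mulrA -zXC -mulrA.
rewrite xf -[z ^+ _ in RHS]fzR -!mulrA -xf mulrA fx -!mulrA.
by rewrite fz.
Qed.

End Fitting.

Section FittingExists.
Variables (k : fieldType) (gT : finGroupType) (z : galg k gT).

Definition lmulg (x y : galg k gT) : galg k gT := x * y.
Lemma lmulg_is_linear x : linear (lmulg x).
Proof. by move=> c u v; rewrite /lmulg mulrDr scalerAr. Qed.
HB.instance Definition _ x :=
  GRing.isLinear.Build k (galg k gT) (galg k gT) _ (lmulg x) (lmulg_is_linear x).

(** The ideals generated by the powers of [z] decrease; where the dimension is minimal, [z ^+ n.+1]
    is a multiple [z ^+ (n.+1 + n.+1) * y] of its own square, and [z ^+ n.+1 * y] is the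
    idempotent. *)
Lemma fitting_exists : exists f, fitting z f.
Proof.
pose U i := limg (linfun (lmulg (z ^+ i))).
have memU i x : x \in U i <-> exists y, x = z ^+ i * y.
  split=> [/memv_imgP[y _ ->]|[y ->]]; first by exists y; rewrite lfunE.
  by rewrite -[_ * y]/(lmulg _ y) -lfunE memv_img// memvf.
have exd : exists d, `[< exists n, \dim (U n.+1) = d >].
  by exists (\dim (U 1%N)); apply/asboolP; exists 0%N.
case: (ex_minnP exd) => d /asboolP[n Und] dmin.
have /subvP UU : (U n.+1 <= U (n.+1 + n.+1)%N)%VS.
  have sub : (U (n.+1 + n.+1)%N <= U n.+1)%VS.
    apply/subvP => _ /memU[y ->]; apply/memU.
    by exists (z ^+ n.+1 * y); rewrite mulrA -exprD.
  have /eqP -> // : (U (n.+1 + n.+1)%N == U n.+1)%VS.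
  rewrite eqEdim sub Und; apply: dmin; apply/asboolP.
  by exists (n + n.+1)%N.
have /memU[y zy] : z ^+ n.+1 \in U (n.+1 + n.+1)%N.
  by apply/UU/memU; exists 1; rewrite mulr1.
exists (z ^+ n.+1 * y), n, y; split=> //.
by rewrite mulrA -exprD -zy.
Qed.

End FittingExists.

Section Rosenberg.
Variables (k : fieldType) (G : profiniteGroupType).
Local Notation kG := (cgalg k G).
Implicit Types (x y z w : kG) (N M : openNormal G).

Lemma cgpr_central z N : centre z -> forall x : galg k (G_mod N),
  cgpr N z * x = x * cgpr N z.
Proof.
move=> zC x; rewrite [x]gdelta_sum mulr_sumr mulr_suml; apply: eq_bigr => q _.
rewrite -scalerAr -scalerAl; congr (_ *: _); have [g <-] := to_mod_surj q.
by rewrite -cgpr_delta -!rmorphM zC.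
Qed.

Lemma cg_fitting z : centre z ->
  exists2 f, centre f & forall N, fitting (cgpr N z) (cgpr N f).
Proof.
move=> zC; have ex N := fitting_exists (cgpr N z).
pose F N := projT1 (cid (ex N)).
have FP N : fitting (cgpr N z) (F N) := projT2 (cid (ex N)).
have Fc N M (NM : on_set N `<=` on_set M) :
    galg_map (@mod_proj G N M) (F N) = F M.
  apply: (fitting_unique (cgpr_central zC)) (FP M).
  have [n [y [FE Fz]]] := FP N; exists n, (galg_map (@mod_proj G N M) y).
  have pM := galg_mapM (mod_projM NM).
  (* Positive exponents suffice, and for them multiplicativity of [galg_map] is enough. *)
  have pX m (x : galg k (G_mod N)) : galg_map (@mod_proj G N M) (x ^+ m.+1) =
      galg_map (@mod_proj G N M) x ^+ m.+1.
    by elim: m => [|m IHm]; rewrite ?expr1// exprS pM IHm -exprS.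
  by rewrite -(cgpr_compat z NM) -pX -!pM -FE Fz.
exists (CGalg Fc) => [x|N]; last exact: FP.
apply: cgalgP => N; exact: (fitting_central (cgpr_central zC) (FP N) (cgpr N x)).
Qed.

Variable e : kG.
Hypothesis ePrim : primitive_central_idempotent e.

Let eC x : e * x = x * e. Proof. by case: ePrim => [[]]. Qed.
Let ee : e * e = e. Proof. by case: ePrim => [[]]. Qed.

(** The Fitting idempotent of [z] is a central idempotent below [e], so it is [0] or [e]. In the
    first case [z] is nilpotent at each level, with an exponent depending on the level; in the
    second it is invertible in the corner cut out by [e]. *)
Lemma primitive_central_local z : centre z -> z * e = z ->
  (exists2 w, centre w & z * w = e) \/
  (forall N, exists n, cgpr N z ^+ n = 0).
Proof.
move=> zC ze; have [f fC fF] := cg_fitting zC.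
have ff : f * f = f.
  by apply: cgalgP => N; exact: (fitting_idem (cgpr_central zC) (fF N)).
have eCN N := cgpr_central (N := N) eC; have zCN N := cgpr_central (N := N) zC.
have zeN N : cgpr N z * cgpr N e = cgpr N z by rewrite -rmorphM ze.
have eeN N : cgpr N e * cgpr N e = cgpr N e by rewrite -rmorphM ee.
have fe : f * e = f.
  apply: cgalgP => N; have [n [y [fE _]]] := fF N.
  rewrite -[LHS]/(cgpr N (f * e)) rmorphM /= -[RHS]/(cgpr N f) fE.
  by rewrite exprSr -!mulrA -(eCN N y) (mulrA (cgpr N z)) zeN.
have [] : f = 0 \/ e - f = 0.
  case: ePrim => _ _; apply.
  - by [].
  - split; first by move=> x; rewrite mulrBl mulrBr eC fC.
    by rewrite mulrBl !mulrBr ee fe eC fe ff subrr subr0.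
  - by rewrite mulrBr fe ff subrr.
  - by rewrite addrC subrK.
- move=> f0; right=> N; have [n [y [_]]] := fF N.
  by rewrite f0 linear0 mulr0 => zn0; exists n.+1.
move=> /eqP; rewrite subr_eq0 => /eqP fE; left.
have ex N : exists w : galg k (G_mod N), cgpr N z * w = cgpr N e /\ w * cgpr N e = w.
  have [n [y [eE _]]] := fF N; rewrite -fE in eE.
  exists (cgpr N z ^+ n * y * cgpr N e).
  by rewrite !mulrA -exprS -eE eeN -!mulrA eeN.
pose W N := projT1 (cid (ex N)).
have WP N : cgpr N z * W N = cgpr N e /\ W N * cgpr N e = W N :=
  projT2 (cid (ex N)).
(* Requiring [w * e = w] makes the inverse unique at each level, so the inverses form a compatible
   family. *)
have Wu N (w w' : galg k (G_mod N)) : cgpr N z * w = cgpr N e -> w * cgpr N e = w ->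
    cgpr N z * w' = cgpr N e -> w' * cgpr N e = w' -> w = w'.
  move=> zw we zw' we'.
  by rewrite -we -zw' mulrA -zCN zw eCN we'.
have Wc N M (NM : on_set N `<=` on_set M) :
    galg_map (@mod_proj G N M) (W N) = W M.
  have [zW We] := WP N; have [zW' We'] := WP M.
  have pM := galg_mapM (mod_projM NM).
  by apply: Wu => //; rewrite -!(cgpr_compat _ NM) -pM ?zW ?We.
exists (CGalg Wc); last by apply: cgalgP => N; have [] := WP N.
move=> x; apply: cgalgP => N; have [zW We] := WP N.
rewrite -[LHS]/(W N * cgpr N x) -[RHS]/(cgpr N x * W N).
rewrite -{1}We -mulrA eCN -zW !mulrA -(zCN _ (W N * cgpr N x)) !mulrA zW.
by rewrite eCN -mulrA eCN We.
Qed.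

(** If no [z i * e] were invertible, all would be nilpotent modulo every [N]; a sum of commuting
    nilpotents being nilpotent, the idempotent [e] would vanish at each level. *)
Lemma rosenberg (I : finType) (z : I -> kG) : (forall i, centre (z i)) ->
  e = \sum_i z i -> exists i, exists2 w, centre w & z i * w = e.
Proof.
move=> zC ez; apply: contrapT => /forallNP nz.
have zeC i : centre (z i * e).
  by move=> x; rewrite -mulrA eC mulrA zC -mulrA.
have ze i : z i * e * e = z i * e by rewrite -mulrA ee.
have nil i N : exists n, cgpr N (z i * e) ^+ n = 0.
  have [[w wC zw]|] := primitive_central_local (zeC i) (ze i); last exact.
  case: (nz i); exists (e * w); last by rewrite mulrA.
  by move=> x; rewrite -mulrA wC mulrA eC -mulrA.
have e0 N : cgpr N e = 0.
  have [n en] : exists n, cgpr N (\sum_i z i * e) ^+ n = 0.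
    suff [] : centre (\sum_i z i * e) /\
      exists n, cgpr N (\sum_i z i * e) ^+ n = 0 by [].
    apply: (big_ind (fun x => centre x /\ exists n, cgpr N x ^+ n = 0)).
    - by split; [move=> x; rewrite mul0r mulr0|exists 1%N; rewrite linear0].
    - move=> x y [xC [n xn]] [yC [m ym]]; split.
        by move=> u; rewrite mulrDl mulrDr xC yC.
      exists (n + m)%N; rewrite linearD /= exprDn_comm; last exact: cgpr_central.
      rewrite big1// => j _; have [jm|mj] := leqP m j.
        by rewrite -(subnK jm) [_ ^+ (_ - _ + _)]exprD ym !mulr0 mul0rn.
      have nj : (n <= n + m - j)%N by rewrite -addnBA ?leq_addr// ltnW.
      by rewrite -(subnK nj) [_ ^+ (_ - _ + _)]exprD xn mulr0 mul0r mul0rn.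
    - by move=> i _; split; [exact: zeC|exact: nil].
  rewrite -mulr_suml -ez ee in en.
  have eX m : cgpr N e ^+ m.+1 = cgpr N e.
    by elim: m => // m IHm; rewrite exprS IHm -rmorphM ee.
  by case: n en => [/eqP|n]; rewrite ?expr0 ?oner_eq0// eX.
by case: ePrim => _ + _; apply; apply: cgalgP => N; exact: e0.
Qed.

End Rosenberg.

Lemma set1_eq0 (M : zmodType) (x y : M) : [set 0] (x - y) -> x = y.
Proof. exact: subr0_eq. Qed.

Lemma set1_subr_closed (M : zmodType) (x y : M) :
  [set (0 : M)] x -> [set (0 : M)] y -> [set (0 : M)] (x - y).
Proof. by move=> /= -> ->; rewrite subrr. Qed.

Lemma csum_ext (T : groupType) (M : zmodType) (L H : set T) (F F' : T -> M) :
    subgroup L -> subgroup H -> H `<=` L -> finite_set (left_cosets L H) ->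
    (forall g, L g -> F g = F' g) ->
  csum L H F = csum L H F'.
Proof.
move=> sL sH HL fLH FF; apply: eq_fsbigr => C /set_mem.
by move=> /(left_cosets_xget sL sH HL)[LC _]; exact: FF.
Qed.

Lemma csum_reindex_eq (T T' : groupType) (M : zmodType) (phi : T -> T')
    (L H : set T) (L' H' : set T') (F : T -> M) (F' : T' -> M) :
    subgroup L -> subgroup H -> H `<=` L -> finite_set (left_cosets L H) ->
    subgroup L' -> subgroup H' -> H' `<=` L' ->
    (forall g, L g -> L' (phi g)) ->
    (forall g h, L g -> L h -> H' ((phi g)^-1 * phi h)%g <-> H (g^-1 * h)%g) ->
    (forall x, L' x -> exists2 g, L g & H' (x^-1 * phi g)%g) ->
    (forall x y, L' x -> H' y -> F' (x * y)%g = F' x) ->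
    (forall g, L g -> F g = F' (phi g)) ->
  csum L H F = csum L' H' F'.
Proof.
move=> sL sH HL fLH sL' sH' HL' LL phiP phiS invF' FF; apply/set1_eq0.
apply: (csum_reindex _ (@set1_subr_closed M) sL sH HL fLH sL' sH' HL' LL phiP
  phiS) => //.
  by move=> x y Lx Hy; rewrite /= invF'// subrr.
by move=> g Lg; rewrite /= FF// subrr.
Qed.

Lemma csum_tower_eq (T : groupType) (M : zmodType) (L K H : set T)
    (F : T -> M) :
    subgroup L -> subgroup K -> subgroup H -> H `<=` K -> K `<=` L ->
    finite_set (left_cosets L K) -> finite_set (left_cosets K H) ->
    (forall g x, L g -> H x -> F (g * x)%g = F g) ->
  csum L H F = csum L K (fun g => csum K H (fun x => F (g * x)%g)).
Proof.
move=> sL sK sH HK KL fLK fKH FH; apply/set1_eq0.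
apply: (csum_tower _ (@set1_subr_closed M)) => // g x Lg Hx.
by rewrite /= FH// subrr.
Qed.

(** * Conjugation and traces *)

Section OrbitSums.
Variables (T : groupType) (L : set T) (X : finType) (act : T -> X -> X).
Hypotheses (sL : subgroup L) (act1 : forall x, act 1%g x = x).
Hypothesis actM : forall g h x, act (g * h)%g x = act g (act h x).
Variable x0 : X.

Definition stab : set T := L `&` [set g | act g x0 = x0].

Definition orb : pred X := [pred x | `[< exists2 g, L g & act g x0 = x >]].

Lemma stab_subgroup : subgroup stab.
Proof.
have [L1 LM LV] := sL; split; first by split=> //=.
  by move=> g h [Lg gx] [Lh hx]; split; [exact: LM|rewrite /= actM hx].
move=> g [Lg gx]; split; first exact: LV.
by rewrite /= -{1}gx -actM mulVg.
Qed.

Lemma stab_cosets g h : L g -> L h ->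
  act g x0 = act h x0 <-> stab (g^-1 * h)%g.
Proof.
have [_ LM LV] := sL; move=> Lg Lh; split=> [gh|[_ /= gh]].
  by split; [apply: LM => //; exact: LV|rewrite /= actM -gh -actM mulVg].
by rewrite -{1}gh -actM mulVKg.
Qed.

Lemma finite_stab_cosets : finite_set (left_cosets L stab).
Proof.
by have [] := coset_index_rep sL stab_subgroup (@subIsetl _ _ _) stab_cosets.
Qed.

Lemma coset_index_stab : coset_index L stab = #|orb|.
Proof.
have [_ ->] := coset_index_rep sL stab_subgroup (@subIsetl _ _ _) stab_cosets.
by apply: eq_card => x; rewrite !inE.
Qed.

(** Orbit and stabiliser: a sum over opaque coset representatives becomes a sum over points of a
    finite type, on which group actions can be followed. *)
Lemma csum_stab (M : zmodType) (F : T -> M) (F' : X -> M) :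
  (forall g, L g -> F g = F' (act g x0)) ->
  csum L stab F = \sum_(x | orb x) F' x.
Proof.
move=> FF; apply/set1_eq0; rewrite -fsbig_fintype.
apply: (csum_rep _ (@set1_subr_closed M) sL stab_subgroup) => //.
- exact: subIsetl.
- exact: finite_stab_cosets.
- exact: stab_cosets.
- by move=> g Lg; rewrite /= FF// subrr.
Qed.

End OrbitSums.

Section Conjugation.
Variables (k : fieldType) (G : profiniteGroupType).
Local Notation kG := (cgalg k G).
Implicit Types (a b x z : kG) (N M : openNormal G) (g h : G).

Definition cconj g x : kG := cdelta k g * x * cdelta k g^-1%g.

Lemma cconj1 x : cconj 1%g x = x.
Proof. by rewrite /cconj invg1 cdelta1 mul1r mulr1. Qed.

Lemma cconjM g h x : cconj (g * h)%g x = cconj g (cconj h x).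
Proof. by rewrite /cconj invMg !cdeltaM !mulrA. Qed.

Lemma cconj_is_linear g : linear (cconj g).
Proof.
by move=> c x y; rewrite /cconj mulrDr mulrDl -scalerAr -scalerAl.
Qed.
HB.instance Definition _ g :=
  GRing.isLinear.Build k kG kG _ (cconj g) (cconj_is_linear g).

Lemma cconj_mul g x y : cconj g (x * y) = cconj g x * cconj g y.
Proof.
rewrite /cconj -!mulrA; congr (_ * (_ * _)).
by rewrite mulrA cdeltaVK mul1r.
Qed.

Lemma cconj_central g z : centre z -> cconj g z = z.
Proof. by move=> zC; rewrite /cconj -zC -mulrA cdeltaKV mulr1. Qed.

(** Modulo [N], any [x] is a combination of group elements, with which [z] commutes by
    hypothesis. *)
Lemma centre_cconj z : (forall g, cconj g z = z) -> centre z.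
Proof.
move=> zC.
have zD g : z * cdelta k g = cdelta k g * z.
  by rewrite -{1}(zC g) /cconj -mulrA cdeltaVK mulr1.
move=> x; apply: cgalgP => N.
rewrite -[LHS]/(cgpr N (z * x)) -[RHS]/(cgpr N (x * z)) !rmorphM /=.
rewrite -(cgpr_dexp N x) -!rmorphM; congr (cgpr N _).
rewrite /dexp mulr_sumr mulr_suml; apply: eq_bigr => q _.
by rewrite -scalerAr -scalerAl zD.
Qed.

Lemma cg_traceE (H L : set G) a : cg_trace H L a = csum L H (cconj^~ a).
Proof. by []. Qed.

Lemma cconj_csum (T : groupType) (L H : set T) g (F : T -> kG) :
  finite_set (left_cosets L H) ->
  cconj g (csum L H F) = csum L H (fun t => cconj g (F t)).
Proof. by move=> fLH; rewrite /csum !fsbig_finite// linear_sum. Qed.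

Lemma cgpr_csum (T : groupType) (L H : set T) N (F : T -> kG) :
  finite_set (left_cosets L H) ->
  cgpr N (csum L H F) = csum L H (fun t => cgpr N (F t)).
Proof. by move=> fLH; rewrite /csum !fsbig_finite// linear_sum. Qed.

Lemma csum_mulr (T : groupType) (L H : set T) (F : T -> kG) z :
  finite_set (left_cosets L H) ->
  csum L H F * z = csum L H (fun t => F t * z).
Proof. by move=> fLH; rewrite /csum !fsbig_finite// mulr_suml. Qed.

Lemma cg_fixed_cconj (H : set G) a g h : cg_fixed H a -> H h ->
  cconj (g * h)%g a = cconj g a.
Proof. by move=> aH Hh; rewrite cconjM [cconj h a]aH. Qed.

Lemma cg_fixedS (H K : set G) a : H `<=` K -> cg_fixed K a -> cg_fixed H a.
Proof. by move=> HK aK h /HK; exact: aK. Qed.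

Section TraceTower.
Variables (H K L : set G).
Hypotheses (sH : subgroup H) (sK : subgroup K) (sL : subgroup L).
Hypotheses (HK : H `<=` K) (KL : K `<=` L).
Hypotheses (fKH : finite_set (left_cosets K H)).
Hypotheses (fLK : finite_set (left_cosets L K)).

Lemma cg_trace_fixed a : cg_fixed H a -> cg_fixed K (cg_trace H K a).
Proof.
move=> aH h Kh; rewrite -[LHS]/(cconj h _) cg_traceE cconj_csum//.
have [_ KM KV] := sK.
apply: (csum_reindex_eq (phi := mulg h)) => //.
- by move=> g Kg; exact: KM.
- by move=> g l _ _; rewrite invMg -mulgA mulKg.
- move=> l Kl; exists (h^-1 * l)%g; first by apply: KM => //; exact: KV.
  by rewrite mulVKg mulVg; case: sH.
- by move=> g l _ Hl; exact: cg_fixed_cconj aH Hl.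
- by move=> g _; rewrite cconjM.
Qed.

Lemma cg_trace_tower a : cg_fixed H a ->
  cg_trace H L a = cg_trace K L (cg_trace H K a).
Proof.
move=> aH; rewrite !cg_traceE (csum_tower_eq sL sK sH HK KL fLK fKH).
  apply: csum_ext => // g _; rewrite cconj_csum//; apply: csum_ext => // x _.
  exact: cconjM.
by move=> g x _ Hx; exact: cg_fixed_cconj aH Hx.
Qed.

Lemma trace_image_tower a : trace_image H L a -> trace_image K L a.
Proof.
move=> [b bH <-]; exists (cg_trace H K b); first exact: cg_trace_fixed.
by rewrite cg_trace_tower.
Qed.

End TraceTower.

Lemma trace_image_central (H L : set G) a z :
  finite_set (left_cosets L H) -> centre z ->
  trace_image H L a -> trace_image H L (a * z).
Proof.
move=> fLH zC [b bH <-]; exists (b * z).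
  by move=> h Hh; rewrite -[LHS]/(cconj h _) cconj_mul (cconj_central _ zC) [cconj h b]bH.
rewrite !cg_traceE csum_mulr//; apply: eq_fsbigr => C _.
by rewrite cconj_mul (cconj_central _ zC).
Qed.

Lemma finite_left_cosets_open (H : set G) L N : subgroup L -> subgroup H ->
  H `<=` L -> on_set N `<=` H -> finite_set (left_cosets L H).
Proof.
move=> sL sH HL NH; have [] // := @coset_index_gimg G N L H sL sH HL.
by move=> x [_ /NH].
Qed.

End Conjugation.

Section LeftTranslation.
Variables (G : profiniteGroupType) (M : openNormal G) (L : set G).
Hypotheses (sL : subgroup L) (ML : on_set M `<=` L).

(** For a subgroup [L] containing [M], the space [G/L] is realised as the orbit of [gimg M L] among
    the subsets of [G/M], which form a finite type. *)
Definition ltrans (g : G) (Y : {set G_mod M}) : {set G_mod M} :=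
  (to_mod M g *: Y)%g.

Lemma ltrans1 Y : ltrans 1%g Y = Y.
Proof. by rewrite /ltrans to_mod1 lcoset1. Qed.

Lemma ltransM g h Y : ltrans (g * h)%g Y = ltrans g (ltrans h Y).
Proof. by rewrite /ltrans to_modM lcosetM. Qed.

Lemma setmul_id : setmul L M = L.
Proof.
apply/seteqP; split=> [_ [l Ll [m /ML Lm <-]]|l Ll]; last exact: sub_setmull.
by case: sL => _ LM _; exact: LM.
Qed.

Lemma ltrans_gimg g h :
  ltrans g (gimg M L) = ltrans h (gimg M L) <-> L (g^-1 * h)%g.
Proof.
rewrite -{3}setmul_id (setmulP _ _ sL) to_modM to_modV.
have lcosE := @lcoset_eqP _ (gimg_group M sL).
split=> [/esym/lcosE|gh]; first by rewrite mem_lcoset.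
by apply/esym/lcosE; rewrite mem_lcoset.
Qed.

Lemma stab_ltrans : stab [set: G] ltrans (gimg M L) = L.
Proof.
apply/seteqP; split=> g; rewrite /stab /= -{2}(ltrans1 (gimg M L)).
  by move=> [_ /esym/ltrans_gimg]; rewrite invg1 mul1g.
by move=> Lg; split=> //; apply/esym/ltrans_gimg; rewrite invg1 mul1g.
Qed.

End LeftTranslation.

(** The summand of a trace at the coset of [g] depends only on that coset, because [a] is fixed by
    [L]; [h] records it as a function of the point of [G/L]. *)
Lemma cg_trace_ltrans (k : fieldType) (G : profiniteGroupType)
    (M : openNormal G) (L : set G) (a : cgalg k G) :
    subgroup L -> on_set M `<=` L -> cg_fixed L a ->
  exists2 h : {set G_mod M} -> cgalg k G,
    forall g, h (ltrans g (gimg M L)) = cconj g a &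
    cg_trace L [set: G] a =
      \sum_(Y | orb [set: G] (@ltrans G M) (gimg M L) Y) h Y.
Proof.
move=> sL ML aL; pose Lb := gimg M L.
pose h Y := cconj (xget 1%g [set g | ltrans g Lb = Y]) a.
have hE g : h (ltrans g Lb) = cconj g a.
  rewrite /h; case: xgetP => [g' _ /esym/(ltrans_gimg sL ML) Lg|/(_ g)[]//].
  by rewrite -(mulVKg g g') (cg_fixed_cconj _ aL).
exists h => //; rewrite cg_traceE -{1}(stab_ltrans sL ML).
by apply: csum_stab => [//|||g _]; [exact: ltrans1|exact: ltransM|rewrite hE].
Qed.

(** * Splitting a trace along centralisers of support points *)

Section TraceSplit.
Variables (k : fieldType) (G : profiniteGroupType).
Local Notation kG := (cgalg k G).
Variable e : kG.
Hypothesis ePrim : primitive_central_idempotent e.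

Let eC : centre e. Proof. by case: ePrim => [[]]. Qed.
Let ee : e * e = e. Proof. by case: ePrim => [[]]. Qed.
Let e0 : e <> 0. Proof. by case: ePrim. Qed.

Definition cent (N : openNormal G) (c : G_mod N) : set G :=
  [set g | (to_mod N g * c * (to_mod N g)^-1)%g = c].

Lemma centre_class (N : openNormal G) (z : kG) (c : G_mod N) g : centre z ->
  cgpr N z (to_mod N g * c * (to_mod N g)^-1)%g = (cgpr N z c : k).
Proof.
move=> zC; rewrite -{1}(cconj_central g zC) cgpr_conj.
by rewrite !mulgA mulVg mul1g mulgVK.
Qed.

(* Split [e = Tr a * e] as the sum over [(gL, c)] in [G/L x G/N] of
   [g a g^-1 * e_c], [e_c] being the part of [e] supported on [c]; each [G]-orbit
   contributes a central element, so by Rosenberg's lemma a single orbit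
   suffices. *)
Lemma trace_split (L : set G) (M N : openNormal G) :
    subgroup L -> on_set M `<=` L -> trace_image L [set: G] e ->
    cgpr N e != 0 ->
  exists c : G_mod N, (cgpr N e c : k) != 0 /\
    trace_image (L `&` cent c) [set: G] e.
Proof.
move=> sL ML [a aL aE] eN0.
pose X := ({set G_mod M} * G_mod N)%type : finType.
pose act (g : G) (x : X) : X :=
  (ltrans g x.1, (to_mod N g * x.2 * (to_mod N g)^-1)%g).
have act1 x : act 1%g x = x.
  by case: x => Y c; rewrite /act /= ltrans1 to_mod1 invg1 mul1g mulg1.
have actM g h x : act (g * h)%g x = act g (act h x).
  by rewrite /act ltransM to_modM invMg !mulgA.
have actK g : cancel (act g) (act g^-1%g).
  by move=> x; rewrite -actM mulVg act1.
have actVK g : cancel (act g^-1%g) (act g).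
  by move=> x; rewrite -actM mulgV act1.
pose Lb := gimg M L.
have [h hE trE] := cg_trace_ltrans sL ML aL.
pose f (x : X) := h x.1 * cg_res x.2 e.
pose P (x : X) := orb [set: G] (@ltrans G M) Lb x.1.
have Pact1 y x : P x -> P (act y x).
  move=> /asboolP[g1 _ gx]; apply/asboolP; exists (y * g1)%g => //.
  by rewrite ltransM gx.
have Pact y x : P (act y x) = P x.
  by apply/idP/idP => [/(Pact1 y^-1%g)|/Pact1//]; rewrite actK.
have fact y x : P x -> f (act y x) = cconj y (f x).
  case: x => Y c /asboolP[g _ /= <-]; rewrite /f /= -ltransM !hE.
  rewrite cconj_mul -cconjM; congr (_ * _).
  by rewrite [RHS]cg_res_conj -/(cconj _ _) (cconj_central _ eC).
have eE : e = \sum_(x | P x) f x.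
  rewrite -{1}ee -{1}aE trE.
  rewrite -{1}(cg_res_sum N e) big_distrlr /= pair_big /=.
  by apply: eq_bigl => x; rewrite andbT.
pose O x := [set y | orb [set: G] act x y]%SET.
have Oact g x : O (act g x) = O x.
  apply/setP => y; rewrite !inE; apply/asboolP/asboolP => -[g' _ <-].
    by exists (g' * g)%g.
  by exists (g' * g^-1)%g => //; rewrite -actM mulgVK.
pose z C := \sum_(x | P x && (O x == C)) f x.
have zC C : centre (z C).
  apply: centre_cconj => g; rewrite linear_sum /=.
  rewrite [RHS](reindex (act g)) /=; last first.
    by exists (act g^-1%g) => x _; [exact: actK|exact: actVK].
  under [RHS]eq_bigl => x do rewrite Pact Oact.
  by apply: eq_bigr => x /andP[Px _]; rewrite fact.
have /(rosenberg ePrim zC)[C [w wC zw]] : e = \sum_C z C.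
  by rewrite {1}eE (partition_big O xpredT).
have [x /andP[Px /eqP Ox]] : exists x, P x && (O x == C).
  apply: contrapT => /forallNP nP; apply: e0; rewrite -zw /z big_pred0 ?mul0r//.
  by move=> x; apply/negbTE/negP/nP.
have [g _ gx] := asboolP _ Px.
(* Moving [x] inside its orbit makes its first coordinate the coset [L] itself, so that the
   stabiliser becomes the intersection of [L] with [cent c]. *)
pose c := (act g^-1%g x).2.
have x0E : act g^-1%g x = (Lb, c).
  by rewrite [LHS]surjective_pairing /= -gx -ltransM mulVg ltrans1.
have {Px Ox} Ox0 : O (Lb, c) = C by rewrite -x0E Oact.
have Px0 : P (Lb, c) by apply/asboolP; exists 1%g => //; exact: ltrans1.
have zE : z C = \sum_(y | orb [set: G] act (Lb, c) y) f y.
  apply: eq_bigl => y; rewrite -Ox0; apply/idP/idP.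
    move=> /andP[_ /eqP Oy].
    have : y \in O y by rewrite inE; apply/asboolP; exists 1%g.
    by rewrite Oy inE.
  by move=> /asboolP[g' _ <-]; rewrite Pact Px0 Oact eqxx.
have fx0 : f (Lb, c) = a * cg_res c e.
  by rewrite /f /= -{1}(ltrans1 Lb) hE cconj1.
exists c; split.
  (* The coefficients of [e] are constant on conjugacy classes. If the one at [c] vanished, every
     term of the orbit, hence [z C * w = e], would vanish modulo [N]. *)
  apply: contraNneq eN0 => ec0.
  have fN y : orb [set: G] act (Lb, c) y -> cgpr N (f y) = 0.
    move=> /asboolP[g' _ <-]; rewrite /f rmorphM /=.
    rewrite [cgpr N (cg_res _ _)](_ : _ = 0) ?mulr0//.
    apply/ffunP => m; rewrite cgpr_res// [RHS]ffunE; case: eqP => // mc.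
    have [m' mE] := to_mod_surj m; move: mc; rewrite -mE mod_projE// => ->.
    by rewrite centre_class.
  by rewrite -zw rmorphM /= zE linear_sum big1 ?mul0r.
have stE : stab [set: G] act (Lb, c) = L `&` cent c.
  apply/seteqP; split=> y.
    move=> [_ [yL yc]]; split=> //; rewrite -(stab_ltrans sL ML); split=> //.
  rewrite -{1}(stab_ltrans sL ML) => -[[_ yL] yc]; split=> //=.
  by rewrite /act /= yL yc.
have sst : subgroup (L `&` cent c) by rewrite -stE; exact: stab_subgroup.
have fst' : finite_set (left_cosets [set: G] (L `&` cent c)).
  by rewrite -stE; exact: finite_stab_cosets.
rewrite -zw; apply: trace_image_central => //.
exists (a * cg_res c e).
  move=> y [Ly yc]; rewrite -[LHS]/(cconj y _) cconj_mul [cconj y a]aL//.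
  by rewrite [cconj y _]cg_res_conj yc -/(cconj _ _) (cconj_central _ eC).
rewrite cg_traceE -stE zE; apply: csum_stab => // y _.
by rewrite -fx0 fact.
Qed.

End TraceSplit.

Section OrdinaryTraces.
Variables (k : fieldType) (G : profiniteGroupType).
Local Notation kG := (cgalg k G).
Implicit Types (a b x z : kG) (N M : openNormal G) (g h : G) (D H K : set G).

Lemma setmulS H K N M : H `<=` K -> on_set N `<=` on_set M ->
  setmul H N `<=` setmul K M.
Proof. by move=> HK NM _ [x /HK Kx [n /NM Mn <-]]; exists x => //; exists n. Qed.

Lemma setmulT N : setmul [set: G] N = [set: G].
Proof. by apply/seteqP; split=> // g _; exact: sub_setmull. Qed.

Lemma openNormal_inf (I : finType) (F : I -> openNormal G) :
  exists M, forall i, on_set M `<=` on_set (F i).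
Proof.
have [M MP] : exists M, forall i, i \in enum I -> on_set M `<=` on_set (F i).
  elim: (enum I) => [|j s [M MP]]; first by exists (onT G).
  exists (onI M (F j)) => i; rewrite inE => /predU1P[->|/MP Mi] g [] //.
  by move=> /Mi.
by exists M => i; apply: MP; rewrite mem_enum.
Qed.

Lemma trace_image_mono H K N x : subgroup H -> subgroup K -> H `<=` K ->
  on_set N `<=` H -> trace_image H [set: G] x -> trace_image K [set: G] x.
Proof.
move=> sH sK HK NH; apply: trace_image_tower => //.
  exact: finite_left_cosets_open NH.
by apply: finite_left_cosets_open (subset_trans NH HK).
Qed.

Lemma trace_image_setmulS H K N M x : subgroup H -> subgroup K -> H `<=` K ->
    on_set N `<=` on_set M ->
  trace_image (setmul H N) [set: G] x -> trace_image (setmul K M) [set: G] x.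
Proof.
move=> sH sK HK NM; apply: (@trace_image_mono _ _ N).
- exact: setmul_subgroup.
- exact: setmul_subgroup.
- exact: setmulS.
- exact: sub_setmulr.
Qed.

Lemma cent_subgroup N (c : G_mod N) : subgroup (cent c).
Proof.
split; rewrite /cent /=.
- by rewrite to_mod1 mul1g invg1 mulg1.
- move=> x y xc yc.
  have -> : (to_mod N (x * y) * c * (to_mod N (x * y))^-1 =
      to_mod N x * (to_mod N y * c * (to_mod N y)^-1) * (to_mod N x)^-1)%g.
    by rewrite to_modM invMg !mulgA.
  by rewrite yc.
- by move=> x xc; rewrite -{1}xc to_modV invgK !mulgA mulVg mul1g mulgVK.
Qed.

Lemma sub_cent N (c : G_mod N) : on_set N `<=` cent c.
Proof.
by move=> n Nn; rewrite /cent /= (to_mod_on Nn) mul1g invg1 mulg1.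
Qed.

(** Dedekind's modular law, as [M] is contained in [cent c]. *)
Lemma setmul_cent D N M (c : G_mod N) : on_set M `<=` on_set N ->
  setmul D M `&` cent c = setmul (D `&` cent c) M.
Proof.
move=> MN; have [_ cM cV] := cent_subgroup c; apply/seteqP; split=> x.
  move=> [[d Dd [m Mm <-]] dmc]; exists d; last by exists m.
  split=> //; rewrite -(mulgK m d); apply: cM => //; apply: cV.
  exact/sub_cent/MN.
move=> [d [Dd dc] [m Mm <-]]; split; first by exists d => //; exists m.
by apply: cM => //; exact/sub_cent/MN.
Qed.

(** [trace_split] gives a point [c] depending on the level of the trace. If each of the finitely
    many [c] failed at some level, a level below all of these would contradict it. *)
Lemma otrace_split (e : kG) D N : primitive_central_idempotent e ->
    subgroup D -> otrace_image D e -> cgpr N e != 0 ->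
  exists c : G_mod N, (cgpr N e c : k) != 0 /\ otrace_image (D `&` cent c) e.
Proof.
move=> ePrim sD De eN0; apply: contrapT => /forallNP nc.
have ex (c : G_mod N) : exists M, (cgpr N e c : k) != 0 ->
    ~ trace_image (setmul (D `&` cent c) M) [set: G] e.
  apply: contrapT => /forallNP nM; apply: (nc c).
  have [ec0|/negP ec0] := boolP ((cgpr N e c : k) != 0); last first.
    by case: (nM N).
  by split=> // M _; apply: contrapT => nt; apply: (nM M).
have [M MP] := openNormal_inf (fun c => projT1 (cid (ex c))).
pose M' := onI M N.
have M'N : on_set M' `<=` on_set N by move=> g [].
have M'M : on_set M' `<=` on_set M by move=> g [].
have [c [ec0]] := trace_split ePrim (setmul_subgroup M' sD)
  (sub_setmulr sD) (De M' I) eN0.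
rewrite setmul_cent// => ct; apply: (projT2 (cid (ex c))) => //.
have sDc := subgroupI sD (cent_subgroup c).
by apply: trace_image_setmulS ct => //; exact: subset_trans (MP c).
Qed.

End OrdinaryTraces.

(** * Orbit counting in characteristic p *)

Section CharacteristicCount.
Variables (T : groupType) (P : set T) (X : finType) (act : T -> X -> X).
Hypotheses (sP : subgroup P) (act1 : forall x, act 1%g x = x).
Hypothesis actM : forall g h x, act (g * h)%g x = act g (act h x).

Lemma orb_refl x : orb P act x x.
Proof. by apply/asboolP; exists 1%g => //; case: sP. Qed.

Lemma orb_class (x y : X) : ([set z | orb P act y z] == [set z | orb P act x z])%SET
  = orb P act x y.
Proof.
have [_ PM PV] := sP; apply/eqP/idP => [xy|/asboolP[g Pg <-]].
  have : y \in [set z | orb P act y z]%SET by rewrite inE; exact: orb_refl.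
  by rewrite xy inE.
apply/setP => z; rewrite !inE; apply/asboolP/asboolP => -[h Ph <-].
  by exists (h * g)%g; [exact: PM|exact: actM].
exists (h * g^-1)%g; first by apply: PM => //; exact: PV.
by rewrite actM -(actM g^-1%g) mulVg act1.
Qed.

(** [F] is constant on each orbit, so an orbit whose length is divisible by [p] contributes zero. *)
Lemma sum_orbit_pchar (k : fieldType) (p : nat) (A : pred X) (F : X -> k) :
    p \in [pchar k] ->
    (forall g x, P g -> A x -> A (act g x) /\ F (act g x) = F x) ->
    \sum_(x | A x) F x != 0 ->
  exists2 x, A x & ~~ (p %| #|orb P act x|)%N.
Proof.
move=> pk AF; rewrite (partition_big (fun x => [set z | orb P act x z]%SET) xpredT)//=.
move=> FA0; apply: contrapT => nx; case/negP: FA0; apply/eqP/big1 => C _.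
have [[x /andP[Ax /eqP xC]]|nC] := pselect (exists x, A x &&
    ([set z | orb P act x z] == C)%SET); last first.
  by rewrite big_pred0// => x; apply/negbTE/negP => xC; apply: nC; exists x.
have -> : \sum_(y | A y && ([set z | orb P act y z] == C)%SET) F y =
    \sum_(y | orb P act x y) F x.
  rewrite (eq_bigl (orb P act x)) => [|y]; last first.
    rewrite -xC orb_class; apply/andb_idl => /asboolP[g Pg <-].
    by have [] := AF g x Pg Ax.
  by apply: eq_bigr => y /asboolP[g Pg <-]; have [] := AF g x Pg Ax.
rewrite sumr_const; apply: contra_notP nx => /eqP Fx; exists x => //.
apply: contraNN Fx => /dvdnP[m ->]; rewrite mulrnA -mulr_natr.
by rewrite (pcharf0 pk) mulr0.
Qed.

End CharacteristicCount.

(** * Pro-p subgroups and conjugates of closed subgroups *)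

Section ProP.
Variables (p : nat) (G : profiniteGroupType).
Implicit Types (N M : openNormal G) (D H L Q : set G).

Lemma gimg1 N D : gimg N (D `&` on_set N) \subset [set 1%g]%SET.
Proof.
apply/fintype.subsetP => _ /gimgP[g [_ Ng] <-]; rewrite inE; apply/eqP.
by rewrite -to_mod1; apply/to_modP; rewrite mulg1; exact: onV.
Qed.

Lemma on_subgroup_setI N D : subgroup D -> subgroup (D `&` on_set N).
Proof. by move=> sD; apply: subgroupI => //; exact: on_subgroup. Qed.

Lemma open_subgroup_inP Q D : subgroup D -> open_subgroup_in Q D ->
  exists N, D `&` on_set N `<=` Q.
Proof.
move=> [D1 _ _] [[Q1 _ _] [U oU QE]].
have [|N NU] := @open_normal_base G U.
  by apply: open_nbhs_nbhs; split=> //; move: Q1; rewrite QE => -[].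
by exists N => x [Dx /NU Ux]; rewrite QE.
Qed.

(** Every open subgroup of [D] contains some intersection of [D] with an open normal [N] of [G], so
    the quotients by these decide. *)
Lemma pro_pP D : subgroup D ->
  pro_p p D <-> forall N, (p.-nat #|gimg N D|)%N.
Proof.
move=> sD; split=> [pD N|pD U [sU [O oO UE]] nU].
  have sDN := on_subgroup_setI N sD.
  have [_ iE] := coset_index_gimg sD sDN (@subIsetl _ _ _) (fun _ => id).
  have gimgDN : gimg N (D `&` on_set N) = 1%g.
    apply/eqP; rewrite finset.eqEsubset gimg1 finset.sub1set.
    exact: group1 (gimg_group N sDN).
  rewrite -[gimg N D]/(gval (gimg_group N sD)) -indexg1 -gimgDN -iE; apply: pD.
    by split=> //; exists (on_set N) => //; exact: on_open.
  move=> g n Dg [Dn Nn]; split; last exact: onJ.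
  by have [_ DM DV] := sD; apply: (DM); [exact: DM|exact: DV].
have UD : U `<=` D by rewrite UE; exact: subIsetl.
have [|N NU] := open_subgroup_inP sD (_ : open_subgroup_in U D).
  by split=> //; exists O.
have [_ ->] := coset_index_gimg sD sU UD NU.
apply: pnat_dvd (pD N); exact: (dvdn_indexg (gimg_group N sD) (gimg_group N sU)).
Qed.

Lemma pro_p_index D Q N : prime p -> subgroup D -> pro_p p D -> subgroup Q ->
  Q `<=` D -> D `&` on_set N `<=` Q -> (p.-nat (coset_index D Q))%N.
Proof.
move=> pp sD /(pro_pP sD) pD sQ QD NQ; have [_ ->] := coset_index_gimg sD sQ QD NQ.
apply: pnat_dvd (pD N); exact: (dvdn_indexg (gimg_group N sD) (gimg_group N sQ)).
Qed.

Lemma coset_index1 D Q : subgroup D -> subgroup Q -> Q `<=` D ->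
  finite_set (left_cosets D Q) -> coset_index D Q = 1%N -> Q = D.
Proof.
move=> sD sQ QD fDQ; rewrite /coset_index => /eqP /cardfs1P[C CE].
apply/seteqP; split=> // d Dd.
have mem x : D x -> lcos x Q = C.
  move=> Dx; apply/eqP; rewrite -in_fset1 -CE in_fset_set//.
  by apply/mem_set; exists x.
have D1 : D 1%g by case: sD.
have : lcos 1%g Q = lcos d Q by rewrite !mem.
by move/(lcosP sQ); rewrite invg1 mul1g.
Qed.

End ProP.

Section Closed.
Variable G : profiniteGroupType.
Implicit Types (N M : openNormal G) (D H L Q : set G) (g h : G).

Lemma nbhs_lcoset g N : nbhs g [set (g * n)%g | n in on_set N].
Proof.
rewrite nbhsE; exists ((fun x => g^-1 * x)%g @^-1` on_set N).
  split; last by rewrite /= mulVg; exact: on1.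
  apply: open_comp; last exact: on_open.
  by move=> x _; apply: continuous_mulg => ?; [exact: cvg_cst|exact: cvg_id].
by move=> x Nx; exists (g^-1 * x)%g => //; rewrite mulVKg.
Qed.

Lemma coset_union_open (A : set G) N :
  (forall g n, A g -> on_set N n -> A (g * n)%g) -> open A.
Proof.
move=> AN; rewrite openE => g Ag; apply: filterS (nbhs_lcoset g N).
by move=> _ [n Nn <-]; exact: AN.
Qed.

Lemma coset_union_closed (A : set G) N :
  (forall g n, A g -> on_set N n -> A (g * n)%g) -> closed A.
Proof.
move=> AN; rewrite -[A]setCK; apply: open_closedC.
apply: (@coset_union_open _ N) => g n nA Nn An; apply: nA.
by rewrite -(mulgK n g); apply: AN => //; exact: onV.
Qed.

Lemma setmul_coset H N g n : setmul H N g -> on_set N n -> setmul H N (g * n)%g.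
Proof.
move=> [h Hh [m Mm <-]] Nn; exists h => //; exists (m * n)%g; first exact: onM.
exact: mulgA.
Qed.

Lemma closed_setmulP D g : closed D -> (forall N, setmul D N g) -> D g.
Proof.
move=> cD gD; apply: contrapT => nDg.
have [|N NU] := @open_normal_base G [set x | (~` D) (g * x)%g].
  have : nbhs (g * 1)%g (~` D).
    by rewrite mulg1; apply: open_nbhs_nbhs; split=> //; exact: closed_openC.
  by apply: (@continuous_mulg G G (fun=> g) id) => ?; [exact: cvg_cst|exact: cvg_id].
have [d Dd [n Nn dn]] := gD N.
by have := NU _ (onV Nn); rewrite /= -dn mulgK.
Qed.

(** The conjugate [g D g^-1], written as a preimage so that closedness follows from continuity. *)
Definition conjset g D : set G := [set x | D (g^-1 * x * g)%g].

Lemma conjset_subgroup g D : subgroup D -> subgroup (conjset g D).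
Proof.
move=> [D1 DM DV]; split; rewrite /conjset /=.
- by rewrite mulg1 mulVg.
- by move=> x y /DM/[apply] /=; rewrite !mulgA mulgK.
- by move=> x /DV /=; rewrite !invMg invgK !mulgA.
Qed.

Lemma conjset_closed g D : closed D -> closed (conjset g D).
Proof.
move=> cD; apply: (preimage_closed _ cD) => x _.
by do 2?apply: continuous_mulg => //; move=> ?; do ?[exact: cvg_cst|exact: cvg_id].
Qed.

Lemma conjsetK g D x : conjset g D (g * x * g^-1)%g <-> D x.
Proof. by rewrite /conjset /= !mulgA mulVg mul1g mulgVK. Qed.

Lemma gimg_conjset N g D :
  gimg N (conjset g D) = (gimg N D :^ (to_mod N g)^-1)%g.
Proof.
apply/setP => q; rewrite mem_conjgV; apply/idP/idP => /gimgP[x xD].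
  move=> <-; rewrite conjgE -to_modV -(to_modM N x) -to_modM mulgA.
  exact: mem_gimg.
rewrite conjgE => xq; apply/gimgP; exists (g * x * g^-1)%g; first exact/conjsetK.
by rewrite !to_modM to_modV xq !mulgA mulgV mul1g mulgK.
Qed.

(** In each [G/N] the images of [D] and of its conjugate have the same finite order, so the
    inclusion is an equality there; closedness carries this back to [D]. *)
Lemma closed_sub_conjset g D : subgroup D -> closed D ->
  D `<=` conjset g D -> conjset g D = D.
Proof.
move=> sD cD DgD; apply/seteqP; split=> // x gDx.
apply: closed_setmulP => // N; apply/(setmulP _ _ sD).
suff -> : gimg N D = gimg N (conjset g D) by exact: mem_gimg.
by apply/eqP; rewrite eqEcard gimgS// gimg_conjset cardJg leqnn.
Qed.

(** The [g] that work for [DN] form a closed set, shrinking with [N] and never empty; compactness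
    yields a common [g], and [D] is the intersection of the [DN]. *)
Lemma closed_conj_exists D (A : set G) : subgroup D -> closed D ->
    (forall N, exists g, A `<=` conjset g (setmul D N)) ->
  exists g, A `<=` conjset g D.
Proof.
move=> sD cD AN.
pose F N := [set g | A `<=` conjset g (setmul D N)].
have cF N : closed (F N).
  apply: (@coset_union_closed _ N) => g n Fg Nn x /Fg; rewrite /conjset /=.
  have [_ DM _] := setmul_subgroup N sD.
  rewrite invMg -!mulgA => gx; apply: DM; first exact/(sub_setmulr sD)/onV.
  by rewrite !mulgA; apply: setmul_coset => //; rewrite -!mulgA.
have dF N M : exists K, F K `<=` F N `&` F M.
  exists (onI N M) => g Fg; split=> x /Fg; apply: setmulS => // y [] //.
have [[g Fg]|nF] := pselect (exists g, forall N, F N g).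
  by exists g => x Ax; apply: (closed_setmulP cD) => N; exact: (Fg N x Ax).
have [|N FN] := compact_directed (onT G) (@profinite_compact G) cF dF open0.
  by move=> g Fg; apply: nF; exists g.
by have [g /FN] := AN N.
Qed.

(** The index of the intersection of [C] and [S] in [K] is computed through [C] and through [S]; the
    first route shows that its p-part is that of [|K : C|]. *)
Lemma index_dvd (S C K : set G) N (p : nat) : subgroup K -> subgroup S ->
    subgroup C -> S `<=` K -> C `<=` K -> on_set N `<=` S -> on_set N `<=` C ->
    prime p -> ~~ (p %| coset_index C (C `&` S))%N ->
  ((coset_index K S)`_p %| (coset_index K C)`_p)%N.
Proof.
move=> sK sS sC SK CK NS NC pp pCS.
have sCS := subgroupI sC sS.
have NCS : on_set N `<=` C `&` S by move=> n Nn; split; [exact: NC|exact: NS].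
have fin A B : subgroup A -> subgroup B -> B `<=` A -> on_set N `<=` B ->
  finite_set (left_cosets A B) by exact: finite_left_cosets_open.
have CSC := @subIsetl _ C S; have CSS := @subIsetr _ C S.
have t1 := coset_index_tower sK sC sCS CSC CK (fin _ _ sK sC CK NC)
  (fin _ _ sC sCS CSC NCS).
have t2 := coset_index_tower sK sS sCS CSS SK (fin _ _ sK sS SK NS)
  (fin _ _ sS sCS CSS NCS).
have pos A B : subgroup A -> subgroup B -> B `<=` A -> on_set N `<=` B ->
    (0 < coset_index A B)%N.
  move=> sA sB BA NB; have [|_ ->] := coset_index_gimg sA sB BA (N := N).
    by move=> x [_ /NB].
  exact: (indexg_gt0 (gimg_group N sA) (gimg_group N sB)).
have -> : ((coset_index K C)`_p)%N = ((coset_index K (C `&` S))`_p)%N.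
  by rewrite t1 partnM ?pos// (part_p'nat (n := coset_index C _)) ?p'natE// muln1.
by rewrite t2 partnM ?pos//; exact: dvdn_mulr.
Qed.

End Closed.

(** * Support points of traces *)

Section Defect.
Variables (p : nat) (k : fieldType).
Hypothesis charkp : p \in [pchar k].
Variable G : profiniteGroupType.
Local Notation kG := (cgalg k G).
Implicit Types (x a z : kG) (N M : openNormal G) (D H L P Q : set G) (g : G).

Let p_prime : prime p. Proof. exact: pcharf_prime charkp. Qed.

(** The coefficient at [c] is a sum over [G/L] whose terms are constant along [P]-orbits, because
    [P] fixes [c]. Being nonzero, it has an orbit of length prime to [p], and the stabiliser in [P]
    of a point [gL] is the intersection with [g L g^-1]. *)
Lemma trace_support L M N P x (c : G_mod N) :
    subgroup L -> on_set M `<=` L -> trace_image L [set: G] x ->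
    (cgpr N x c : k) != 0 -> subgroup P -> P `<=` cent c ->
  exists g, ~~ (p %| coset_index P (P `&` conjset g L))%N.
Proof.
move=> sL ML [a aL <-] xc0 sP Pc.
have [h hE trE] := cg_trace_ltrans sL ML aL.
move: xc0; rewrite trE linear_sum galg_sumE => xc0.
have [|Y /asboolP[g _ gY] pY] := sum_orbit_pchar sP (@ltrans1 G M)
    (@ltransM G M) charkp _ xc0.
  move=> y Y Py /asboolP[g _ <-]; split.
    by apply/asboolP; exists (y * g)%g; rewrite ?ltransM.
  rewrite -ltransM !hE cconjM cgpr_conj /=.
  have [_ _ PV] := sP; have := Pc _ (PV _ Py); rewrite /cent /=.
  by rewrite to_modV invgK => ->.
exists g; move: pY; rewrite -(coset_index_stab sP (@ltrans1 G M) (@ltransM G M)).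
suff -> : stab P (@ltrans G M) Y = P `&` conjset g L by [].
rewrite -gY; apply/seteqP; split=> y [Py].
  rewrite /= -ltransM => /esym/(ltrans_gimg sL ML).
  by rewrite mulgA => gyg; split.
move=> gyg; split=> //=; rewrite -ltransM.
by apply/esym/(ltrans_gimg sL ML); rewrite mulgA.
Qed.

Lemma cg_neq0 x : x <> 0 -> exists N (c : G_mod N), (cgpr N x c : k) != 0.
Proof.
move=> x0; apply: contrapT => nx; apply: x0; apply: cgalgP => N.
apply/ffunP => c; rewrite [RHS]ffunE; apply/eqP/contraT => xc.
by case: nx; exists N, c.
Qed.

Lemma coset_index_conjset N L g : subgroup L -> on_set N `<=` L ->
  coset_index [set: G] (conjset g L) = coset_index [set: G] L.
Proof.
move=> sL NL; have sLg := conjset_subgroup g sL.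
have [_ ->] := coset_index_gimg (@subgroupT G) sL (@subsetT _ _) (N := N)
  (fun y h => NL y h.2).
have [|_ ->] := coset_index_gimg (@subgroupT G) sLg (@subsetT _ _) (N := N).
  by move=> y [_ Ny]; apply: NL; rewrite -{2}(invgK g); exact: onJ.
rewrite gimgT -(divgS (finset.subsetT (gimg_group N sL))).
rewrite -(divgS (finset.subsetT (gimg_group N sLg))).
have -> // : #|gimg_group N sLg| = #|gimg_group N sL|.
by rewrite /= gimg_conjset cardJg.
Qed.

Lemma index_mod_dvd D N M : subgroup D -> on_set N `<=` on_set M ->
  (index_mod M D [set: G] %| index_mod N D [set: G])%N.
Proof.
move=> sD NM; rewrite /index_mod !setmulT.
have sDN := setmul_subgroup N sD; have sDM := setmul_subgroup M sD.
have DNM : setmul D N `<=` setmul D M by exact: setmulS.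
have NDN := sub_setmulr (N := N) sD.
rewrite (coset_index_tower (@subgroupT G) sDM sDN DNM (@subsetT _ _)).
- exact: dvdn_mulr.
- exact: finite_left_cosets_open (subset_trans NDN DNM).
- exact: finite_left_cosets_open NDN.
Qed.

Lemma otrace_finite_pindex D x : subgroup D -> otrace_image D x -> x <> 0 ->
  finite_pindex p D [set: G].
Proof.
move=> sD Dx /cg_neq0[N [c xc0]].
(* This bound comes from one fixed support point and does not depend on [M]. *)
pose b := logn p (coset_index [set: G] (cent c)).
have sc := cent_subgroup c.
have bound M : (logn p (index_mod M D [set: G]) <= b)%N.
  rewrite -(@dvdn_Pexp2l p) ?prime_gt1// -!p_part.
  pose M' := onI M N.
  (* The level must lie below [N], so that it is contained in [cent c] as [index_dvd] requires. *)
  have M'N : on_set M' `<=` on_set N by move=> g [].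
  have M'M : on_set M' `<=` on_set M by move=> g [].
  have sDM := setmul_subgroup M' sD; have MDM := sub_setmulr (N := M') sD.
  apply: (dvdn_trans (partn_dvd p _ (index_mod_dvd sD M'M))).
    rewrite /index_mod setmulT.
    have [|_ ->] := coset_index_gimg (@subgroupT G) sDM (@subsetT _ _) (N := M').
      by move=> x' [_ /MDM].
    exact: (indexg_gt0 (gimg_group _ (@subgroupT G)) (gimg_group _ sDM)).
  have [g pg] := trace_support sDM MDM (Dx M' I) xc0 sc (@subset_refl _ _).
  rewrite /index_mod setmulT -(coset_index_conjset g sDM MDM).
  apply: (index_dvd (N := M')) => //.
  - exact: conjset_subgroup.
  - by move=> y My; apply: MDM; rewrite -{2}(invgK g); exact: onJ.
  - exact: subset_trans M'N (@sub_cent _ _ c).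
have exi : exists i, `[< exists M, logn p (index_mod M D [set: G]) = i >].
  by exists (logn p (index_mod N D [set: G])); apply/asboolP; exists N.
have [|i /asboolP[M Mi] imax] := ex_maxnP exi (m := b).
  by move=> i /asboolP[M <-].
exists (p ^ i)%N; split; first by exists M; rewrite p_part Mi.
move=> M'; rewrite p_part dvdn_Pexp2l ?prime_gt1//; apply: imax.
by apply/asboolP; exists M'.
Qed.

(* A pro-[p] group fixing a point of the support of [Tr_D^G a] fixes a point of
   [G/DM] for every [M]. *)
Lemma otrace_sub_conjset D P N x (c : G_mod N) :
    closed_subgroup D -> otrace_image D x -> (cgpr N x c : k) != 0 ->
    subgroup P -> pro_p p P -> P `<=` cent c ->
  exists g, P `<=` conjset g D.
Proof.
move=> [sD cD] Dx xc0 sP pP Pc; apply: closed_conj_exists => // M.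
have sDM := setmul_subgroup M sD; have MDM := sub_setmulr (N := M) sD.
have [g pg] := trace_support sDM MDM (Dx M I) xc0 sP Pc.
exists g; have sPg := subgroupI sP (conjset_subgroup g sDM).
have PgP := @subIsetl _ P (conjset g (setmul D M)).
have MPg : P `&` on_set M `<=` P `&` conjset g (setmul D M).
  move=> y [Py My]; split=> //; apply: MDM; rewrite -{2}(invgK g); exact: onJ.
have /p_natP[m mE] := pro_p_index p_prime sP pP sPg PgP MPg.
(* The orbit length is a power of [p] and prime to [p], so the orbit is a single fixed point. *)
have m0 : coset_index P (P `&` conjset g (setmul D M)) = 1%N.
  by move: pg; rewrite mE; case: m {mE} => // m; rewrite expnS dvdn_mulr.
have [fP _] := coset_index_gimg sP sPg PgP MPg.
by rewrite -{1}(coset_index1 sP sPg PgP fP m0); exact: subIsetr.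
Qed.

End Defect.

Section ConjugationAction.
Variables (G : profiniteGroupType) (N : openNormal G).

Definition conj_mod (g : G) (c : G_mod N) : G_mod N :=
  (to_mod N g * c * (to_mod N g)^-1)%g.

Lemma conj_mod1 c : conj_mod 1%g c = c.
Proof. by rewrite /conj_mod to_mod1 mul1g invg1 mulg1. Qed.

Lemma conj_modM g h c : conj_mod (g * h)%g c = conj_mod g (conj_mod h c).
Proof. by rewrite /conj_mod to_modM invMg !mulgA. Qed.

End ConjugationAction.

(** * The Brauer homomorphism *)

Section Brauer.
Variables (p : nat) (k : fieldType).
Hypothesis charkp : p \in [pchar k].
Variable G : profiniteGroupType.
Local Notation kG := (cgalg k G).
Implicit Types (x y z : kG) (N M : openNormal G) (D H L P Q : set G) (g : G).

Let p_prime : prime p. Proof. exact: pcharf_prime charkp. Qed.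

Lemma cg_closureP (A : set kG) x :
  closure A x <-> forall N, exists2 y, A y & cgpr N y = cgpr N x.
Proof.
split=> [Ax N|Ax B [N NB]]; last first.
  by have [y Ay yx] := Ax N; exists y; split=> //; exact: NB.
have [|y [Ay yx]] := Ax [set y | cgpr N y = cgpr N x]; first by exists N.
by exists y.
Qed.

Definition proper_traces D : set kG := [set x | exists (n : nat) (t : 'I_n -> kG),
    (forall i, exists Q, [/\ open_subgroup_in Q D, Q <> D
                           & trace_image Q D (t i)]) /\
    x = \sum_i t i].

Lemma brauer_kernelE D : brauer_kernel D = closure (proper_traces D).
Proof. by []. Qed.

Lemma proper_traces0 D : proper_traces D 0.
Proof. by exists 0%N, (fun _ => 0); split=> [[]//|]; rewrite big_ord0. Qed.

Lemma proper_traces1 D Q x : open_subgroup_in Q D -> Q <> D ->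
  trace_image Q D x -> proper_traces D x.
Proof.
move=> QD nQD Qx; exists 1%N, (fun _ => x); split; last by rewrite big_ord1.
by move=> _; exists Q.
Qed.

Lemma proper_tracesD D x y : proper_traces D x -> proper_traces D y ->
  proper_traces D (x + y).
Proof.
move=> [n [t [tP ->]]] [m [s [sP ->]]].
exists (n + m)%N, (fun i => match fintype.split i with inl i => t i | inr i => s i end).
split=> [i|]; first by case: (fintype.split i) => j; [exact: tP|exact: sP].
rewrite big_split_ord /=; congr (_ + _); apply: eq_bigr => i _.
  by rewrite (unsplitK (inl i)).
by rewrite (unsplitK (inr i)).
Qed.

Lemma open_subgroup_in_sub Q D : open_subgroup_in Q D -> Q `<=` D.
Proof. by move=> [_ [U _ ->]]; exact: subIsetl. Qed.

Lemma finite_open_cosets Q D : subgroup D -> open_subgroup_in Q D ->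
  finite_set (left_cosets D Q).
Proof.
move=> sD oQ; have [N NQ] := open_subgroup_inP sD oQ.
by have [] := coset_index_gimg sD oQ.1 (open_subgroup_in_sub oQ) NQ.
Qed.

Lemma proper_tracesN D x : subgroup D -> proper_traces D x ->
  proper_traces D (- x).
Proof.
move=> sD [n [t [tP ->]]]; exists n, (fun i => t i * -1); split=> [i|]; last first.
  by rewrite -mulr_suml mulrN1.
have [Q [oQ nQ Qt]] := tP i; exists Q; split=> //.
apply: trace_image_central => //; first exact: finite_open_cosets.
by move=> y; rewrite mulrN1 mulN1r.
Qed.

Lemma brauer_eq0 D x : subgroup D -> brauer D x = brauer D 0 <-> brauer_kernel D x.
Proof.
move=> sD.
have K0 : brauer_kernel D (0 : kG).
  rewrite brauer_kernelE; apply/cg_closureP => N.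
  by exists 0 => //; exact: proper_traces0.
have KB y z : brauer_kernel D y -> brauer_kernel D z -> brauer_kernel D (z - y).
  rewrite brauer_kernelE => /cg_closureP Ky /cg_closureP Kz.
  apply/cg_closureP => N; have [u Bu uy] := Ky N; have [v Bv vz] := Kz N.
  exists (v - u); last by rewrite !linearB /= uy vz.
  by apply: proper_tracesD => //; exact: proper_tracesN.
have KD y z : brauer_kernel D y -> brauer_kernel D z -> brauer_kernel D (z + y).
  by move=> Ky Kz; rewrite -[y]opprK; apply: (KB) => //; rewrite -sub0r; exact: KB.
split=> [xD|Kx].
  have : brauer D x x by exists 0 => //; rewrite addr0.
  by rewrite xD => -[z Kz]; rewrite add0r => <-.
apply/seteqP; split=> _ [z Kz <-].
  by exists (x + z); rewrite ?add0r//; exact: KD.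
by exists (z - x); [exact: KB|rewrite add0r addrC subrK].
Qed.

(** Modulo [N], cut [x] into its parts over the points of [G/N]. Points moved by [D] form nontrivial
    orbits, and each orbit sum is a trace from a proper open stabiliser. If fixed points never
    carried a coefficient, [x] would be approximated at every level by sums of proper traces. *)
Lemma brauer_support D x : subgroup D -> cg_fixed D x ->
    brauer D x <> brauer D 0 ->
  exists N (c : G_mod N), D `<=` cent c /\ (cgpr N x c : k) != 0.
Proof.
move=> sD xD nx; apply: contrapT => nc; apply: nx.
apply/(brauer_eq0 _ sD); rewrite brauer_kernelE; apply/cg_closureP => N.
have c1 := @conj_mod1 G N; have cM := @conj_modM G N.
pose O (c : G_mod N) := [set c' | orb D (@conj_mod G N) c c']%SET.
have Dact c g : D g -> cconj g (cg_res c x) = cg_res (conj_mod g c) x.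
  by move=> Dg; rewrite [LHS]cg_res_conj; congr cg_res; exact: xD.
pose moved (c : G_mod N) := `[< exists2 g, D g & conj_mod g c <> c >].
exists (\sum_(c | moved c) cg_res c x); last first.
  rewrite -[in RHS](cg_res_sum N x) !linear_sum /= [RHS](bigID moved) /=.
  rewrite [X in _ = _ + X]big1 ?addr0// => c /asboolPn mc.
  have Dc : D `<=` cent c.
    by move=> g Dg; apply: contrapT => gc; apply: mc; exists g.
  apply/ffunP => m; rewrite cgpr_res// [RHS]ffunE; case: eqP => // mE.
  have [m' m'E] := to_mod_surj m; move: mE; rewrite -m'E mod_projE// => ->.
  by apply/eqP/contraT => xc; case: nc; exists N, c.
rewrite (partition_big O xpredT) //=.
apply: (big_ind (proper_traces D)).
- exact: proper_traces0.
- exact: proper_tracesD.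
move=> C _.
have [[c /andP[mc /eqP cC]]|nC] := pselect (exists c, moved c && (O c == C));
    last first.
  rewrite big_pred0; first exact: proper_traces0.
  by move=> c; apply/negbTE/negP => cC; apply: nC; exists c.
have -> : \sum_(c' | moved c' && (O c' == C)) cg_res c' x =
    \sum_(c' | orb D (@conj_mod G N) c c') cg_res c' x.
  apply: eq_bigl => c'; rewrite -cC (orb_class sD c1 cM).
  apply/andb_idl => /asboolP[g Dg gc]; apply/asboolP; apply: contrapT => nm.
  have fixc' h : D h -> conj_mod h c' = c'.
    by move=> Dh; apply: contrapT => hc'; apply: nm; exists h.
  have [_ _ DV] := sD; have := fixc' _ (DV _ Dg).
  rewrite -{1}gc -cM mulVg c1 => cc'.
  by have [h Dh] := asboolP _ mc; rewrite cc' fixc'.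
have sst := stab_subgroup sD c1 cM c.
apply: (@proper_traces1 _ (stab D (@conj_mod G N) c)).
- split=> //; exists (cent c) => //.
  apply: (@coset_union_open _ _ N) => g n gc Nn.
  have [_ CM _] := cent_subgroup c; apply: CM => //; exact: sub_cent.
- move=> stD; have [h] := asboolP _ mc.
  by rewrite -{1}stD => -[_ hc].
- exists (cg_res c x).
    move=> g [Dg gc]; rewrite -[LHS]/(cconj g _) Dact//.
    by rewrite [conj_mod g c]gc.
  apply: (@csum_stab _ _ _ _ sD c1 cM c _ (fun g => cconj g (cg_res c x))
    (fun c' => cg_res c' x)) => g Dg.
  by rewrite Dact.
Qed.

(** At a point fixed by [D], a trace from [Q] has coefficient [|D : Q|] times that of the original
    element; the index is a nontrivial power of [p], so the coefficient vanishes. *)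
Lemma brauer_neq0 D x N (c : G_mod N) : subgroup D -> pro_p p D ->
  D `<=` cent c -> (cgpr N x c : k) != 0 -> brauer D x <> brauer D 0.
Proof.
move=> sD pD Dc xc /(brauer_eq0 _ sD); rewrite brauer_kernelE.
move=> /cg_closureP/(_ N)[_ [n [t [tP ->]]] tx].
case/negP: xc; rewrite -tx linear_sum galg_sumE; apply/eqP/big1 => i _.
have [Q [oQ nQ [a aQ <-]]] := tP i.
have [sQ QD] := (oQ.1, open_subgroup_in_sub oQ).
have fQ := finite_open_cosets sD oQ.
have [M MQ] := open_subgroup_inP sD oQ.
rewrite /= cg_traceE cgpr_csum// /csum fsbig_finite// galg_sumE.
rewrite -(fsbig_finite _ (fun C => cgpr N (cconj (xget 1%g C) a) c : k))//.
rewrite -[LHS]/(csum D Q (fun g => cgpr N (cconj g a) c : k)).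
rewrite (csum_ext (F' := fun _ => cgpr N a c : k))//; last first.
  move=> g Dg; rewrite cgpr_conj.
  have [_ _ DV] := sD; have := Dc _ (DV _ Dg); rewrite /cent /=.
  by rewrite to_modV invgK => ->.
rewrite csum_const//.
have /p_natP[m mE] := pro_p_index p_prime sD pD sQ QD MQ.
case: m mE => [|m] mE; first by case: nQ; exact: coset_index1 mE.
by rewrite mE expnS mulrnA -(mulr_natr _ p) (pcharf0 charkp) mulr0 mul0rn.
Qed.

End Brauer.

(** * Defect groups *)

Section DefectGroups.
Variables (p : nat) (k : fieldType).
Hypothesis charkp : p \in [pchar k].
Variable G : profiniteGroupType.
Local Notation kG := (cgalg k G).
Implicit Types (x y z : kG) (N M : openNormal G) (D H K L P Q : set G) (g : G).

Let p_prime : prime p. Proof. exact: pcharf_prime charkp. Qed.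

Lemma natr_pchar_neq0 n : ~~ (p %| n)%N -> n%:R != 0 :> k.
Proof. by rewrite (dvdn_pcharf charkp). Qed.

(** An element fixed by [K] is the trace from [H] to [K] of its quotient by [|K : H|]. *)
Lemma trace_image_p'index H K L x : subgroup H -> subgroup K -> subgroup L ->
    H `<=` K -> K `<=` L -> finite_set (left_cosets K H) ->
    finite_set (left_cosets L K) -> ~~ (p %| coset_index K H)%N ->
  trace_image K L x -> trace_image H L x.
Proof.
move=> sH sK sL HK KL fKH fLK /natr_pchar_neq0 n0 [a aK <-].
set n := coset_index K H in n0.
have bK : cg_fixed K (n%:R^-1 *: a).
  by move=> h Kh; rewrite -[LHS]/(cconj h _) linearZ /= [cconj h a]aK.
exists (n%:R^-1 *: a); first exact: cg_fixedS bK.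
rewrite (cg_trace_tower sH sK sL)//; last exact: cg_fixedS bK.
congr cg_trace; rewrite cg_traceE.
rewrite (csum_ext (F' := fun _ => n%:R^-1 *: a))//.
by rewrite csum_const// -scaler_nat scalerA mulfV// scale1r.
Qed.

(** The preimage [E] in [D] of a Sylow p-subgroup of the image of [D] in [G/N] has index prime to
    [p], so it inherits the trace condition; minimality forces [E = D]. *)
Lemma minimal_otrace_pro_p D x : closed_subgroup D ->
  minimal_closed (fun H => otrace_image H x) D -> pro_p p D.
Proof.
move=> [sD cD] [Dx Dmin]; apply/(pro_pP _ sD) => N.
pose DN := gimg_group N sD.
have [S sylS] := Sylow_exists p DN.
pose E : set G := D `&` [set g | to_mod N g \in S].
have sE : subgroup E.
  apply: subgroupI => //; split; rewrite /=.
  - by rewrite to_mod1 group1.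
  - by move=> a b Sa Sb /=; rewrite to_modM groupM.
  - by move=> a Sa /=; rewrite to_modV groupV.
have NE : D `&` on_set N `<=` E.
  by move=> n [Dn Nn]; split=> //=; rewrite (to_mod_on Nn) group1.
have ED : E `<=` D by exact: subIsetl.
have gE : gimg N E = S.
  apply/setP => q; apply/idP/idP => [/gimgP[g [_ /= gS] <-]//|qS].
  have /gimgP[g Dg gq] : q \in DN by exact: (fintype.subsetP (pHall_sub sylS)).
  by apply/gimgP; exists g => //; split; rewrite //= gq.
have iE : ~~ (p %| coset_index D E)%N.
  have [_ ->] := coset_index_gimg sD sE ED NE; rewrite gE -p'natE//.
  by case/and3P: sylS.
have cE : closed_subgroup E.
  split=> //; apply: closedI => //.
  apply: (@coset_union_closed _ _ N) => g n gS Nn /=.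
  rewrite (_ : to_mod N (g * n)%g = to_mod N g)//.
  by apply/esym/to_modP; rewrite mulKg.
have /Dmin : otrace_image E x.
  (* Below [N] the index [|DM' : EM'|] equals [|D : E|], so it stays prime to [p]. *)
  move=> M _; pose M' := onI M N.
  have M'N : on_set M' `<=` on_set N by move=> g [].
  have M'M : on_set M' `<=` on_set M by move=> g [].
  apply: (@trace_image_setmulS _ _ E E M') => //.
  have sDM := setmul_subgroup M' sD; have sEM := setmul_subgroup M' sE.
  have EDM : setmul E M' `<=` setmul D M' by exact: setmulS.
  apply: trace_image_p'index (Dx M' I) => //.
  - exact: finite_left_cosets_open (sub_setmulr sE).
  - exact: finite_left_cosets_open (sub_setmulr sD).
  have [|_ ->] := coset_index_gimg sDM sEM EDM (N := M').
    by move=> g [_ /(sub_setmulr sE)].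
  rewrite !gimg_setmul//.
  have [|_ <-//] := coset_index_gimg sD sE ED (N := M').
  by move=> g [Dg /M'N Ng]; exact: NE.
move=> /(_ cE ED) DE.
by rewrite -{1}DE gE; exact: pHall_pgroup sylS.
Qed.

Lemma closed_subgroup_cent D N (c : G_mod N) :
  closed_subgroup D -> closed_subgroup (D `&` cent c).
Proof.
move=> [sD cD]; split; first exact: subgroupI (cent_subgroup c).
apply: closedI => //; apply: (@coset_union_closed _ _ N) => g n gc Nn.
by have [_ CM _] := cent_subgroup c; apply: CM => //; exact: sub_cent.
Qed.

Section BlockIdempotent.
Variable e : kG.
Hypothesis ePrim : primitive_central_idempotent e.

Let eC : centre e. Proof. by case: ePrim => [[]]. Qed.

Lemma central_fixed D : cg_fixed D e.
Proof. by move=> h _; exact: cconj_central. Qed.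

Lemma minimal_otrace_brauer D : closed_subgroup D ->
    minimal_closed (fun H => otrace_image H e) D ->
  [/\ pro_p p D, otrace_image D e & brauer D e <> brauer D 0].
Proof.
move=> cD minD; have pD := minimal_otrace_pro_p cD minD.
have [De Dmin] := minD; split=> //; have [sD _] := cD.
have [N eN] : exists N, cgpr N e != 0.
  have /cg_neq0[N [c ec]] : e <> 0 by case: ePrim.
  by exists N; apply: contraNneq ec => ->; rewrite ffunE.
have [c [ec Dce]] := otrace_split ePrim sD De eN.
have DcD := Dmin _ (closed_subgroup_cent c cD) Dce (@subIsetl _ _ _).
apply: (brauer_neq0 charkp sD pD) ec.
by rewrite -DcD; exact: subIsetr.
Qed.

Lemma brauer_sub_conjset D P : closed_subgroup D -> otrace_image D e ->
    subgroup P -> pro_p p P -> brauer P e <> brauer P 0 ->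
  exists g, P `<=` conjset g D.
Proof.
move=> cD De sP pP /(brauer_support sP (@central_fixed P))[N [c [Pc ec]]].
exact: (otrace_sub_conjset charkp cD De ec).
Qed.

(** The inclusions of [D] in [D'] and of [D'] in a conjugate of [D] collapse, since a closed
    subgroup is never properly contained in a conjugate of itself. Minimality, next, exchanges the
    roles of [D] and [D']. *)
Lemma brauer_otrace_maximal D : closed_subgroup D -> pro_p p D ->
    otrace_image D e -> brauer D e <> brauer D 0 ->
  maximal_closed (fun H => pro_p p H /\ brauer H e <> brauer H 0) D.
Proof.
move=> cD pD De bD; split=> // D' [sD' _] [pD' bD'] DD'.
have [g D'g] := brauer_sub_conjset cD De sD' pD' bD'.
have [sD clD] := cD.
have DE := closed_sub_conjset sD clD (subset_trans DD' D'g).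
by apply/seteqP; split=> //; rewrite -DE.
Qed.

Lemma brauer_otrace_minimal D : closed_subgroup D -> pro_p p D ->
    otrace_image D e -> brauer D e <> brauer D 0 ->
  minimal_closed (fun H => otrace_image H e) D.
Proof.
move=> [sD cD] pD De bD; split=> // D' cD' De' D'D.
have [g Dg] := brauer_sub_conjset cD' De' sD pD bD.
have [sD' clD'] := cD'.
have D'E := closed_sub_conjset sD' clD' (subset_trans D'D Dg).
by apply/seteqP; split=> //; rewrite -D'E.
Qed.

Lemma otrace_conjset D g : subgroup D -> otrace_image D e ->
  otrace_image (conjset g D) e.
Proof.
move=> sD De N _; have [a aD aE] := De N I.
have sDN := setmul_subgroup N sD; have sgD := conjset_subgroup g sD.
have NDN := sub_setmulr (N := N) sD.
have sgDN := setmul_subgroup N sgD.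
have Dg h : setmul (conjset g D) N h <-> setmul D N (g^-1 * h * g)%g.
  rewrite (setmulP _ _ sgD) gimg_conjset mem_conjgV conjgE -to_modV.
  by rewrite -(to_modM N h) -to_modM mulgA -(setmulP _ _ sD).
exists (cconj g a).
  move=> h /Dg gh; rewrite -[LHS]/(cconj h _) -cconjM.
  rewrite -[RHS](cg_fixed_cconj g aD gh); congr cconj.
  by rewrite !mulgA mulgV mul1g.
rewrite -aE !cg_traceE.
apply: (csum_reindex_eq (phi := fun h => (h * g)%g)) => //.
- by apply: finite_left_cosets_open (sub_setmulr sgD).
- move=> x y _ _; rewrite invMg !mulgA; split=> [?|/Dg].
    by apply/Dg; rewrite !mulgA.
  by rewrite !mulgA.
- move=> x _; exists (x * g^-1)%g => //; rewrite mulgVK mulVg.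
  by case: sDN.
- by move=> x y _ Hy; exact: cg_fixed_cconj aD Hy.
- by move=> x _; rewrite cconjM.
Qed.

Lemma pro_p_conjset D g : subgroup D -> pro_p p D -> pro_p p (conjset g D).
Proof.
move=> sD /(pro_pP _ sD) pD; apply/(pro_pP _ (conjset_subgroup g sD)) => N.
by rewrite gimg_conjset cardJg; exact: pD.
Qed.

(** No map between the two Brauer quotients is needed: a support point fixed by [D] is carried by
    [g] to one fixed by the conjugate, with the same coefficient because [e] is central. *)
Lemma brauer_neq0_conjset D g : subgroup D -> pro_p p D ->
  brauer D e <> brauer D 0 -> brauer (conjset g D) e <> brauer (conjset g D) 0.
Proof.
move=> sD pD /(brauer_support sD (@central_fixed D))[N [c [Dc ec]]].
apply: (@brauer_neq0 _ _ charkp _ _ _ N (conj_mod g c)).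
- exact: conjset_subgroup.
- exact: pro_p_conjset.
-   move=> x /Dc; rewrite /cent /conj_mod /= => gx.
  rewrite -[in RHS]gx !to_modM to_modV !invMg !invgK !mulgA.
  by rewrite mulgV mul1g mulgK.
- by rewrite /conj_mod centre_class.
Qed.

(** Zorn's lemma for reversed inclusion. If [E] is the intersection of a chain, [EN] is open and so
    contains a member of the chain by compactness; traces from that member times [N] are then traces
    from [EN]. *)
Lemma otrace_minimal_exists : exists2 D, closed_subgroup D &
  minimal_closed (fun H => otrace_image H e) D.
Proof.
pose T := {D : set G | closed_subgroup D /\ otrace_image D e}.
pose R (A B : T) := `[< sval B `<=` sval A >].
have T0 : closed_subgroup [set: G] /\ otrace_image [set: G] e.
  split; first by split; [exact: subgroupT|exact: closedT].
  move=> N _; rewrite setmulT; exists e; first exact: central_fixed.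
  have fT : finite_set (left_cosets [set: G] [set: G]).
    exact: finite_left_cosets_open (@subsetT _ (on_set (onT G))).
  rewrite cg_traceE (csum_ext (F' := fun _ => e))//; last first.
    by move=> g _; exact: cconj_central.
  rewrite csum_const// (_ : coset_index _ _ = 1%N) ?mulr1n//.
  have [|_ ->] := coset_index_gimg (@subgroupT G) (@subgroupT G)
    (@subset_refl _ _) (N := onT G); first by [].
  by rewrite gimgT indexgg.
have [|||A Atot|D Dmax] := @Zorn T R.
- by move=> A; apply/asboolP.
- by move=> A B C /asboolP AB /asboolP BC; apply/asboolP; exact: subset_trans AB.
- move=> [A PA] [B PB] /asboolP /= AB /asboolP /= BA.
  have E : A = B by apply/seteqP.
  by subst B; congr exist; exact: Prop_irrelevance.
(* The compactness argument needs a member of the chain; the empty chain is bounded by [G]. *)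
- have [[t0 At0]|nA] := pselect (exists t : T, A t); last first.
    by exists (exist _ [set: G] T0 : T) => t At; case: nA; exists t.
  pose I := {D : T | A D}.
  pose F (i : I) : set G := sval (sval i).
  have FP i : closed_subgroup (F i) /\ otrace_image (F i) e.
    exact: (svalP (sval i)).
  pose E := [set g | forall i, F i g].
  have sE : subgroup E.
    split; first by move=> i; have [[[]]] := FP i.
      move=> x y Ex Ey i; have [[[_ FM _]] _] := FP i.
      by move=> _; apply: FM.
    by move=> x Ex i; have [[[_ _ FV] _] _] := FP i; exact: FV.
  have cE : closed E.
    have -> : E = \bigcap_(i in [set: I]) F i.
      by apply/seteqP; split => z h i; [move=> _|]; exact: h.
    by apply: closed_bigI => i _; have [[]] := FP i.
  have oE : otrace_image E e.
    move=> N _.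
    have [i FiN] : exists i, F i `<=` setmul E N.
      apply: (compact_directed (exist _ t0 At0 : I) (@profinite_compact G)).
      - by move=> i; have [[]] := FP i.
      - move=> i j; have [/asboolP ij|/asboolP ji] := Atot _ _ (svalP i) (svalP j).
          by exists j => x Fx; split=> //; exact: ij.
        by exists i => x Fx; split=> //; exact: ji.
      - apply: (@coset_union_open _ _ N) => g n; exact: setmul_coset.
      - by move=> x Ex; exact: sub_setmull.
    have [[sF _] /(_ N Logic.I) oF] := FP i.
    apply: (@trace_image_mono k G (setmul (F i) N) _ N) oF;
      last exact: sub_setmulr.
    - exact: setmul_subgroup.
    - exact: setmul_subgroup.
    - move=> _ [x /FiN Ex [n Nn <-]]; exact: setmul_coset.
  exists (exist _ E (conj (conj sE cE) oE) : T) => t At; apply/asboolP => x /=.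
  exact: (fun Ex => Ex (exist _ t At)).
have [cD oD] := svalP D.
exists (sval D) => //; split=> // D' cD' oD' D'D.
have := Dmax (exist _ D' (conj cD' oD') : T).
by move=> /(_ (asboolT D'D)) <-.
Qed.

(** [D] lies in a conjugate of a minimal subgroup [D0]. That conjugate is itself pro-p with nonzero
    Brauer image, so maximality makes it equal to [D], which thus inherits the trace condition. *)
Lemma maximal_brauer_minimal D : closed_subgroup D ->
    maximal_closed (fun H => pro_p p H /\ brauer H e <> brauer H 0) D ->
  minimal_closed (fun H => otrace_image H e) D.
Proof.
move=> cD [[pD bD] Dmax]; have [D0 cD0 minD0] := otrace_minimal_exists.
have [pD0 oD0 bD0] := minimal_otrace_brauer cD0 minD0.
have [[sD _] [sD0 clD0]] := (cD, cD0).
have [g Dg] := brauer_sub_conjset cD0 oD0 sD pD bD.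
have DE : conjset g D0 = D.
  apply: Dmax => //.
    by split; [exact: conjset_subgroup|exact: conjset_closed].
  by split; [exact: pro_p_conjset|exact: brauer_neq0_conjset].
apply: brauer_otrace_minimal => //.
by rewrite -DE; exact: otrace_conjset.
Qed.

End BlockIdempotent.
End DefectGroups.

(** * The modified trace *)

(* [inv n] stands for the inverse of an [n] prime to [p], and [F] for the open
   submodules of a pseudocompact module. The averages of [v0] over [HK / HN]
   converge, as [N] shrinks, to a vector fixed by [HK]. *)
Section Average.
Variables (G : profiniteGroupType) (p : nat) (R : pzRingType) (V : lmodType R).
Variables (act : G -> V -> V) (inv : nat -> R).
Hypotheses (actD : forall g, {morph act g : u v / u - v})
  (actM : forall g h v, act (g * h)%g v = act g (act h v))
  (actZ : forall g n v, act g (inv n *: v) = inv n *: act g v)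
  (invK : forall n, ~~ (p %| n)%N -> inv n * n%:R = 1).
Variable F : set (set V).
Hypotheses (F0 : forall S, F S -> S 0)
  (FB : forall S, F S -> forall u v, S u -> S v -> S (u - v))
  (FA : forall S, F S -> forall g v, S v -> S (act g v))
  (FZ : forall S, F S -> forall n v, S v -> S (inv n *: v)).

Definition trivial_mod (S : set V) (N : openNormal G) :=
  forall g v, on_set N g -> S (act g v - v).

Hypotheses (FN : forall S, F S -> exists N, trivial_mod S N)
  (Fsep : forall v, (forall S, F S -> S v) -> v = 0)
  (Fcomplete : forall s : set V -> V,
    (forall S T, F S -> F T -> S `<=` T -> T (s S - s T)) ->
    exists u, forall S, F S -> S (u - s S)).
Variables (H : set G) (K : openNormal G) (v0 : V).
Hypotheses (sH : subgroup H) (v0H : forall h, H h -> act h v0 = v0).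
Hypothesis pHK : forall N : openNormal G, on_set N `<=` on_set K ->
  ~~ (p %| coset_index (setmul H K) (setmul H N))%N.

Definition average (N : openNormal G) : V :=
  inv (coset_index (setmul H K) (setmul H N)) *:
    csum (setmul H K) (setmul H N) (act^~ v0).

Let sHN (N : openNormal G) : subgroup (setmul H N). Proof. exact: setmul_subgroup. Qed.

Let fHN (N M : openNormal G) : on_set N `<=` on_set M ->
  finite_set (left_cosets (setmul H M) (setmul H N)).
Proof.
by move=> NM; apply: finite_left_cosets_open (sub_setmulr sH) => //; exact: setmulS.
Qed.

Let act_congr S g u v : F S -> S (u - v) -> S (act g u - act g v).
Proof. by move=> FS Suv; rewrite -actD; exact: FA. Qed.

Let act_coset S N g h : F S -> trivial_mod S N -> setmul H N h ->
  S (act (g * h)%g v0 - act g v0).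
Proof.
move=> FS SN [x Hx [n Nn <-]]; rewrite actM; apply: act_congr => //.
by rewrite actM -[X in _ - X](v0H Hx); apply: act_congr => //; exact: SN.
Qed.

Let trivial_modS S N M : on_set N `<=` on_set M -> trivial_mod S M ->
  trivial_mod S N.
Proof. by move=> NM SM g v /NM; exact: SM. Qed.

Let natrC n (r : R) : r * n%:R = n%:R * r.
Proof. by rewrite mulr_natl mulr_natr. Qed.

(** When [N] acts trivially modulo [S], the terms over [HK/HN'] are constant modulo [S] on each
    coset of [HN], so refinement multiplies both sum and index by [|HN : HN'|]. *)
Lemma average_congr S N N' : F S -> on_set N' `<=` on_set N ->
  on_set N `<=` on_set K -> trivial_mod S N -> S (average N' - average N).
Proof.
move=> FS N'N NK SN; have N'K := subset_trans N'N NK.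
have HN'N : setmul H N' `<=` setmul H N by exact: setmulS.
have HNK : setmul H N `<=` setmul H K by exact: setmulS.
have HN'K := subset_trans HN'N HNK.
rewrite /average (coset_index_tower (sHN K) (sHN N) (sHN N') HN'N HNK)//;
  [|exact: fHN..].
set a := coset_index _ (setmul H N); set b := coset_index (setmul H N) _.
have pab : ~~ (p %| a * b)%N.
  rewrite /a /b -(coset_index_tower (sHN K) (sHN N) (sHN N'))//;
    [exact: pHK|exact: fHN..].
have pa : ~~ (p %| a)%N by apply: contra pab; exact: dvdn_mulr.
(* [inv] is not assumed multiplicative; this instance follows from [invK], natural numbers being
   central. *)
have invE : inv (a * b)%N * b%:R = inv a.
  have ab1 : inv (a * b)%N * b%:R * a%:R = 1 
    by rewrite -mulrA -natrM [(b * a)%N]mulnC invK.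
  have := congr1 ( *%R^~ (inv a)) ab1.
  by rewrite mul1r -mulrA -natrC invK// mulr1.
have -> : inv a *: csum (setmul H K) (setmul H N) (act^~ v0) = inv (a * b)%N *:
    csum (setmul H K) (setmul H N) (fun g => act g v0 *+ b).
  rewrite -invE -scalerA scaler_nat; congr (_ *: _).
  by rewrite /csum !fsbig_finite ?sumrMnl//; exact: fHN.
rewrite -scalerBr; apply: FZ => //.
have SB := FB FS; have S0 := F0 FS.
apply: (addset_trans S0 SB) (csum_tower S0 SB (sHN K) (sHN N) (sHN N') HN'N HNK
  (fHN NK) (fHN N'N) (F := act^~ v0) _) _.
  move=> g h _ h'; apply: act_coset h' => //; exact: trivial_modS SN.
apply: csum_congr => // [|g Kg]; first exact: fHN.
rewrite -(csum_const (act g v0) (fHN N'N)).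
apply: csum_congr => // [|h Nh]; first exact: fHN.
exact: act_coset Nh.
Qed.

(** For each [S] some average is taken at a level acting trivially modulo [S]; modulo [S] it is
    independent of the level, so the family has a limit. Left translation by [HK] permutes [HK/HN],
    which gives invariance modulo every [S], hence exactly. *)
Lemma average_exists : exists v1 : V,
  (forall g, setmul H K g -> act g v1 = v1) /\
  (forall S N, F S -> on_set N `<=` on_set K -> trivial_mod S N ->
    S (v1 - average N)).
Proof.
have ex S : exists N, F S -> on_set N `<=` on_set K /\ trivial_mod S N.
  have [FS|nFS] := pselect (F S); last by exists K.
  have [N SN] := FN FS; exists (onI N K) => _; split; first by move=> g [].
  by apply: trivial_modS SN => g [].
pose n S := projT1 (cid (ex S)).
have nP S : F S -> on_set (n S) `<=` on_set K /\ trivial_mod S (n S).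
  exact: (projT2 (cid (ex S))).
have indep S N N' : F S -> on_set N `<=` on_set K -> on_set N' `<=` on_set K ->
    trivial_mod S N -> trivial_mod S N' -> S (average N - average N').
  move=> FS NK N'K SN SN'; have S0 := F0 FS; have SB := FB FS.
  apply: (addset_trans S0 SB (y := average (onI N N'))).
    by apply: (addset_sym S0 SB); apply: average_congr => // g [].
  by apply: average_congr => // g [].
have [S T FS FT ST|v1 v1P] := Fcomplete (s := fun S => average (n S)).
  have [nSK Sn] := nP S FS; have [nTK Tn] := nP T FT.
  by apply: indep => // g v /(Sn g v)/ST.
have v1E S N : F S -> on_set N `<=` on_set K -> trivial_mod S N ->
    S (v1 - average N).
  move=> FS NK SN; have [nSK Sn] := nP S FS.
  exact: (addset_trans (F0 FS) (FB FS)) (v1P _ FS) (indep _ _ _ FS nSK NK Sn SN).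
exists v1; split=> // g Kg; apply/subr0_eq/Fsep => S FS.
have [nSK Sn] := nP S FS; have S0 := F0 FS; have SB := FB FS.
set N := n S in nSK Sn; have v1N := v1E S N FS nSK Sn.
apply: (addset_trans S0 SB (y := act g (average N))); first exact: act_congr.
apply: (addset_trans S0 SB (y := average N)); last exact: (addset_sym S0 SB).
have HNK : setmul H N `<=` setmul H K by exact: setmulS.
rewrite actZ -scalerBr; apply: FZ => //.
have -> : act g (csum (setmul H K) (setmul H N) (act^~ v0)) =
    csum (setmul H K) (setmul H N) (fun h => act (g * h)%g v0).
  have act0 : act g 0 = 0 by have := actD g 0 0; rewrite !subrr.
  have actN v : act g (- v) = - act g v by rewrite -sub0r actD act0 sub0r.
  have actA u v : act g (u + v) = act g u + act g v.
    by rewrite -{1}[v]opprK actD actN opprK.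
  rewrite /csum !fsbig_finite; [|exact: fHN..].
  by apply: (big_rec2 (fun u v => act g u = v)) => // C u v _ <-; rewrite actA actM.
have [_ KM KV] := sHN K.
apply: (csum_reindex S0 SB (sHN K) (sHN N) HNK (fHN nSK) (phi := mulg g)) => //.
- by move=> h; exact: KM.
- by move=> h l _ _; rewrite invMg -mulgA mulKg.
- move=> h Kh; exists (g^-1 * h)%g; first by apply: KM => //; exact: KV.
  by rewrite mulVKg mulVg; case: (sHN N).
- by move=> h l _ Hl; exact: act_coset Hl.
- by move=> h _; rewrite subrr.
Qed.

End Average.

Section ModifiedTrace.
Variables (p : nat) (k : fieldType).
Hypothesis charkp : p \in [pchar k].
Variable G : profiniteGroupType.
Local Notation kG := (cgalg k G).
Implicit Types (x y z : kG) (N M K : openNormal G) (H : set G) (g : G).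

Let p_prime : prime p. Proof. exact: pcharf_prime charkp. Qed.

Lemma cgpr_cconj_fixed H N x g h : cg_fixed H x -> setmul H N h ->
  cgpr N (cconj (g * h)%g x) = cgpr N (cconj g x).
Proof.
move=> xH [y Hy [n Nn <-]]; rewrite -[in RHS](cg_fixed_cconj g xH Hy).
apply/ffunP => c; rewrite !cgpr_conj.
by rewrite mulgA (to_modM N _ n) (to_mod_on Nn) mulg1.
Qed.

Lemma cgpr_cconj N g x y : cgpr N x = cgpr N y ->
  cgpr N (cconj g x) = cgpr N (cconj g y).
Proof. by move=> xy; rewrite /cconj !rmorphM /= xy. Qed.

Lemma cg_complete (s : openNormal G -> kG) :
    (forall N M, on_set N `<=` on_set M -> cgpr M (s N) = cgpr M (s M)) ->
  exists x, forall N, cgpr N x = cgpr N (s N).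
Proof.
move=> sP.
have sC N M : on_set N `<=` on_set M ->
    galg_map (@mod_proj G N M) (cgpr N (s N)) = cgpr M (s M).
  by move=> NM; rewrite cgpr_compat// sP.
by exists (CGalg sC).
Qed.

Lemma coset_index_neq0 H L N : subgroup H -> subgroup L -> H `<=` L ->
  on_set N `<=` H -> (0 < coset_index L H)%N.
Proof.
move=> sH sL HL NH; have [|_ ->] := coset_index_gimg sL sH HL (N := N).
  by move=> g [_ /NH].
exact: (indexg_gt0 (gimg_group N sL) (gimg_group N sH)).
Qed.

(** The averaging lemma for conjugation on [k[[G]]], with the kernels of the projections as open
    submodules. [N] acts trivially on [k[G/N]], so the limit is given at each level below [K] by the
    average at that same level. *)
Lemma average_conj H K x : subgroup H -> cg_fixed H x ->
    (forall N, on_set N `<=` on_set K ->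
      ~~ (p %| coset_index (setmul H K) (setmul H N))%N) ->
  exists2 y, cg_fixed (setmul H K) y &
    forall N, on_set N `<=` on_set K ->
      cgpr N y = (coset_index (setmul H K) (setmul H N))%:R^-1 *:
        cgpr N (csum (setmul H K) (setmul H N) (fun g => cconj g x)).
Proof.
move=> sH xH pHK.
pose S N : set kG := [set y | cgpr N y = 0].
pose F := [set S N | N in [set: openNormal G]].
have SN N : trivial_mod (fun g y => cconj g y) (S N) N.
  move=> g v Ng; rewrite /S /= linearB /=.
  apply/eqP; rewrite subr_eq0; apply/eqP/ffunP => c; rewrite cgpr_conj.
  have -> : to_mod N g = 1%g.
    by rewrite -to_mod1; apply/to_modP; rewrite mulg1; exact: onV.
  by rewrite invg1 mul1g mulg1.
have [|||||||||||y [yK yE]] := @average_exists G p k kG (fun g y => cconj g y)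
  (fun n => n%:R^-1) _ _ _ _ F _ _ _ _ _ _ _ H K x sH xH pHK.
- by move=> g u v; rewrite linearB.
- exact: cconjM.
- by move=> g n v; rewrite linearZ.
- by move=> n; rewrite (dvdn_pcharf charkp) => n0; rewrite mulVf.
- by move=> _ [N _ <-]; exact: linear0.
- by move=> _ [N _ <-] u v; rewrite /S /= linearB /= => -> ->; rewrite subrr.
- by move=> _ [N _ <-] g v v0; rewrite /S /= (@cgpr_cconj N g v 0) ?v0 ?linear0.
- by move=> _ [N _ <-] n v; rewrite /S /= linearZ /= => ->; rewrite scaler0.
- by move=> _ [N _ <-]; exists N; exact: SN.
- by move=> v vF; apply: cgalgP => N; apply: (vF (S N)); exists N.
- move=> s sP; have [N M NM|y yE] := @cg_complete (fun N => s (S N)).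
    apply/eqP; rewrite -subr_eq0 -linearB; apply/eqP.
    apply: (sP (S N) (S M)); [by exists N|by exists M|].
    by move=> v; rewrite /S /= => v0; rewrite (@cgpr_sub _ _ N M v 0) ?v0 ?linear0.
  by exists y => _ [N _ <-]; rewrite /S /= linearB /= yE subrr.
exists y => // N NK; apply/eqP; rewrite -subr_eq0 -linearZ -linearB; apply/eqP.
by apply: (yE (S N)) => //; exists N.
Qed.

Section Index.
Variable H : set G.
Hypothesis sH : subgroup H.

Local Notation idx N := (index_mod N H [set: G]).

Lemma index_mod_gt0 N : (0 < idx N)%N.
Proof.
rewrite /index_mod setmulT; apply: coset_index_neq0 (sub_setmulr (N := N) sH) => //.
exact: setmul_subgroup.
Qed.

Lemma index_mod_tower N M : on_set N `<=` on_set M ->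
  idx N = (idx M * coset_index (setmul H M) (setmul H N))%N.
Proof.
move=> NM; rewrite /index_mod !setmulT.
have sHN := setmul_subgroup N sH; have sHM := setmul_subgroup M sH.
have HNM : setmul H N `<=` setmul H M by exact: setmulS.
apply: coset_index_tower => //.
  exact: finite_left_cosets_open (sub_setmulr sH).
exact: finite_left_cosets_open (sub_setmulr sH).
Qed.

Lemma index_modS_gt0 N M : on_set N `<=` on_set M ->
  (0 < coset_index (setmul H M) (setmul H N))%N.
Proof.
by move=> NM; have := index_mod_gt0 N; rewrite (index_mod_tower NM) muln_gt0 => /andP[].
Qed.

Lemma pindex_normalsS N M : on_set N `<=` on_set M ->
  pindex_normals p H [set: G] M -> pindex_normals p H [set: G] N.
Proof.
move=> NM [_ Mmax]; have idxE : ((idx N)`_p = (idx M)`_p)%N.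
  apply/eqP; rewrite eqn_dvd Mmax/= partn_dvd ?index_mod_gt0//.
  exact: index_mod_dvd.
by split; [exists N|move=> L; rewrite idxE].
Qed.

(** The p-part of [|G : HM|] is already maximal, so a further layer contributes only to the part
    prime to [p]. *)
Lemma pindex_normals_index N M : on_set N `<=` on_set M ->
    pindex_normals p H [set: G] M ->
  ~~ (p %| coset_index (setmul H M) (setmul H N))%N /\
  ((idx N)`_p^' = (idx M)`_p^' * coset_index (setmul H M) (setmul H N))%N.
Proof.
move=> NM MP; have [_ Nmax] := pindex_normalsS NM MP.
have iE := index_mod_tower NM; have i0 := index_modS_gt0 NM.
set c := coset_index _ _ in iE i0 *.
have p'c : (p^'.-nat c)%N.
  have := Nmax M; have [_ Mmax] := MP; have := Mmax N.
  rewrite iE partnM ?index_mod_gt0// => cM _.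
  have : ((idx M)`_p * c`_p %| (idx M)`_p * 1)%N by rewrite muln1.
  rewrite dvdn_pmul2l ?part_gt0// dvdn1 => /eqP c1.
  by rewrite -(partnC p i0) c1 mul1n part_pnat.
split; first by rewrite -p'natE.
by rewrite iE partnM ?index_mod_gt0// (part_pnat_id p'c).
Qed.

Lemma mod_image_gimg (L : set G) N q : subgroup L ->
  mod_image N L q <-> q \in gimg N L.
Proof.
move=> sL; split=> [[g /(setmulP _ _ sL) gL <-]//|/gimgP[g Lg <-]].
by exists g => //; exact: sub_setmull.
Qed.

Lemma mod_image_subgroup (L : set G) N : subgroup L -> subgroup (mod_image N L).
Proof.
move=> sL; split.
- exact: (@mod_image_gimg L N 1%g sL).2 (group1 (gimg_group N sL)).
- move=> a b /(mod_image_gimg _ sL) La /(mod_image_gimg _ sL) Lb.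
  by apply: (@mod_image_gimg L N (a * b)%g sL).2; exact: (@groupM _ (gimg_group N sL)).
- move=> a /(mod_image_gimg _ sL) La.
  by apply: (@mod_image_gimg L N a^-1%g sL).2; exact: (@groupVr _ (gimg_group N sL)).
Qed.

(** Lifts the trace of the finite quotient to a sum over cosets in [G], where sums at different
    levels can be compared. *)
Lemma rel_trace_mod N x : cg_fixed H x ->
  rel_trace (gdelta k) (mod_image N H) (mod_image N [set: G]) (cg_proj x N) =
  csum [set: G] (setmul H N) (fun g => cgpr N (cconj g x)).
Proof.
move=> xH; have sHN := setmul_subgroup N sH; symmetry.
rewrite /rel_trace -/(csum (mod_image N [set: G]) (mod_image N H) (fun q =>
  gdelta k q * cgpr N x * gdelta k q^-1%g)).
have sT := @subgroupT G.
apply: (csum_reindex_eq (phi := to_mod N)) => //.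
- exact: finite_left_cosets_open (sub_setmulr sH).
- exact: mod_image_subgroup.
- exact: mod_image_subgroup.
- move=> q /(mod_image_gimg _ sH)/gimgP[g _ <-].
  by apply/(mod_image_gimg _ sT)/mem_gimg.
- by move=> g _; apply/(mod_image_gimg _ sT)/mem_gimg.
- move=> g h _ _; rewrite -to_modV -to_modM (setmulP _ _ sH).
  exact: mod_image_gimg.
- move=> q _; have [g <-] := to_mod_surj q; exists g => //.
  rewrite mulVg; by case: (mod_image_subgroup N sH).
- move=> q h _ [y Hy <-]; have [g <-] := to_mod_surj q.
  rewrite -to_modM -!to_modV -!cgpr_delta -!rmorphM.
  exact: cgpr_cconj_fixed Hy.
- by move=> g _; rewrite /cconj !rmorphM /= !cgpr_delta to_modV.
Qed.

End Index.

Lemma csum_scale (T : groupType) (V : lmodType k) (L H : set T) (c : k)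
    (F : T -> V) : finite_set (left_cosets L H) ->
  csum L H (fun t => c *: F t) = c *: csum L H F.
Proof. by move=> fLH; rewrite /csum !fsbig_finite// scaler_sumr. Qed.

Section Equivalence.
Variable H : set G.
Hypothesis sH : subgroup H.

Local Notation idx N := (index_mod N H [set: G]).

Let fHN (N M : openNormal G) : on_set N `<=` on_set M ->
  finite_set (left_cosets (setmul H M) (setmul H N)).
Proof.
move=> NM; apply: finite_left_cosets_open (sub_setmulr sH).
- exact: setmul_subgroup.
- exact: setmul_subgroup.
- exact: setmulS.
Qed.

Let fGN (N : openNormal G) : finite_set (left_cosets [set: G] (setmul H N)).
Proof.
by apply: finite_left_cosets_open (sub_setmulr sH) => //; exact: setmul_subgroup.
Qed.

Let csum_subgroup (V : zmodType) (N M : openNormal G) (F : G -> V) :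
    on_set N `<=` on_set M ->
    (forall g h, setmul H N h -> F (g * h)%g = F g) ->
  csum [set: G] (setmul H N) F = csum [set: G] (setmul H M)
    (fun g => csum (setmul H M) (setmul H N) (fun h => F (g * h)%g)).
Proof.
move=> NM FN; apply: csum_tower_eq => //.
- exact: setmul_subgroup.
- exact: setmul_subgroup.
- exact: setmulS.
- exact: fHN.
- by move=> g h _; exact: FN.
Qed.

Let csum_subgroup_const (V : zmodType) (N M : openNormal G) (F : G -> V) :
    on_set N `<=` on_set M ->
    (forall g h, setmul H M h -> F (g * h)%g = F g) ->
  csum [set: G] (setmul H N) F = csum [set: G] (setmul H M) F *+
    coset_index (setmul H M) (setmul H N).
Proof.
move=> NM FM; have HNM : setmul H N `<=` setmul H M by exact: setmulS.
rewrite (csum_subgroup NM); last by move=> g h /HNM; exact: FM.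
have sHM := setmul_subgroup M sH; have sHN := setmul_subgroup N sH.
rewrite (csum_ext (F' := fun g => F g *+ coset_index (setmul H M) (setmul H N)))//.
  by rewrite /csum !fsbig_finite ?sumrMnl//; exact: fGN.
move=> g _; rewrite -(csum_const (F g) (fHN NM)); apply: csum_ext => //.
  exact: fHN.
by move=> h; exact: FM.
Qed.

(** At a level [M] carrying the full p-part, [x] is the trace of some [a], and a multiple of [a] is
    the required preimage. For another level [N], the sums over [G/HN] and [G/HM] are both lifted to
    [G/HK] with [K] the intersection; the multiplicities [|HN : HK|] and [|HM : HK|] match the
    prime-to-p parts of the indices, and the former is invertible in [k]. *)
Lemma otrace_modified_trace x : x <> 0 -> otrace_image H x ->
  finite_pindex p H [set: G] /\ modified_trace_image p H [set: G] x.
Proof.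
move=> x0 oHx; have fH := otrace_finite_pindex charkp sH oHx x0; split=> //.
have [n [[M nM] nmax]] := fH.
have MP : pindex_normals p H [set: G] M by split; [exists M|rewrite -nM].
have [a aM aE] := oHx M Logic.I.
(* This factor cancels the normalising denominator of the modified trace at level [M]. *)
pose m := (((idx M)`_p^')%N)%:R : k.
have aM' : cg_fixed (setmul H M) (m *: a).
  by move=> h Hh; rewrite -[LHS]/(cconj h _) linearZ /= [cconj h a]aM.
have aH : cg_fixed H (m *: a) by apply: cg_fixedS aM'; exact: sub_setmull.
have xP N : pindex_normals p H [set: G] N -> cgpr N x =
    (((idx N)`_p^')%N%:R : k)^-1 *: rel_trace (gdelta k) (mod_image N H)
      (mod_image N [set: G]) (cg_proj (m *: a) N).
  move=> NP; rewrite rel_trace_mod//; pose K := onI N M.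
  have KN : on_set K `<=` on_set N by move=> g [].
  have KM : on_set K `<=` on_set M by move=> g [].
  have [bp bE] := pindex_normals_index sH KN NP.
  have [_ cE] := pindex_normals_index sH KM MP.
  set C := csum _ _ _.
  have e1 := csum_subgroup_const KN (fun g h => cgpr_cconj_fixed g aH).
  have e2 := csum_subgroup_const KM (F := fun g => cgpr N (cconj g (m *: a)))
    (fun g h Hh => congr1 (cgpr N) (cg_fixed_cconj g aM' Hh)).
  have e3 : csum [set: G] (setmul H M) (fun g => cgpr N (cconj g (m *: a))) =
      m *: cgpr N x.
    rewrite -cgpr_csum// -linearZ -aE cg_traceE -csum_scale//.
    by congr (cgpr N); apply: eq_fsbigr => C' _; rewrite linearZ.
  move: e2; rewrite e1 e3 -/C /m => e2.
  have b0 := natr_pchar_neq0 charkp bp.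
  have n0 : ((idx N)`_p^')%N%:R != 0 :> k.
    by apply: (natr_pchar_neq0 charkp); rewrite -p'natE// part_pnat.
  apply: (scalerI n0); rewrite scalerA mulfV// scale1r.
  apply: (scalerI b0); rewrite !scaler_nat e2 scaler_nat -!mulrnA.
  by rewrite mulnC -cE bE mulnC.
exists (m *: a) => //; apply: xget_unique => /= [N|y yP]; first exact: xP.
apply: (@cgprP_cofinal _ _ M) => N NM; have NP := pindex_normalsS sH NM MP.
by rewrite xP// -yP.
Qed.

(** The preimage [y] is fixed only by [H]. Its average [v] over [HK/H] is fixed by [HK], and the
    ordinary trace from [HK] of [v], divided by the prime-to-p part of [|G : HK|], has the same
    projections as the modified trace of [y]. *)
Lemma modified_trace_otrace x : x <> 0 -> finite_pindex p H [set: G] ->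
  modified_trace_image p H [set: G] x -> otrace_image H x.
Proof.
move=> x0 [n [[M0 nM0] nmax]] [y yH yx] M _.
have M0P : pindex_normals p H [set: G] M0 by split; [exists M0|rewrite -nM0].
have xP : forall N, pindex_normals p H [set: G] N -> cgpr N x =
    (((idx N)`_p^')%N%:R : k)^-1 *: rel_trace (gdelta k) (mod_image N H)
      (mod_image N [set: G]) (cg_proj y N).
  (* [x <> 0] excludes the default value [0] of [xget], so [x] satisfies the defining equations. *)
  by move: yx x0; rewrite /modified_trace; case: xgetP => [u _ uP <- _|_ ->].
pose K := onI M M0.
have KM : on_set K `<=` on_set M by move=> g [].
have KP : pindex_normals p H [set: G] K by apply: pindex_normalsS M0P => // g [].
have pHK N (NK : on_set N `<=` on_set K) := (pindex_normals_index sH NK KP).1.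
have [v vK vE] := average_conj sH yH pHK.
apply: (@trace_image_setmulS _ _ H H K) => //.
pose m := ((idx K)`_p^')%N%:R : k.
exists (m^-1 *: v).
  by move=> h Hh; rewrite -[LHS]/(cconj h _) linearZ /= [cconj h v]vK.
apply: (@cgprP_cofinal _ _ K) => N NK; have NP := pindex_normalsS sH NK KP.
have [_ bE] := pindex_normals_index sH NK KP.
rewrite xP// rel_trace_mod// cg_traceE cgpr_csum//.
rewrite (csum_subgroup NK) => [|g h Nh]; last exact: cgpr_cconj_fixed Nh.
rewrite -csum_scale//; apply: csum_ext => //; first exact: setmul_subgroup.
move=> g _; rewrite !linearZ /= bE natrM invfM -scalerA; congr (_ *: _).
set b := coset_index _ _ in vE *.
have -> : cgpr N (cconj g v) = cgpr N (cconj g (b%:R^-1 *: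
    csum (setmul H K) (setmul H N) (fun h => cconj h y))).
  by apply: cgpr_cconj; rewrite linearZ /= vE.
rewrite !linearZ /=; congr (_ *: _).
rewrite cconj_csum; last exact: (fHN NK).
rewrite cgpr_csum; last exact: (fHN NK).
by apply: eq_fsbigr => C _; rewrite cconjM.
Qed.

End Equivalence.
End ModifiedTrace.

(** * Relative projectivity of blocks *)

Lemma subrACA (V : zmodType) (x y z t : V) : (x - y) - (z - t) = (x - z) - (y - t).
Proof. by rewrite !opprD !opprK addrACA. Qed.

Section Density.
Variables (k : fieldType) (G : profiniteGroupType).
Local Notation kG := (cgalg k G).

(** [x] differs from its finite approximation [dexp N x] by an element of the kernel at [N].
    Identities between maps that factor through a level modulo [S] are thus reduced to group
    elements. *)
Lemma cg_density (V : zmodType) (S : set V) (N : openNormal G) (Phi : kG -> V) :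
    S 0 -> (forall u v, S u -> S v -> S (u - v)) ->
    {morph Phi : x y / x - y} ->
    (forall c x, S (Phi x) -> S (Phi (c *: x))) ->
    (forall x, cgpr N x = 0 -> S (Phi x)) ->
    (forall g, S (Phi (cdelta k g))) ->
  forall x, S (Phi x).
Proof.
move=> S0 SB PhiB PhiZ PhiN Phid x.
have SD := addset_add S0 SB.
have Phi0 : Phi 0 = 0 by have := PhiB 0 0; rewrite !subrr.
have PhiD y z : Phi (y + z) = Phi y + Phi z.
  have PhiNg w : Phi (- w) = - Phi w by rewrite -[- w]sub0r PhiB Phi0 sub0r.
  by rewrite -{1}[z]opprK PhiB PhiNg opprK.
rewrite -[x](subrK (dexp N x)) PhiD; apply: (SD).
  by apply: PhiN; rewrite linearB /= cgpr_dexp subrr.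
rewrite /dexp; apply: (big_ind (fun y => S (Phi y))) => [|y z Sy Sz|q _].
- by rewrite Phi0.
- by rewrite PhiD; exact: SD.
- exact/PhiZ/Phid.
Qed.

Lemma galg_map_comp (gT hT lT : finGroupType) (f : hT -> lT) (h : gT -> hT)
    (x : galg k gT) : galg_map f (galg_map h x) = galg_map (f \o h) x.
Proof.
rewrite [x]gdelta_sum !linear_sum; apply: eq_bigr => q _.
by rewrite !linearZ /= !galg_map_delta.
Qed.

Lemma eq_galg_map (gT hT : finGroupType) (f h : gT -> hT) (x : galg k gT) :
  f =1 h -> galg_map f x = galg_map h x.
Proof.
move=> fh; rewrite [x]gdelta_sum !linear_sum; apply: eq_bigr => q _.
by rewrite !linearZ /= !galg_map_delta fh.
Qed.

End Density.

Section LeftFactor.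
Variables (k : fieldType) (G : profiniteGroupType).
Local Notation kG := (cgalg k G).
Local Notation kGG := (cgalg k (G * G)%type).
Implicit Types (x y : kG) (a b : kGG) (K L : openNormal (G * G)%type).

(** The kernel of the map from [G] to [(G x G)/K] that sends [g] to the class of [(g, 1)]. *)
Definition fst_section K : set G := [set g | on_set K (g, 1%g)].

Lemma mulg_pair (g1 g2 h1 h2 : G) :
  ((g1, g2) * (h1, h2))%g = (g1 * h1, g2 * h2)%g.
Proof. by []. Qed.

Program Definition on_fst K : openNormal G := @OpenNormal G (fst_section K) _ _ _.
Next Obligation.
move=> K; split; first exact: (on1 K).
  by move=> x y Kx Ky; have := onM Kx Ky; rewrite mulg_pair mulg1.
by move=> x Kx; have := onV Kx; rewrite (_ : (x, 1%g)^-1%g = (x^-1, 1^-1)%g)// invg1.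
Qed.
Next Obligation.
move=> K g n _ Kn; have := onJ (g, 1%g) Kn.
by rewrite (_ : (g, 1%g)^-1%g = (g^-1, 1^-1)%g)// !mulg_pair invg1 !mulg1.
Qed.
Next Obligation.
move=> K; apply: open_comp (on_open K) => x _.
by apply: cvg_pair; [exact: cvg_id|exact: cvg_cst].
Qed.

Definition mod_left K (q : G_mod (on_fst K)) : G_mod K :=
  to_mod K (generic_quotient.repr q, 1%g).

Lemma mod_leftE K g : mod_left (to_mod (on_fst K) g) = to_mod K (g, 1%g).
Proof.
apply/to_modP; have /to_modP := reprK_mod (to_mod (on_fst K) g).
set r := generic_quotient.repr _ => Kr.
rewrite (_ : (r, 1%g)^-1%g = (r^-1, 1^-1)%g)// mulg_pair invg1 mulg1.
exact: Kr.
Qed.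

(** The embedding [x |-> x (x) 1] of [k[[G]]] into [k[[G x G]]]. *)
Program Definition lft x : kGG :=
  @CGalg k _ (fun K => galg_map (@mod_left K) (cgpr (on_fst K) x)) _.
Next Obligation.
move=> x K L KL.
have KL' : on_set (on_fst K) `<=` on_set (on_fst L) by move=> g; exact: KL.
rewrite -(cgpr_compat x KL') !galg_map_comp; apply: eq_galg_map => q /=.
by have [g <-] := to_mod_surj q; rewrite mod_leftE !mod_projE// mod_leftE.
Qed.

Lemma cgpr_lft K x : cgpr K (lft x) = galg_map (@mod_left K) (cgpr (on_fst K) x).
Proof. by []. Qed.

Lemma lft_is_linear : linear lft.
Proof. by move=> c x y; apply: cgalgP => K; rewrite /= !linearP. Qed.
HB.instance Definition _ := GRing.isLinear.Build k kG kGG _ lft lft_is_linear.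

Lemma lft_delta g : lft (cdelta k g) = cdelta k (g, 1%g).
Proof.
apply: cgalgP => K; rewrite -[LHS]/(cgpr K _) cgpr_lft cgpr_delta.
by rewrite galg_map_delta mod_leftE.
Qed.

Lemma lft_kernel K x : cgpr (on_fst K) x = 0 -> cgpr K (lft x) = 0.
Proof. by move=> x0; rewrite cgpr_lft x0 linear0. Qed.

Lemma biactNr b x y : biact b (x - y) = biact b x - biact b y.
Proof.
have b0 : biact b 0 = 0 by apply: (addrI (biact b 0)); rewrite -biactDr !addr0.
apply/eqP; rewrite -subr_eq opprK -biactDr; apply/eqP.
by rewrite subrK.
Qed.

Lemma biactNl a b x : biact (a - b) x = biact a x - biact b x.
Proof.
apply/eqP; rewrite -subr_eq opprK -biactDl; apply/eqP.
by rewrite subrK.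
Qed.

Lemma biactZl c a x : biact (c *: a) x = c *: biact a x.
Proof.
apply: cgalgP => N /=; rewrite scaler_sumr; apply: eq_bigr => q _.
by rewrite ffunE -scalerA.
Qed.

Lemma biact_kernel (N : openNormal G) a x :
  cgpr (onX N) a = 0 \/ cgpr N x = 0 -> cgpr N (biact a x) = 0.
Proof.
rewrite /cgpr => -[] h; rewrite /= h big1// => q _.
  by rewrite ffunE scale0r.
by rewrite linear0 scaler0.
Qed.

(** [k[[G]] (x) 1] acts by left multiplication; this is why the block is generated by [e] over it.
    The identity is checked on group elements by density. *)
Lemma biact_lft x y : biact (lft x) y = x * y.
Proof.
apply: cgalgP => N; pose M := onI (on_fst (onX N)) N.
have MN : on_set M `<=` on_set N by move=> g [].
have MX : on_set M `<=` on_set (on_fst (onX N)) by move=> g [].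
apply/subr0_eq; rewrite -[LHS]/(cgpr N (biact (lft x) y) - cgpr N (x * y)).
rewrite -linearB.
apply: (@cg_density k G _ [set 0] M (fun x => cgpr N (biact (lft x) y - x * y))).
- by [].
- exact: set1_subr_closed.
- move=> u v; rewrite -linearB; congr (cgpr N _); rewrite linearB /= biactNl.
  by rewrite mulrBl subrACA.
- move=> c u /= uy; rewrite [lft _]linearZ /= biactZl -scalerAl -scalerBr.
  by rewrite linearZ /= uy scaler0.
- move=> u uM; rewrite /= linearB /= [cgpr N (u * y)]rmorphM /=.
  rewrite biact_kernel; last first.
    by left; apply: lft_kernel; rewrite (@cgpr_sub _ _ M _ u 0) ?linear0.
  by rewrite (@cgpr_sub _ _ M N u 0) ?linear0// mul0r subrr.
- move=> g /=; rewrite lft_delta biact_delta invg1 cdelta1 mulr1 subrr.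
  exact: linear0.
Qed.

End LeftFactor.

Section Pseudocompact.
Variables (k : fieldType) (G : profiniteGroupType).
Local Notation kG := (cgalg k G).
Variable V : preTopModType kG.

(** Continuity at [(0, b i)] gives a level for each of the finitely many [b i] spanning modulo [S];
    below all of them the action on the quotient by [S] factors through one finite level. *)
Lemma pseudocompact_annihilator (S : set V) :
    continuous (fun z : kG * V => z.1 *: z.2) ->
    submodule S -> open S -> finite_codim S ->
  exists N, forall a, cgpr N a = 0 -> forall v, S (a *: v).
Proof.
move=> cZ [S0 SD SZ] oS [n [b bS]].
have ex i : exists N, forall a, cgpr N a = 0 -> S (a *: b i).
  have nS : nbhs ((0 : kG) *: b i) S.
    by rewrite scale0r; apply: open_nbhs_nbhs.
  have [[A C] /= [[N NA] Cb] AC] := cZ (0, b i) S nS; exists N => a a0.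
  apply: (AC (a, b i)); split; last exact: nbhs_singleton.
  by apply: NA; rewrite /= -[LHS]/(cgpr N a) a0.
have [N NP] := openNormal_inf (fun i => projT1 (cid (ex i))).
exists N => a aN v; have [c Sc] := bS v.
rewrite -[v](subrK (\sum_i (c i)%:A *: b i)) scalerDr; apply: (SD); first exact: SZ.
rewrite scaler_sumr; apply: (big_ind S) => // i _.
rewrite scalerA -scalerAr mulr1 -mulr_algl -scalerA.
apply: SZ; apply: (projT2 (cid (ex i))).
by rewrite (@cgpr_sub _ _ N _ a 0) ?linear0//; exact: NP.
Qed.

End Pseudocompact.

Section Translation.
Variables (T : groupType) (M : zmodType) (L H : set T).
Hypotheses (sL : subgroup L) (sH : subgroup H) (HL : H `<=` L).
Hypothesis fLH : finite_set (left_cosets L H).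

Lemma csum_translate (F : T -> M) g : L g ->
    (forall x h, L x -> H h -> F (x * h)%g = F x) ->
  csum L H (fun x => F (g * x)%g) = csum L H F.
Proof.
move=> Lg FH; have [_ LM LV] := sL.
apply: (csum_reindex_eq (phi := mulg g)) => //.
- by move=> x; exact: LM.
- by move=> x y _ _; rewrite invMg -mulgA mulKg.
- move=> x Lx; exists (g^-1 * x)%g; first by apply: LM => //; exact: LV.
  by rewrite mulVKg mulVg; case: sH.
Qed.

End Translation.

Section Projectivity.
Variables (p : nat) (k : fieldType).
Hypothesis charkp : p \in [pchar k].
Variables (G : profiniteGroupType) (B : block k G).
Local Notation kG := (cgalg k G).
Local Notation kGG := (cgalg k (G * G)%type).
Local Notation e := (block_idem B).
Implicit Types (x y : kG) (a b : kGG) (N : openNormal G) (g h : G).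

Lemma block_primitive : primitive_central_idempotent e.
Proof. by case: (block_idemP B) => E [EP _ _] /EP. Qed.

Lemma block_centre : centre e.
Proof. exact: block_idem_central. Qed.

Definition block_one : block_mod B := bmk (block_idemK B).

Lemma block_valZ a (u : block_mod B) : set_val (a *: u) = biact a (set_val u) :> kG.
Proof. by []. Qed.

Lemma block_one_fixed g : cdelta k ((g, g) : G * G) *: block_one = block_one.
Proof.
apply: block_modP; rewrite block_valZ /= biact_delta.
exact: (cconj_central g block_centre).
Qed.

Lemma block_one_generates (u : block_mod B) : lft (set_val u) *: block_one = u.
Proof.
by apply: block_modP; rewrite block_valZ biact_lft; exact: block_modE.
Qed.

Lemma lft_cconj g x : cdelta k ((g, g) : G * G) * lft x =
  lft (cconj g x) * cdelta k ((g, g) : G * G).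
Proof.
apply: cgalgP => K; apply/subr0_eq.
pose Phi x := cdelta k ((g, g) : G * G) * lft x -
  lft (cconj g x) * cdelta k ((g, g) : G * G).
rewrite -[LHS]/(cgpr K (Phi x)).
apply: (@cg_density k G _ [set 0] (on_fst K) (fun x => cgpr K (Phi x))).
- by [].
- exact: set1_subr_closed.
- move=> u v; rewrite -linearB; congr (cgpr K _).
  by rewrite /Phi ![in LHS]linearB /= mulrBr mulrBl subrACA.
- move=> c u /= uy; rewrite /Phi !linearZ /= -scalerAr -scalerAl -scalerBr.
  by rewrite linearZ /= -/(Phi u) uy scaler0.
- move=> u uK; rewrite /Phi /= linearB /= !rmorphM /=.
  rewrite (lft_kernel uK) (lft_kernel (K := K) (x := cconj g u)).
    by rewrite mulr0 mul0r subrr.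
  by rewrite (@cgpr_cconj _ _ _ g u 0) ?linear0.
- move=> h /=; rewrite /Phi lft_delta /cconj -!cdeltaM lft_delta -cdeltaM.
  by rewrite !mulg_pair mulgVK mulg1 mul1g subrr linear0.
Qed.

Lemma lft_continuous : continuous (@lft k G).
Proof.
move=> x A [K KA]; exists (on_fst K) => y yx; apply: KA.
rewrite /= -[LHS]/(cgpr K (lft y)) -[RHS]/(cgpr K (lft x)) !cgpr_lft.
by congr galg_map.
Qed.

Lemma set_val_continuous : continuous (fun u : block_mod B => set_val u : kG).
Proof. exact: initial_continuous. Qed.

Section Module.
Variable V : preTopModType kGG.
Hypothesis cZ : continuous (fun z : kGG * V => z.1 *: z.2).
Variable F : set (set V).
Hypothesis FP : forall S, F S -> [/\ submodule S, open S & finite_codim S].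
Hypothesis Fsep : forall u, (forall S, F S -> S u) -> u = 0.

Definition dact g (v : V) : V := cdelta k ((g, g) : G * G) *: v.

Lemma submodule0 S : F S -> S 0. Proof. by move=> /FP[[]]. Qed.
Lemma submoduleB S : F S -> forall u v, S u -> S v -> S (u - v).
Proof.
move=> /FP[[_ SD SZ] _ _] u v Su Sv; apply: SD => //.
by rewrite -scaleN1r; exact: SZ.
Qed.
Lemma submoduleZ S : F S -> forall a v, S v -> S (a *: v).
Proof. by move=> /FP[[]]. Qed.

Lemma continuous_scaler (v : V) : continuous (fun a : kGG => a *: v).
Proof.
move=> a A nA; have [[X Y] /= [Xa Yv] XY] := @cZ (a, v) A nA.
apply: (filterS _ Xa) => b Xb; apply: (XY (b, v)); split=> //=.
exact: nbhs_singleton.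
Qed.

(** The linearity needed for sending [x] to [lft x *: v] to define a homomorphism out of the block.
    Modulo each [S] it reduces by density to group elements, where [(g y, h)] is [(g y h^-1, 1)]
    times [(h, h)] and [(h, h)] fixes [v]. *)
Lemma lft_biact (v : V) : (forall g, dact g v = v) ->
  forall b x, lft (biact b x) *: v = b *: (lft x *: v).
Proof.
move=> gv b x; apply/subr0_eq/Fsep => S FS.
have [subS oS fS] := FP FS.
have [K KS] := pseudocompact_annihilator cZ subS oS fS.
have S0 := submodule0 FS; have SB := submoduleB FS; have SZ := submoduleZ FS.
rewrite scalerA -scalerBl.
pose Phi b x := (lft (biact b x) - b * lft x) *: v.
rewrite -/(Phi b x).
have PhiB : {morph Phi^~ x : b b' / b - b'}.
  move=> b1 b2; rewrite /Phi -scalerBl; congr (_ *: _).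
  by rewrite biactNl [in LHS]linearB /= mulrBl subrACA.
apply: (@cg_density k _ _ S (onI (onX (on_fst K)) K) (Phi^~ x)) => //.
- move=> c b' Sb; rewrite /Phi biactZl linearZ /= -scalerAl -scalerBr.
  by rewrite -mulr_algl -scalerA; exact: SZ.
- move=> b' b0; apply: KS; rewrite linearB /= rmorphM /=.
  rewrite (@cgpr_sub _ _ _ K b' 0 _ b0) ?linear0//; last by move=> z [].
  rewrite mul0r subr0; apply: lft_kernel; apply: biact_kernel; left.
  by rewrite (@cgpr_sub _ _ _ _ b' 0 _ b0) ?linear0// => z [].
move=> [g h].
apply: (@cg_density k _ _ S (on_fst K) (Phi (cdelta k (g, h)))) => //.
- move=> x1 x2; rewrite /Phi -scalerBl; congr (_ *: _).
  by rewrite biactNr ![in LHS]linearB /= mulrBr subrACA.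
- move=> c x' Sx; move: (SZ c%:A _ Sx); rewrite /Phi !biact_delta scalerA.
  by rewrite mulr_algl scalerBr scalerAr -!linearZ /= scalerAl -scalerAr.
- move=> x' x0; apply: KS; rewrite linearB /= rmorphM /= (lft_kernel x0).
  rewrite mulr0 subr0; apply: lft_kernel; apply: biact_kernel; by right.
move=> y; rewrite /Phi biact_delta -!cdeltaM !lft_delta scalerBl.
rewrite -[in X in X - _](gv h) /dact scalerA -!cdeltaM !mulg_pair.
by rewrite mulgVK mulg1 mul1g subrr.
Qed.

Lemma submodule_trivial_mod S : F S -> exists N, trivial_mod dact S N.
Proof.
move=> FS; have [subS oS fS] := FP FS.
have [K KS] := pseudocompact_annihilator cZ subS oS fS.
have cd : continuous (fun g : G => (g, g)).
  by move=> g; apply: cvg_pair; exact: cvg_id.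
have [|N NK] := @open_normal_base G [set g | on_set K (g, g)].
  apply: (cd 1%g); apply: open_nbhs_nbhs; split; first exact: on_open.
  exact: on1.
exists N => g v /NK Kg; rewrite -[v in _ - v]scale1r -scalerBl; apply: KS.
rewrite linearB /= cgpr_delta rmorph1 -gdelta1 -to_mod1.
have -> : to_mod K (g, g) = to_mod K 1%g.
  by apply/to_modP; rewrite mulg1; exact: onV.
exact: subrr.
Qed.

End Module.

(* Choose [K] with [|HK : H|] prime to [p] and [a] with [Tr_HK a = e]. The image
   [v0] of [e] under a splitting on [H], averaged over [HK / H], gives [v1] fixed
   by [HK] and lying over the image of [e], and the [G x G]-splitting sends [e]
   to the sum over [G / HK] of the [(g, g) (a (x) 1) v1]. *)
Lemma otrace_rel_projective (H : set G) : subgroup H -> otrace_image H e ->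
  rel_projective (@delta G @` H) (block_mod B).
Proof.
move=> sH He V W [_ _ cZ [F [FP Fnb Fsep Fcomplete]]].
move=> [_ _ _ [FW [FWP _ FWsep _]]] beta phi cbeta _ _.
move=> [alpha [[_ alphaZ] _ phiE]].
have e0 : e <> 0 by case: block_primitive.
have [n [[K nK] nmax]] := otrace_finite_pindex charkp sH He e0.
have KP : pindex_normals p H [set: G] K by split; [exists K|rewrite -nK].
have [a aK aE] := He K Logic.I.
pose w := phi block_one.
have actw g : dact g w = w by rewrite /w /dact -linearZ /= block_one_fixed.
have phiu u : phi u = lft (set_val u) *: w.
  by rewrite -linearZ /= block_one_generates.
pose inv m : kGG := (m%:R^-1 : k)%:A.
have invK m : ~~ (p %| m)%N -> inv m * m%:R = 1.
  rewrite (dvdn_pcharf charkp) => m0; rewrite mulr_algl -scaler_nat scalerA.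
  by rewrite mulVf// scale1r.
have inv_comm m b : inv m * b = b * inv m.
  by rewrite mulr_algl -scalerAr mulr1.
have dactM (U : preTopModType kGG) g h (u : U) : dact (g * h)%g u = dact g (dact h u).
  by rewrite /dact scalerA -cdeltaM.
have [||||||||||||v1 [v1K v1E]] := @average_exists G p kGG V (@dact V) inv
  _ _ _ invK F _ _ _ _ _ _ _ H K (alpha block_one) sH _ _.
- by move=> g u v; rewrite /dact scalerBr.
- exact: dactM.
- by move=> g m v; rewrite /dact !scalerA inv_comm.
- exact: submodule0 FP.
- exact: submoduleB FP.
- by move=> S FS g v; apply: (submoduleZ FP FS).
- by move=> S FS m v; apply: (submoduleZ FP FS).
- by move=> S FS; exact: (submodule_trivial_mod cZ FP FS).
- exact: Fsep.
- exact: Fcomplete.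
- move=> h Hh; rewrite /dact -alphaZ ?block_one_fixed// => N q.
  rewrite -[cg_proj _ _]/(cgpr N _) cgpr_delta galg_deltaE.
  have [->|_] := eqVneq q (to_mod N (h, h)); last by rewrite eqxx.
  by exists (h, h) => //; apply: sub_setmull; exists h.
- by move=> N NK; have [] := pindex_normals_index charkp sH NK KP.
have beta0 : beta 0 = 0 by exact: linear0.
(* Every average of [alpha block_one] lies over [w], because [w] is fixed by the diagonal;
   continuity of [beta] passes this to the limit. *)
have betav1 : beta v1 = w.
  apply/subr0_eq/FWsep => S FS.
  have [subS oS _] := FWP _ FS; have S0 := submodule0 FWP FS.
  have nS : nbhs (beta 0) S by rewrite beta0; apply: open_nbhs_nbhs.
  have [S' FS' S'S] := Fnb _ (cbeta 0 S nS).
  have [N S'N] := submodule_trivial_mod cZ FP FS'.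
  pose N' := onI N K; have N'K : on_set N' `<=` on_set K by move=> g [].
  have S'N' : trivial_mod (@dact V) S' N' by move=> g v [/S'N].
  have := S'S _ (v1E S' N' FS' N'K S'N'); rewrite /= linearB.
  suff -> : beta (average (@dact V) inv H K (alpha block_one) N') = w by [].
  have fKN : finite_set (left_cosets (setmul H K) (setmul H N')).
    apply: finite_left_cosets_open (sub_setmulr sH).
    - exact: setmul_subgroup.
    - exact: setmul_subgroup.
    - exact: setmulS.
  rewrite /average linearZ /=.
  have -> : beta (csum (setmul H K) (setmul H N')
      (fun g => dact g (alpha block_one))) =
      csum (setmul H K) (setmul H N') (fun _ => w).
    rewrite /csum !fsbig_finite// linear_sum; apply: eq_bigr => C _.
    by rewrite /dact linearZ /= -phiE; exact: actw.
  rewrite csum_const// -scaler_nat scalerA invK ?scale1r//.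
  by have [] := pindex_normals_index charkp sH N'K KP.
pose v := csum [set: G] (setmul H K) (fun g => dact g (lft a *: v1)).
have vF g h : setmul H K h ->
    dact (g * h)%g (lft a *: v1) = dact g (lft a *: v1).
  move=> Kh; rewrite dactM; congr (dact g _).
  rewrite /dact scalerA lft_cconj -scalerA -[cdelta _ _ *: v1]/(dact h v1) v1K//.
  by rewrite [cconj h a]aK.
have sHK := setmul_subgroup K sH.
have fHK : finite_set (left_cosets [set: G] (setmul H K)).
  exact: finite_left_cosets_open (sub_setmulr sH).
have actv g : dact g v = v.
  rewrite -[RHS](csum_translate (@subgroupT G) sHK (@subsetT _ _) fHK (g := g))//.
    rewrite /v /csum !fsbig_finite// /dact scaler_sumr; apply: eq_bigr => C _.
    by rewrite -[LHS]dactM.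
  by move=> x h _; exact: vF.
(* Since [w] is fixed by the diagonal, [(g, g) (a (x) 1) w] is the conjugate of [a] by [g], tensored
   with [1], applied to [w]; the sum of these conjugates is [e]. *)
have betav : beta v = w.
  rewrite /v /csum fsbig_finite// linear_sum /=.
  under eq_bigr => C _.
    rewrite /dact linearZ /= linearZ /= betav1 scalerA lft_cconj -scalerA.
    rewrite -[cdelta _ _ *: w]/(dact _ w) actw; over.
  rewrite -scaler_suml -linear_sum /= -(fsbig_finite _ (fun C => cconj (xget 1%g C) a))//.
  rewrite -[X in lft X]/(cg_trace _ _ a) aE.
  exact/esym/(phiu block_one).
pose f (u : block_mod B) : V := lft (set_val u) *: v.
have f_linear : linear f.
  move=> b u1 u2; rewrite /f.
  have -> : set_val (b *: u1 + u2) = biact b (set_val u1) + set_val u2 :> kG by [].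
  by rewrite linearD /= scalerDl (lft_biact cZ FP Fsep actv).
pose fL : {linear block_mod B -> V} :=
  HB.pack f (GRing.isLinear.Build kGG (block_mod B) V *:%R f f_linear).
exists fL; split=> [|u]; last by rewrite phiu /= /f linearZ /= betav.
move=> u; rewrite /= /f.
have cf : continuous (fun x : kG => lft x *: v).
  move=> x; apply: (@continuous_comp _ _ _ (@lft k G) (fun b => b *: v)).
    exact: lft_continuous.
  exact: continuous_scaler.
apply: (@continuous_comp _ _ _ (fun u : block_mod B => set_val u : kG)
  (fun x : kG => lft x *: v)); last exact: cf.
exact: set_val_continuous.
Qed.

End Projectivity.

(** * Permutation modules and the converse *)

Record mod_action (G : profiniteGroupType) (N : openNormal G) := ModAction {
  ma_sort : finType;
  ma_act : G_mod N -> ma_sort -> ma_sort;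
  ma_act1 : forall y, ma_act 1%g y = y;
  ma_actM : forall q r y, ma_act (q * r)%g y = ma_act q (ma_act r y)
}.

Section BiactSums.
Variables (k : fieldType) (G : profiniteGroupType).
Local Notation kG := (cgalg k G).
Local Notation kGG := (cgalg k (G * G)%type).

Lemma biact0r (b : kGG) : biact b (0 : kG) = 0.
Proof. by rewrite -[in LHS](subrr (0 : kG)) biactNr subrr. Qed.

Lemma biact0l (x : kG) : biact (0 : kGG) x = 0.
Proof. by rewrite -[in LHS](subrr (0 : kGG)) biactNl subrr. Qed.

Lemma biact_sumr I (r : seq I) (P : pred I) (F : I -> kG) (b : kGG) :
  biact b (\sum_(i <- r | P i) F i) = \sum_(i <- r | P i) biact b (F i).
Proof. exact: (big_morph _ (@biactDr k G b) (biact0r b)). Qed.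

Lemma biact_suml I (r : seq I) (P : pred I) (F : I -> kGG) (x : kG) :
  biact (\sum_(i <- r | P i) F i) x = \sum_(i <- r | P i) biact (F i) x.
Proof.
exact: (big_morph (fun b => biact b x) (fun b c => @biactDl k G b c x) (biact0l x)).
Qed.

Lemma cgpr_biact_congr (M : openNormal G) (b b' : kGG) (x x' : kG) :
  cgpr (onX M) b = cgpr (onX M) b' -> cgpr M x = cgpr M x' ->
  cgpr M (biact b x) = cgpr M (biact b' x').
Proof. by rewrite /cgpr /= => -> ->. Qed.

Lemma cgpr_res_congr (K L : openNormal (G * G)%type) q (b b' : kGG) :
  on_set L `<=` on_set K -> cgpr L b = cgpr L b' ->
  cgpr L (cg_res (K := K) q b) = cgpr L (cg_res q b').
Proof.
by move=> LK bb; apply/ffunP => m; rewrite !cgpr_res// bb.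
Qed.

End BiactSums.

Lemma finite_codim_fintype (k : fieldType) (G : profiniteGroupType)
    (U : preTopModType (cgalg k G)) (S : set U) (I : finType) (b : I -> U) :
  (forall u, exists c : I -> k, S (u - \sum_i (c i)%:A *: b i)) ->
  finite_codim S.
Proof.
move=> bS; exists #|I|, (fun i => b (enum_val i)) => u; have [c Sc] := bS u.
exists (fun i => c (enum_val i)).
by rewrite -(big_enum_val (A := I) (fun i => (c i)%:A *: b i)).
Qed.

Section PermutationModule.
Variables (k : fieldType) (G : profiniteGroupType) (N : openNormal G).
Variable X : mod_action N.
Local Notation kG := (cgalg k G).
Local Notation kGG := (cgalg k (G * G)%type).

(** [k[[G]] (x) k[X]], on which [(g, h)] acts by
    [x (x) y |-> g x h^-1 (x) h y]. *)
Definition perm_mod := {ffun ma_sort X -> kG}.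
HB.instance Definition _ := GRing.Zmodule.on perm_mod.

Implicit Types (f : perm_mod) (b : kGG).

(** The second factor permutes the finite set through [G/N], so it acts by one permutation on the
    whole part of [b] supported on a coset [q]; the action is assembled from these parts. *)
Definition perm_scale b f : perm_mod :=
  [ffun y => \sum_(q : G_mod (onX N))
     biact (cg_res q b) (f (ma_act (mod_snd q)^-1%g y))].

Let scaleA b b' f : perm_scale b (perm_scale b' f) = perm_scale (b * b') f.
Proof.
apply/ffunP => y; rewrite !ffunE.
under eq_bigr => r _ do rewrite ffunE biact_sumr.
under [RHS]eq_bigr => q _ do rewrite cg_resM biact_suml.
rewrite [RHS]exchange_big /=; apply: eq_bigr => r _.
rewrite [RHS](reindex_inj (mulgI r)) /=; apply: eq_bigr => s _.
by rewrite biactA mulKg mod_sndM invMg ma_actM.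
Qed.

Let scale1r : left_id 1 perm_scale.
Proof.
move=> f; apply/ffunP => y; rewrite ffunE (bigD1 1%g)//= -cdelta1 cg_res_delta.
rewrite eqxx big1 ?addr0 => [|q q1]; last first.
  by rewrite cg_res_delta to_mod1 eq_sym (negPf q1) biact0l.
rewrite cdelta1 biact1 (_ : mod_snd _ = 1%g) ?invg1 ?ma_act1//.
by rewrite -to_mod1 mod_sndE.
Qed.

Let scaleDr : right_distributive perm_scale +%R.
Proof.
move=> b f f'; apply/ffunP => y; rewrite !ffunE -big_split /=.
by apply: eq_bigr => q _; rewrite ffunE biactDr.
Qed.

Let scaleDl f : {morph perm_scale^~ f : b b' / b + b'}.
Proof.
move=> b b'; apply/ffunP => y; rewrite !ffunE -big_split /=.
by apply: eq_bigr => q _; rewrite linearD biactDl.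
Qed.

HB.instance Definition _ := GRing.Zmodule_isLmodule.Build kGG perm_mod
  scaleA scale1r scaleDr scaleDl.

Lemma perm_scaleE b f y : (b *: f) y =
  \sum_(q : G_mod (onX N)) biact (cg_res q b) (f (ma_act (mod_snd q)^-1%g y)).
Proof. by rewrite ffunE. Qed.

Lemma perm_scale_delta g h f y : (cdelta k ((g, h) : G * G) *: f) y =
  cdelta k g * f (ma_act (to_mod N h)^-1%g y) * cdelta k h^-1%g.
Proof.
rewrite perm_scaleE (bigD1 (to_mod (onX N) (g, h)))//= cg_res_delta eqxx.
rewrite big1 ?addr0 => [|q qgh]; last first.
  by rewrite cg_res_delta eq_sym (negPf qgh) biact0l.
by rewrite biact_delta mod_sndE.
Qed.

Lemma perm_scale_const (c : k) f y : (c%:A *: f) y = c *: f y.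
Proof.
rewrite perm_scaleE.
under eq_bigr => q _ do rewrite linearZ /= biactZl.
rewrite -scaler_sumr; congr (_ *: _); rewrite -perm_scaleE.
by rewrite GRing.scale1r.
Qed.

Definition perm_ball (M : openNormal G) f : set perm_mod :=
  [set f' | forall y, cgpr M (f' y) = cgpr M (f y)].

Definition perm_nbhs f : set_system perm_mod :=
  [set A | exists M, perm_ball M f `<=` A].

HB.instance Definition _ := hasNbhs.Build perm_mod perm_nbhs.

Let perm_nbhs_filter f : ProperFilter (perm_nbhs f).
Proof.
split; first by move=> [M /(_ f (fun _ => erefl))].
split; first by exists (onT G).
  move=> A A' [M MA] [M' MA']; exists (onI M M') => f' ff; split.
    by apply: MA => y; apply: cgpr_sub (ff y) => g [].
  by apply: MA' => y; apply: cgpr_sub (ff y) => g [].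
by move=> A A' AA' [M MA]; exists M; exact: subset_trans AA'.
Qed.

Let perm_nbhs_singleton f A : perm_nbhs f A -> A f.
Proof. by move=> [M]; exact. Qed.

Let perm_nbhs_nbhs f A : perm_nbhs f A -> perm_nbhs f (perm_nbhs^~ A).
Proof.
move=> [M MA]; exists M => f1 ff1; exists M => f2 ff2.
by apply: MA => y; rewrite ff2.
Qed.

HB.instance Definition _ := Nbhs_isNbhsTopological.Build perm_mod
  perm_nbhs_filter perm_nbhs_singleton perm_nbhs_nbhs.

Definition perm_kernel (M : openNormal G) : set perm_mod :=
  [set f | forall y, cgpr M (f y) = 0].

(** The topology is that of a finite power of [k[[G]]]: the kernels [perm_kernel M] are open
    submodules, and modulo them group elements representing [G/M], placed at single points of the
    set, span. *)
Lemma perm_mod_pseudocompact : pseudocompact perm_mod.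
Proof.
split.
- move=> [f f'] A [M MA]; exists (perm_ball M f, perm_ball M f').
    by split; exists M.
  move=> [f1 f1'] [/= ff1 ff1']; apply: MA => y.
  by rewrite !ffunE !linearD /= ff1 ff1'.
- move=> f A [M MA]; exists M => f1 ff1; apply: MA => y.
  by rewrite !ffunE !linearN /= ff1.
- move=> [b f] A [M MA]; pose K := onI (onX M) (onX N).
  exists ([set b' | cgpr K b' = cgpr K b], perm_ball M f).
    by split; [exists K|exists M].
  move=> [b' f'] [/= bb ff]; apply: MA => y; rewrite !perm_scaleE !linear_sum.
  apply: eq_bigr => q _ /=; apply: cgpr_biact_congr => //.
  apply: (@cgpr_sub _ _ K); first by move=> g [].
  by apply: cgpr_res_congr => // g [].
exists [set perm_kernel M | M in [set: openNormal G]]; split.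
- move=> _ [M _ <-]; split.
  + split; first by move=> y; rewrite ffunE linear0.
      by move=> u v u0 v0 y; rewrite ffunE linearD /= u0 v0 addr0.
    move=> b u u0 y; rewrite perm_scaleE linear_sum big1// => q _.
    by apply: biact_kernel; right.
  + rewrite openE => f f0; exists M => f' ff y; rewrite ff; exact: f0.
  + pose c (z : ma_sort X * G_mod M) : perm_mod := [ffun y =>
      if y == z.1 then cdelta k (generic_quotient.repr z.2) else 0].
    apply: (@finite_codim_fintype _ _ _ _ _ c) => u.
    exists (fun z => cgpr M (u z.1) z.2 : k) => y.
    suff cE : (\sum_z (cgpr M (u z.1) z.2 : k)%:A *: c z) y = dexp M (u y).
      by rewrite !ffunE cE linearB /= cgpr_dexp subrr.
    rewrite sum_ffunE -(pair_bigA _ (fun y' m =>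
      ((cgpr M (u y') m : k)%:A *: c (y', m)) y)) /=.
    rewrite (bigD1 y)//= [X in _ + X]big1 ?addr0 => [|y' yy']; last first.
      rewrite big1// => m _; rewrite perm_scale_const ffunE /=.
      by rewrite eq_sym (negPf yy') scaler0.
    by apply: eq_bigr => m _; rewrite perm_scale_const ffunE /= eqxx.
- move=> A [M MA]; exists (perm_kernel M); first by exists M.
  move=> f f0; apply: MA => y; rewrite ffunE linear0; exact: f0.
- move=> u u0; apply/ffunP => y; rewrite ffunE; apply: cgalgP => M.
  by apply: (u0 (perm_kernel M)); exists M.
move=> s sP.
have ex y : exists x, forall M, cgpr M x = cgpr M (s (perm_kernel M) y).
  apply: cg_complete => M M' MM'; apply/subr0_eq; rewrite -linearB.
  have MM : perm_kernel M `<=` perm_kernel M'.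
    by move=> f f0 y'; rewrite (@cgpr_sub _ _ M M' (f y') 0) ?linear0.
  have := sP (perm_kernel M) (perm_kernel M') (ex_intro2 _ _ M Logic.I erefl)
    (ex_intro2 _ _ M' Logic.I erefl) MM y.
  by rewrite !ffunE.
exists ([ffun y => projT1 (cid (ex y))] : perm_mod) => _ [M _ <-] y.
by rewrite !ffunE linearB /= (projT2 (cid (ex y))) subrr.
Qed.

End PermutationModule.

Section PermutationModules.
Variables (G : profiniteGroupType) (N : openNormal G).

(** All subsets of [G/N]: this one action contains every [G/L] with [L] above [N] as an orbit,
    without a new finite type for each [L]. *)
Definition subset_action : mod_action N :=
  @ModAction G N {set G_mod N} (fun q Y => (q *: Y)%g) (@lcoset1 _)
    (fun q r Y => lcosetM Y q r).

Definition point_action : mod_action N :=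
  @ModAction G N unit (fun _ y => y) (fun _ => erefl) (fun _ _ _ => erefl).

End PermutationModules.

Section Converse.
Variables (k : fieldType) (G : profiniteGroupType) (B : block k G).
Local Notation kG := (cgalg k G).
Local Notation kGG := (cgalg k (G * G)%type).
Local Notation e := (block_idem B).

Lemma cg_sub_res (Gamma : profiniteGroupType) (H : set Gamma)
    (K : openNormal Gamma) (q : G_mod K) (a : cgalg k Gamma) :
  cg_sub H a -> ~ mod_image K H q -> cg_res q a = 0.
Proof.
move=> aH nq; apply: (@cgprP_cofinal _ _ K) => M MK; apply/ffunP => m.
rewrite cgpr_res// linear0 [RHS]ffunE; case: eqP => // mq.
apply/eqP/contraT => am; case: nq; have [h [x Hx [n Mn <-]] hm] := aH M m am.
exists (x * n)%g; first by exists x => //; exists n => //; exact: MK.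
by rewrite -mq -hm mod_projE.
Qed.

(* [B] embeds in the trivial module [k[[G]] = k[[G]] (x) k], over which
   [k[[G]] (x) k[G/HN]] splits on [HN]; a [G x G]-splitting sends [e] to a family
   of conjugates of some [a] with [Tr a = e]. *)
Lemma rel_projective_otrace (H : set G) : subgroup H ->
  rel_projective (@delta G @` H) (block_mod B) -> otrace_image H e.
Proof.
move=> sH BH N _.
pose V := perm_mod k (subset_action N); pose W := perm_mod k (point_action N).
pose L := setmul H N; have sL : subgroup L by exact: setmul_subgroup.
have NL : on_set N `<=` L by exact: sub_setmulr.
pose Lb : {set G_mod N} := gimg N L.
(* Only this orbit, a copy of [G/L], matters among the subsets of [G/N], so [beta] sums over it
   alone. *)
pose O : pred {set G_mod N} := orb [set: G] (@ltrans G N) Lb.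
have Oact g Y : O (ltrans g Y) = O Y.
  have O1 x Z : O Z -> O (ltrans x Z).
    by move=> /asboolP[y _ <-]; apply/asboolP; exists (x * y)%g; rewrite ?ltransM.
  by apply/idP/idP => [/(O1 g^-1%g)|/O1//]; rewrite -ltransM mulVg ltrans1.
pose phi (u : block_mod B) : W := [ffun _ => set_val u].
have phi_lin : linear phi.
  move=> b u u'; apply/ffunP => y.
  rewrite ffunE [RHS]ffunE perm_scaleE.
  rewrite -[LHS]/(biact b (set_val u) + set_val u' : kG).
  congr (_ + _); last by rewrite ffunE.
  rewrite -[in LHS](cg_res_sum (onX N) b) biact_suml.
  by apply: eq_bigr => q _; rewrite ffunE.
pose beta (f : V) : W := [ffun _ => \sum_(Y | O Y) f Y].
have beta_lin : linear beta.
  move=> b f f'; apply/ffunP => y; rewrite ffunE [RHS]ffunE perm_scaleE.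
  rewrite (eq_bigr (fun Y => (b *: f) Y + f' Y)); last by move=> Y _; rewrite ffunE.
  rewrite big_split /=; congr (_ + _); last by rewrite ffunE.
  rewrite (eq_bigr _ (fun Y _ => perm_scaleE b f Y)).
  rewrite exchange_big /=; apply: eq_bigr => q _.
  rewrite ffunE biact_sumr; have [g gq] := to_mod_surj (mod_snd q).
  rewrite (reindex (ltrans g)) /=; last first.
    by exists (ltrans g^-1%g) => Y _; rewrite -ltransM ?mulVg ?mulgV ltrans1.
  rewrite (eq_bigl O) => [|Y]; last exact: Oact.
  by apply: eq_bigr => Y _; rewrite -gq -to_modV -/(ltrans _ _) -ltransM mulVg ltrans1.
pose phiL : {linear block_mod B -> W} :=
  HB.pack phi (GRing.isLinear.Build kGG (block_mod B) W *:%R phi phi_lin).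
pose betaL : {linear V -> W} :=
  HB.pack beta (GRing.isLinear.Build kGG V W *:%R beta beta_lin).
have cbeta : continuous betaL.
  move=> f A [M MA]; exists M => f' ff; apply: MA => y.
  by rewrite !ffunE !linear_sum; apply: eq_bigr => Y _; exact: ff.
have OLb : O Lb by apply/asboolP; exists 1%g => //; exact: ltrans1.
(* Placing [x] at the coset [L] splits [beta]. It is compatible with those [(g, h)] for which [h]
   fixes this coset, in particular with [delta(H)]. *)
pose alpha (x : kG) : V := [ffun Y => if Y == Lb then x else 0].
have beta_alpha x : beta (alpha x) = [ffun _ => x].
  apply/ffunP => y; rewrite !ffunE (bigD1 Lb)//= ffunE eqxx big1 ?addr0// => Y.
  by case/andP => _ /negPf YL; rewrite ffunE YL.
have sbeta : set_surj [set: V] [set: W] betaL.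
  move=> w _; exists (alpha (w tt)) => //; rewrite /= beta_alpha.
  by apply/ffunP => -[]; rewrite ffunE.
have near_val M (u : block_mod B) :
    nbhs u [set u' : block_mod B | cgpr M (set_val u') = cgpr M (set_val u)].
  by apply: (@set_val_continuous k G B u [set x | cgpr M x = _]); exists M.
have cphi : continuous phiL.
  move=> u A [M MA].
  by apply: filterS (near_val M u) => u' uu'; apply: MA => y; rewrite !ffunE.
have := BH V W (@perm_mod_pseudocompact k G N _) (@perm_mod_pseudocompact k G N _)
  betaL phiL cbeta sbeta cphi.
case=> [|alpha' [_ alpha'E]].
  exists (fun u => alpha (set_val u)); split; last first.
  - by move=> u; rewrite /= beta_alpha.
  - move=> u A [M MA].
    apply: filterS (near_val M u) => u' uu'; apply: MA => Y; rewrite !ffunE.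
    by case: eqP.
  split=> [u v|b u bH].
    by apply/ffunP => Y; rewrite !ffunE; case: eqP => // _; rewrite addr0.
  apply/ffunP => Y; rewrite perm_scaleE ffunE block_valZ.
  have qLb (q : G_mod (onX N)) :
      mod_image (onX N) (@delta G @` H) q -> (mod_snd q)^-1%g \in gimg N L.
    move=> [gh [_ [h Hh <-] [n Nn <-]] <-]; rewrite mod_sndE /= -to_modV.
    apply: mem_gimg; case: (sL) => _ _ LV; apply: LV.
    by exists h => //; exists n.2 => //; have [] := Nn.
  have lLb (q : G_mod N) : q \in Lb -> (q *: Lb)%g = Lb.
    by move=> qL; apply: (@lcoset_id _ (gimg_group N sL)).
  (* An element of [k[[delta(H)]]] has no part on the cosets that miss [delta(H)]; over the others
     the permutation fixes [Lb]. *)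
  have key (q : G_mod (onX N)) : biact (cg_res q b)
      (alpha (set_val u) (ma_act (m := subset_action N) (mod_snd q)^-1%g Y)) =
      if Y == Lb then biact (cg_res q b) (set_val u) else 0.
    have [qH|/(cg_sub_res bH) ->] := pselect (mod_image (onX N) (@delta G @` H) q);
      last by rewrite !biact0l; case: ifP.
    have qL := qLb _ qH; rewrite ffunE /=.
    have -> : (((mod_snd q)^-1 *: Y)%g == Lb) = (Y == Lb).
      rewrite -[in LHS](lLb _ qL) (inj_eq _)//.
      move=> Y1 Y2 /(congr1 (fun Z => (mod_snd q *: Z)%g)).
      by rewrite -!lcosetM mulgV !lcoset1.
    by case: ifP => // _; exact: biact0r.
  under [RHS]eq_bigr => q _ do rewrite key.
  case: ifP => _; last by rewrite big1.
  by rewrite -biact_suml cg_res_sum.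
pose f : V := alpha' (block_one B).
have fg g Y : cconj g (f Y) = f (ltrans g Y).
  have : cdelta k ((g, g) : G * G) *: f = f by rewrite -linearZ /= block_one_fixed.
  move=> /ffunP/(_ (ltrans g Y)) <-; rewrite perm_scale_delta /=.
  by rewrite -to_modV -/(ltrans _ _) -ltransM mulVg ltrans1.
exists (f Lb).
  move=> l Ll; rewrite -[LHS]/(cconj l _) fg; congr (f _).
  rewrite -[RHS](ltrans1 Lb); apply/(ltrans_gimg sL NL).
  by rewrite mulg1; case: (sL) => _ _; apply.
rewrite cg_traceE -[X in csum _ X](stab_ltrans sL NL).
rewrite (@csum_stab _ _ _ _ (@subgroupT G) (@ltrans1 G N) (@ltransM G N) Lb
  _ _ (f : _ -> kG)) => [|g _]; last by rewrite fg.
(* The sum of [f] over the orbit is the value of [beta f], which is the image of [e] under [phi],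
   that is [e]. *)
have := alpha'E (block_one B) => /ffunP/(_ tt); rewrite !ffunE => <-.
by [].
Qed.

End Converse.


(** * Diagonal subgroups and vertices *)

Section DiagonalSubgroups.
Variable G : profiniteGroupType.

Lemma delta_continuous : continuous (@delta G : G -> (G * G)%type).
Proof. by move=> g; apply: cvg_pair; exact: cvg_id. Qed.

Lemma closed_subgroup_delta (H : set G) :
  closed_subgroup H -> closed_subgroup (@delta G @` H).
Proof.
move=> [[H1 HM HV] cH]; split; last first.
  apply: closed_image => //; first exact: profinite_compact.
  exact: delta_continuous.
split.
- by exists 1%g.
- by move=> _ _ [x Hx <-] [y Hy <-]; exists (x * y)%g => //; exact: HM.
- by move=> _ [x Hx <-]; exists x^-1%g => //; exact: HV.
Qed.

Lemma closed_subgroup_delta_preimage (R : set (G * G)) :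
  closed_subgroup R -> closed_subgroup (@delta G @^-1` R).
Proof.
move=> [[R1 RM RV] cR]; split; last first.
  by apply: preimage_closed => // g _; exact: delta_continuous.
by split=> //= [x y Rx Ry|x Rx]; [exact: (RM _ _ Rx Ry)|exact: (RV _ Rx)].
Qed.

Lemma delta_image_preimage (H : set G) (R : set (G * G)) :
  R `<=` @delta G @` H -> @delta G @` (@delta G @^-1` R) = R.
Proof.
move=> RH; apply/seteqP; split=> [_ [g Rg <-]//|x Rx].
by have [g _ gx] := RH _ Rx; exists g => //=; rewrite gx.
Qed.

Lemma delta_image_subset (H H' : set G) :
  @delta G @` H `<=` @delta G @` H' -> H `<=` H'.
Proof. by move=> HH' g Hg; have [|h Hh [<-]] := HH' (g, g); first by exists g. Qed.

End DiagonalSubgroups.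

(** A closed subgroup of [delta(D)] is the image of its closed preimage in [G], so minimality among
    subgroups of [G x G] inside [delta(D)] is minimality among closed subgroups of [D]. *)
Lemma is_vertex_delta (p : nat) (k : fieldType) (charkp : p \in [pchar k])
    (G : profiniteGroupType) (B : block k G) (D : set G) :
  closed_subgroup D ->
  is_vertex (@delta G @` D) (block_mod B) <->
  minimal_closed (fun H => otrace_image H (block_idem B)) D.
Proof.
have rel_projectiveE H : subgroup H ->
    rel_projective (@delta G @` H) (block_mod B) <-> otrace_image H (block_idem B).
  move=> sH; split; first exact: rel_projective_otrace.
  exact: (@otrace_rel_projective p k charkp G B H sH).
move=> cD; split=> [[_ /rel_projectiveE DB Dmin]|[DB Dmin]].
  split=> [|H cH He HD]; first by apply: DB; case: cD.
  apply/seteqP; split=> //; apply: contrapT => DH.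
  case: (Dmin _ (closed_subgroup_delta cH)); last first.
    by apply/rel_projectiveE => //; case: cH.
  by split=> [|/delta_image_subset//]; exact: image_subset.
split; first exact: closed_subgroup_delta.
  by apply/rel_projectiveE => //; case: cD.
move=> R cR [RD DR] RB; have dR := delta_image_preimage RD.
have cR' := closed_subgroup_delta_preimage cR.
apply: DR; rewrite -dR (Dmin _ cR')//.
  by apply/rel_projectiveE; [case: cR'|rewrite dR].
by apply: delta_image_subset; rewrite dR.
Qed.

Theorem theorem5p18 (p : nat) (k : fieldType) (charkp : p \in [pchar k])
    (G : profiniteGroupType) (B : block k G)
    (D : set G) (closedD : closed_subgroup D) :
  let e := block_idem B in
  [<-> minimal_closed (fun H => otrace_image H e) D;
       minimal_closed (fun H => finite_pindex p H [set: G] /\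
                                modified_trace_image p H [set: G] e) D;
       is_vertex (@delta G @` D) (block_mod B);
       [/\ pro_p p D, otrace_image D e & brauer D e <> brauer D 0];
       maximal_closed (fun H => pro_p p H /\ brauer H e <> brauer H 0) D].
Proof.
move=> e; have ePrim : primitive_central_idempotent e := block_primitive B.
have e0 : e <> 0 by case: ePrim.
(* The ordinary and modified conditions agree for each closed subgroup separately, so their minimal
   subgroups coincide. *)
have traceE H : closed_subgroup H -> otrace_image H e <->
    finite_pindex p H [set: G] /\ modified_trace_image p H [set: G] e.
  move=> [sH _]; split; first exact: otrace_modified_trace.
  by case; exact: modified_trace_otrace.
split=> [[De Dmin]|].
  split=> [|H cH /(traceE _ cH) He]; last exact: Dmin.
  exact/traceE.
split=> [[/(traceE _ closedD) De Dmin]|].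
  apply/(is_vertex_delta charkp _ closedD); split=> // H cH He.
  by apply: Dmin => //; exact/traceE.
split=> [/(is_vertex_delta charkp _ closedD)|].
  exact: minimal_otrace_brauer.
split=> [[]|]; first exact: brauer_otrace_maximal.
exact: maximal_brauer_minimal.
Qed.
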